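(* Consider the control-free case. Let $\mathbb{X},\mathbb{Y},\mathbb{U}$ be compact, let $Q(\cdot|x)$ and $\mathcal{T}(\cdot|x)$ be weakly continuous in $x$, and suppose that either (S) $\{X_t\}$ is stationary, or (B, D) the stochastic kernel $\kappa(dx|y)=P(X_t\in dx|Y_{(-\infty,t]}=y)$ is weakly continuous in $y$ (product topology) and, for every Borel $B\subset\mathbb{X}$ and almost every $y$, $P(X_t\in B|Y_{(-\infty,t]}=y)=P(X_{t+1}\in B|Y_{(-\infty,t+1]}=y)$. If $Y_t$ is uniquely ergodic, and if the filter $\pi_t$ is $\sigma(Y_{(-\infty,t]})$-measurable (in particular, there exists a measurable $g$ with $g(Y_{(-\infty,t]})(A)=\pi_t(A)$ for every Borel $A$), then the filter is uniquely ergodic, i.e. the filter process has exactly one invariant probability measure.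
   Context: Model (control-free): $\mathbb{X}$, $\mathbb{Y}$ are standard Borel (Polish) spaces. $\{X_t\}$ is a Markov chain with kernel $\mathcal{T}(B|x)=P(X_{t+1}\in B|X_t=x)$, and $Y_t=G(X_t,V_t)$ with $V_t$ i.i.d. and independent of the state noise; $Q(C|x)=P(Y_t\in C|X_t=x)$. $\mathbb{U}$ is the decision space; decisions affect only the cost. Infinite past: measurements are assumed to have been taking place since $-\infty$; $\mathbb{Y}^{\mathbb{Z}_-}$ is the one-sided product over $\{\dots,-1,0\}$ with the product topology, and $Y_{(-\infty,t]}$ is viewed as $\mathbb{Y}^{\mathbb{Z}_-}$-valued. The filter process $\pi_t\in\mathcal{P}(\mathbb{X})$ (weak topology) is the conditional distribution of $X_t$ given the measurements and distant prior beliefs, $\pi_t(A)=E[1_{\{X_t\in A\}}\,|\,\sigma(Y_{(-\infty,t]})\vee\sigma(\pi_{(-\infty,-n]})]$ for every $n$; it is a $\mathcal{P}(\mathbb{X})$-valued Markov process, and its invariant probability measures are those of its transition kernel. ''$Y_t$ is uniquely ergodic'' means that the history process $Y_{(-\infty,t]}$ has a unique invariant (stationary) probability measure.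
   Formalization: Measurability of the filter with respect to the observation past is assumed for every filter process of the model satisfying (S) or (B, D), whatever its prior, not only for the given one; otherwise the claim fails (T = identity on two points, trivial Y, X = a, filter = Dirac mass at a). *)

(* Defs.v *)
From HB Require Import structures.
From mathcomp Require Import all_boot all_order all_algebra.
From mathcomp Require Import all_classical all_reals all_analysis.
From mathcomp Require Import measurable_realfun.

Set Implicit Arguments.
Unset Strict Implicit.
Unset Printing Implicit Defensive.

Import Order.TTheory GRing.Theory Num.Theory.
Import numFieldNormedType.Exports.

Local Open Scope classical_set_scope.
Local Open Scope ring_scope.

Definition borel (T : ptopologicalType) : measurableType (@open T).-sigma :=
  g_sigma_algebraType (@open T).

(* A Hausdorff pseudo-metric is a metric, and second countability is
   separability for (pseudo-)metric spaces. *)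
Definition polish (R : realType) (T : completePseudoMetricType R) : Prop :=
  hausdorff_space T /\ @second_countable T.

Definition weakly_continuous (R : realType) (S : topologicalType)
    (T : ptopologicalType) (k : S -> {measure set (borel T) -> \bar R}) : Prop :=
  forall f : T -> R, continuous f -> (exists M, forall x, `|f x| <= M) ->
    continuous (fun s => \int[k s]_x f x).

(* The one-sided product Y^{Z_-}: coordinate k stands for the index -k. *)
Definition history (Y : ptopologicalType) : Type := {ptws nat -> Y}.
HB.instance Definition _ (Y : ptopologicalType) :=
  Topological.copy (history Y) {ptws nat -> Y}.
HB.instance Definition _ (Y : ptopologicalType) :=
  isPointed.Build (history Y) (fun=> point).

Section processes.
Context (R : realType) (d : measure_display) (Omega : measurableType d)
  (P : probability Omega R).

(* Generators of sigma(Z_s : s <= t). *)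
Definition past d' (E : measurableType d') (Z : int -> Omega -> E) (t : int) :
    set (set Omega) :=
  \bigcup_(s in [set s | s <= t]) preimage_set_system setT (Z s) measurable.

(* W is a version of P(A | sigma(G)), where G is a set of generators; W itself
   is only required to be a.s. equal to a sigma(G)-measurable function. *)
Definition cond_prob (G : set (set Omega)) (A : set Omega)
    (W : Omega -> \bar R) : Prop :=
  exists W' : Omega -> \bar R,
    [/\ measurable_fun setT (W' : g_sigma_algebraType G -> \bar R),
        forall E, <<s G >> E -> P (A `&` E) = (\int[P]_(w in E) W' w)%E &
        {ae P, forall w, W w = W' w} ].

Definition stationary d' (E : measurableType d') (Z : int -> Omega -> E) :
    Prop :=
  forall (n : nat) (s : 'I_n -> int) (B : 'I_n -> set E),
    (forall i, measurable (B i)) ->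
    P (\bigcap_(i in [set: 'I_n]) (Z (s i + 1) @^-1` B i)) =
    P (\bigcap_(i in [set: 'I_n]) (Z (s i) @^-1` B i)).

End processes.

Section model.
Context (R : realType) (X Y V : completePseudoMetricType R).
Context (T : R.-pker (borel X) ~> (borel X)) (nu : probability (borel V) R)
  (G : borel X * borel V -> borel Y) (Q : R.-pker (borel X) ~> (borel Y)).

Section on_a_probability_space.
Context (d : measure_display) (Omega : measurableType d)
  (P : probability Omega R) (F : int -> set (set Omega))
  (Xp : int -> Omega -> borel X) (Vp : int -> Omega -> borel V)
  (pit : int -> Omega -> pprobability (borel X) R).

Definition obs (t : int) (w : Omega) : borel Y := G (Xp t w, Vp t w).

Definition obs_past (t : int) (w : Omega) : borel (history Y) :=
  fun k : nat => obs (t - k%:Z) w.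

Record hidden_markov : Prop := HiddenMarkov {
  filtration_sigma_algebra : forall t, sigma_algebra setT (F t) ;
  filtration_measurable : forall t, F t `<=` measurable ;
  filtration_nondecreasing : forall t, F t `<=` F (t + 1) ;
  state_adapted : forall t B, measurable B -> F t (Xp t @^-1` B) ;
  noise_adapted : forall t D, measurable D -> F t (Vp t @^-1` D) ;
  state_markov : forall t B E, measurable B -> F t E ->
    P (E `&` (Xp (t + 1) @^-1` B)) = (\int[P]_(w in E) T (Xp t w) B)%E ;
  (* V_{t+1} has law nu and is independent of F_t and X_{t+1} *)
  noise_iid : forall t D E, measurable D ->
    <<s F t `|` preimage_set_system setT (Xp (t + 1)) measurable >> E ->
    P (E `&` (Vp (t + 1) @^-1` D)) = (P E * nu D)%E }.

(* The beliefs are adapted to F, hence the distant prior beliefs carry no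
   information on the future noises. *)
Record filter_process : Prop := FilterProcess {
  filter_hidden_markov : hidden_markov ;
  filter_adapted : forall t S, measurable S -> F t (pit t @^-1` S) ;
  filter_cond_prob : forall t m, m <= t -> forall A, measurable A ->
    cond_prob P (past obs t `|` past pit m) (Xp t @^-1` A)
      (fun w => (pit t w : probability _ R) A) }.

(* kappa t is a version of P(X_t in dx | Y_(-oo,t] = y).  As these conditional
   probabilities are determined only up to null sets of the law of Y_(-oo,t],
   time invariance is required almost everywhere for the laws of both
   Y_(-oo,t] and Y_(-oo,t+1]. *)
Definition continuous_invariant_posterior : Prop :=
  exists kappa : int -> R.-pker (borel (history Y)) ~> (borel X),
    [/\ forall t, weakly_continuous (fun y : history Y => kappa t y),
        forall t A, measurable A ->
          cond_prob P (past obs t) (Xp t @^-1` A)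
            (fun w => kappa t (obs_past t w) A) &
        forall t A, measurable A ->
          {ae P, forall w,
             kappa t (obs_past t w) A = kappa (t + 1) (obs_past t w) A} /\
          {ae P, forall w,
             kappa t (obs_past (t + 1) w) A =
             kappa (t + 1) (obs_past (t + 1) w) A} ].

Definition stationary_or_posterior : Prop :=
  stationary P Xp \/ continuous_invariant_posterior.

Definition filter_obs_measurable : Prop :=
  forall t, exists g : borel (history Y) -> pprobability (borel X) R,
    measurable_fun setT g /\
    forall A, measurable A ->
      {ae P, forall w, (g (obs_past t w) : probability _ R) A =
                       (pit t w : probability _ R) A}.

End on_a_probability_space.

(* lambda is the law of Y_(-oo,t], for every t, for some realization of the
   model.  The conditional law of X_t given Y_(-oo,t], and with it the
   transition probability of the history process, depends on the realization;
   so invariance of lambda is expressed by stationarity. *)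
Definition history_invariant (lambda : probability (borel (history Y)) R) : Prop :=
  exists (d : measure_display) (Omega : measurableType d)
    (P : probability Omega R) (F : int -> set (set Omega))
    (Xp : int -> Omega -> borel X) (Vp : int -> Omega -> borel V),
    hidden_markov P F Xp Vp /\
    forall t S, measurable S -> P (obs_past Xp Vp t @^-1` S) = lambda S.

(* Equality of probability measures is equality on the measurable sets. *)
Definition exactly_one_probability d (E : measurableType d)
    (I : probability E R -> Prop) : Prop :=
  exists mu, I mu /\
    forall mu', I mu' -> forall S, measurable S -> mu' S = mu S.

Definition obs_uniquely_ergodic : Prop :=
  exactly_one_probability history_invariant.

(* Phi(p, y) = P(X_{t+1} in . | pi_t = p, Y_{t+1} = y): given pi_t = p,
   (X_{t+1}, Y_{t+1}) has law p(dx) T(dx'|x) Q(dy|x'), and Phi(p, .) is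
   a disintegration of it with respect to its second marginal. *)
Definition filter_update
    (Phi : pprobability (borel X) R * borel Y -> pprobability (borel X) R) :
    Prop :=
  measurable_fun setT Phi /\
  forall (p : probability (borel X) R) A C, measurable A -> measurable C ->
    (\int[p]_x \int[T x]_x' \int[Q x']_(y in C)
       (Phi (p, y) : probability _ R) A =
     \int[p]_x \int[T x]_(x' in A) Q x' C)%E.

(* P(pi_{t+1} in S | pi_t = p) *)
Definition filter_transition
    (Phi : pprobability (borel X) R * borel Y -> pprobability (borel X) R)
    (p : pprobability (borel X) R) (S : set (pprobability (borel X) R)) :
    \bar R :=
  (\int[(p : probability _ R)]_x \int[T x]_x' Q x' [set y | S (Phi (p, y))])%E.

(* The sigma-algebra of pprobability, generated by the evaluations p |-> p A,
   is the Borel sigma-algebra of the weak topology. *)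
Definition filter_invariant
    (Phi : pprobability (borel X) R * borel Y -> pprobability (borel X) R)
    (mu : probability (pprobability (borel X) R) R) : Prop :=
  forall S, measurable S -> mu S = (\int[mu]_p filter_transition Phi p S)%E.

End model.

(* Main.v *)
(* Uniqueness.  An invariant law mu of the filter is the law of the belief in a
   stationary two-sided joint process (belief, state, noise) whose beliefs are
   updated by Phi; there the belief is the conditional law of the state given
   the past observations and beliefs, so it is a filter process with a
   stationary state.  For two invariant laws, the average of the two joint laws
   is again one, and measurability of the filter gives one function g with
   belief = g(Y_(-oo,0]) almost surely under both.  So both invariant laws are
   images under g of laws of Y_(-oo,0], and these coincide by unique ergodicity
   of the observations.  Averaging is needed because the g provided for each
   joint law separately could differ.

   Existence.  By compactness and weak continuity T has an invariant law
   (Krylov-Bogoliubov).  In a stationary two-sided realization of the model, the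
   posterior g(Y_(-oo,t]) of the state satisfies the update equation
   g(Y_(-oo,1]) = Phi(g(Y_(-oo,0]), Y_1) almost surely by Bayes' rule, so its
   law is invariant.

   Measures are constructed on the Cantor space: every standard Borel space
   involved embeds in it as a measurable retract, an ultralimit of probabilities
   on the Cantor space exists since cylinders are clopen, and a probability with
   prescribed masses of cylinders is an image of the uniform law on [0, 1]. *)
Require Import Defs.
From HB Require Import structures.
From mathcomp Require Import all_boot all_order all_algebra.
From mathcomp Require Import all_classical all_reals all_analysis.
From mathcomp Require Import measurable_realfun.
From mathcomp Require Import zify ring lra.

Set Implicit Arguments.
Unset Strict Implicit.
Unset Printing Implicit Defensive.

Import Order.TTheory GRing.Theory Num.Theory.
Import numFieldNormedType.Exports.

Local Open Scope classical_set_scope.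
Local Open Scope ring_scope.

(** A conditional law is handled as a disintegration: an identity between integrals, for all
    nonnegative measurable functions of the pair (conditioning variable, value). For a fixed kernel
    this identity is linear in the underlying probability, which is why the average of two joint
    laws of (belief, state, noise) is again such a law. Each summand is absolutely continuous with
    respect to the average, so an almost sure identity between the belief and g(Y_(-oo,0]) descends
    to both.

    The delicate point of uniqueness is that the belief must be a posterior given the entire past,
    whereas the construction from an invariant law only makes it the conditional law of the state
    given the belief itself. The past is restored one observation at a time by Bayes' rule, over
    windows of growing length and at all times simultaneously; the infinite past is reached because
    events depending on finite windows generate it. *)

Lemma integral_indicT d (A : measurableType d) (R : realType)
    (m : {measure set A -> \bar R}) S :
  measurable S -> (\int[m]_x (\1_S x)%:E = m S)%E.
Proof. by move=> mS; rewrite integral_indic// setIT. Qed.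

(** * Probability kernels and disintegrations *)

Section pi_systems.
Context d (T : measurableType d) (R : realType).

Lemma finite_measure_unique (G : set (set T)) (m1 m2 : {measure set T -> \bar R}) :
  G `<=` measurable -> setI_closed G -> G setT -> (m1 setT < +oo)%E ->
  (forall A, G A -> m1 A = m2 A) -> forall A, <<s G >> A -> m1 A = m2 A.
Proof.
move=> Gm GI GT fm1 eqG A sA.
apply: (@g_sigma_algebra_measure_unique _ _ _ G Gm (fun=> setT)) => //.
by rewrite -subTset => x _; exists 0%N.
Qed.

(** The class [G] may lack the whole space; adjoining it is harmless, as both masses are 1. *)
Lemma probability_unique (G : set (set T)) (m1 m2 : probability T R) :
  @measurable _ T = <<s G >> -> setI_closed G ->
  (forall A, G A -> m1 A = m2 A) -> forall A, measurable A -> m1 A = m2 A.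
Proof.
move=> mG GI eqG A mA.
pose G' := G `|` [set setT].
have GG' : G `<=` G' by left.
have G'm : G' `<=` measurable.
  by move=> B [GB|->//]; rewrite mG; exact: sub_sigma_algebra.
apply: (finite_measure_unique (G := G')) => //.
- move=> B C [GB|->] [GC|->]; rewrite ?setIT ?setTI; [left; exact: GI|by left..|].
  by right.
- by right.
- by rewrite [ltLHS]probability_setT ltry.
- by move=> B [/eqG//|->]; rewrite [LHS]probability_setT [RHS]probability_setT.
- by move: A mA; rewrite mG; apply: sub_sigma_algebra2.
Qed.

End pi_systems.

Section plaw.
Context d d' (A : measurableType d) (B : measurableType d') (R : realType).
Variables (P : probability A R) (f : A -> B) (mf : measurable_fun setT f).

(** The proof of measurability is an argument so that the measure structures declared below, which
    depend on it, can be inferred from the term. *)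
Definition plaw of measurable_fun setT f : set B -> \bar R := pushforward P f.

Let plaw0 : plaw mf set0 = 0%E.
Proof. by rewrite /plaw /pushforward preimage_set0 measure0. Qed.

Let plaw_ge0 S : (0 <= plaw mf S)%E.
Proof. exact: measure_ge0. Qed.

Let plaw_sigma_additive : semi_sigma_additive (plaw mf).
Proof.
move=> F mF tF mUF; rewrite /plaw /pushforward preimage_bigcup.
apply: measure_semi_sigma_additive.
- by move=> n; rewrite -[X in measurable X]setTI; exact: mf.
- apply/trivIsetP => /= i j _ _ ij; rewrite -preimage_setI.
  by move/trivIsetP : tF => /(_ _ _ _ _ ij) ->//; rewrite preimage_set0.
- by rewrite -preimage_bigcup -[X in measurable X]setTI; exact: mf.
Qed.

HB.instance Definition _ := isMeasure.Build _ _ _ (plaw mf)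
  plaw0 plaw_ge0 plaw_sigma_additive.

Let plaw_setT : plaw mf setT = 1%E.
Proof. by rewrite /plaw /pushforward preimage_setT probability_setT. Qed.

HB.instance Definition _ := Measure_isProbability.Build _ _ _ (plaw mf) plaw_setT.

Lemma ge0_integral_plaw (h : B -> \bar R) :
  measurable_fun setT h -> (forall y, 0 <= h y)%E ->
  (\int[plaw mf]_y h y = \int[P]_x h (f x))%E.
Proof.
by move=> mh h0; rewrite ge0_integral_pushforward//= preimage_setT.
Qed.

End plaw.

Section mbind.
Context d d' (A : measurableType d) (B : measurableType d') (R : realType).
Variables (m : probability A R) (k : R.-pker A ~> B).

Definition mbind (S : set B) : \bar R := (\int[m]_a k a S)%E.

Let mbind0 : mbind set0 = 0%E.
Proof. by rewrite /mbind integral0_eq. Qed.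

Let mbind_ge0 S : (0 <= mbind S)%E.
Proof. exact: integral_ge0. Qed.

Let mbind_sigma_additive : semi_sigma_additive mbind.
Proof.
move=> F mF tF mUF; rewrite /mbind.
have -> : (\int[m]_a k a (\bigcup_n F n) =
           \sum_(0 <= n <oo) \int[m]_a k a (F n))%E.
  rewrite -integral_nneseries//; last by move=> n; exact: measurable_kernel.
  apply: eq_integral => a _; apply/esym/cvg_lim => //.
  exact: measure_semi_sigma_additive.
by apply: is_cvg_nneseries => n _ _; exact: integral_ge0.
Qed.

HB.instance Definition _ := isMeasure.Build _ _ _ mbind
  mbind0 mbind_ge0 mbind_sigma_additive.

Let mbind_setT : mbind setT = 1%E.
Proof.
rewrite /mbind; under eq_integral do rewrite prob_kernel.
by rewrite integral_cst// mul1e; exact: probability_setT.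
Qed.

HB.instance Definition _ := Measure_isProbability.Build _ _ _ mbind mbind_setT.

End mbind.

Section kmap.
Context d d' d'' (A : measurableType d) (B : measurableType d')
  (C : measurableType d'') (R : realType).
Variables (k : R.-pker A ~> B) (f : C -> A) (mf : measurable_fun setT f).

Definition kmap of measurable_fun setT f : C -> {measure set B -> \bar R} :=
  fun c => k (f c).

Let measurable_kmap U : measurable U -> measurable_fun setT (kmap mf ^~ U).
Proof.
by move=> mU; apply: (measurableT_comp (measurable_kernel k U mU)).
Qed.

HB.instance Definition _ := isKernel.Build _ _ _ _ _ (kmap mf) measurable_kmap.

Let kmap_prob c : kmap mf c setT = 1%E.
Proof. exact: prob_kernel. Qed.

HB.instance Definition _ := Kernel_isProbability.Build _ _ _ _ _ (kmap mf) kmap_prob.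

End kmap.

Lemma ge0_integral_mbind d d' (A : measurableType d) (B : measurableType d')
    (R : realType) (m : probability A R) (k : R.-pker A ~> B) (h : B -> \bar R) :
  measurable_fun setT h -> (forall y, 0 <= h y)%E ->
  (\int[mbind m k]_y h y = \int[m]_a \int[k a]_b h b)%E.
Proof.
move=> mh h0.
(* The integration formula is known for compositions of kernels, so [m] is read as a kernel from the
   one-point space. *)
pose cm : unit -> pprobability A R := fun=> (m : probability A R).
have mcm : measurable_fun setT cm by exact: measurable_cst.
have := @integral_kcomp _ _ _ _ _ _ _ (kprobability mcm)
  (kmap k (@measurable_snd _ _ unit A)) tt h h0 mh.
by [].
Qed.

Lemma measurable_pprobability d d' (A : measurableType d) (B : measurableType d')
    (R : realType) (f : A -> pprobability B R) :
  (forall U, measurable U ->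
     measurable_fun setT (fun a => (f a : probability B R) U)) ->
  measurable_fun setT f.
Proof.
move=> mf; apply: (@measurability _ _ _ _ setT f (@pset _ B R)) => //.
move=> _ [_ [r r01] [U mU <-]] <-.
rewrite setTI.
have -> : f @^-1` mset U r = (fun a => (f a : probability B R) U) @^-1` `]-oo, r%:E[%classic.
  by apply/seteqP; split => a /=; rewrite in_itv.
by rewrite -[X in measurable X]setTI; apply: (mf U mU measurableT); exact: emeasurable_itv.
Qed.

Section kprob.
Context d d' (A : measurableType d) (B : measurableType d') (R : realType).
Variable k : R.-pker A ~> B.

(** The value of a probability kernel is typed as a mere measure; this copy carries the probability
    structure. *)
Definition kprob (a : A) : set B -> \bar R := k a.

HB.instance Definition _ a := Measure.on (kprob a).

Let kprob_setT a : kprob a setT = 1%E.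
Proof. exact: prob_kernel. Qed.

HB.instance Definition _ a :=
  Measure_isProbability.Build _ _ _ (kprob a) (kprob_setT a).

End kprob.

Section kgraph.
Context d d' (A : measurableType d) (B : measurableType d') (R : realType).
Variable k : R.-pker A ~> B.

(** The product of the Dirac mass at [a] with [k a]; [mbind m (kgraph k)] is then the joint law of a
    point drawn from [m] and of its image under the kernel. *)
Definition kgraph (a : A) : {measure set (A * B) -> \bar R} :=
  plaw (kprob k a) (pair1_measurable a).

Let measurable_kgraph U : measurable U -> measurable_fun setT (kgraph ^~ U).
Proof.
move=> mU.
have := @measurable_fun_xsection_finite_kernel _ _ _ _ R k U (mem_set mU).
by congr (measurable_fun _ _); apply/funext => a; rewrite /kgraph /= /plaw
  /pushforward xsectionE.
Qed.

HB.instance Definition _ := isKernel.Build _ _ _ _ _ kgraph measurable_kgraph.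

Let kgraph_prob a : kgraph a setT = 1%E.
Proof. exact: (@probability_setT _ _ _ (plaw (kprob k a) (pair1_measurable a))). Qed.

HB.instance Definition _ := Kernel_isProbability.Build _ _ _ _ _ kgraph kgraph_prob.

Lemma kgraphX a S D : kgraph a (S `*` D) = if a \in S then k a D else 0%E.
Proof.
rewrite /kgraph /plaw /pushforward /=; case: ifPn => [/set_mem Sa|/negP nSa].
  have -> : pair a @^-1` (S `*` D) = D by apply/seteqP; split => b /=; tauto.
  by [].
have -> : pair a @^-1` (S `*` D) = set0; last by rewrite (measure0 (kprob k a)).
by apply/seteqP; split => b //= -[Sa _]; apply: nSa; exact: mem_set.
Qed.

End kgraph.

Section disint.
Context d d1 d2 (Omega : measurableType d) (A : measurableType d1)
  (B : measurableType d2) (R : realType).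

(** [k (z w)] is a regular conditional law of [x] given [z]. Testing against functions of the pair,
    and not only on rectangles, allows direct substitution in later computations. *)
Definition disint (P : probability Omega R) (z : Omega -> A) (x : Omega -> B)
    (k : A -> {measure set B -> \bar R}) :=
  forall h : A * B -> \bar R, measurable_fun setT h ->
    (forall ab, 0 <= h ab)%E ->
  (\int[P]_w h (z w, x w) = \int[P]_w \int[k (z w)]_b h (z w, b))%E.

(** Rectangles with first side in the pi-system form a pi-system generating the product
    sigma-algebra. So the joint law of [z] and [x] is the law built from [kgraph k], and integrals
    of all nonnegative functions agree. *)
Lemma disintP (G : set (set A)) (P : probability Omega R) (z : Omega -> A)
    (x : Omega -> B) (k : R.-pker A ~> B) :
  @measurable _ A = <<s G >> -> setI_closed G -> G setT ->
  measurable_fun setT z -> measurable_fun setT x ->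
  (forall S C, G S -> measurable C ->
    P (z @^-1` S `&` x @^-1` C) = \int[P]_(w in z @^-1` S) k (z w) C)%E ->
  disint P z x k.
Proof.
move=> mG GI GT mz mx eqP h mh h0.
pose m1 := plaw P (measurable_fun_pair mz mx).
pose m2 := mbind (plaw P mz) (kgraph k).
have Gm S : G S -> measurable S by rewrite mG; exact: sub_sigma_algebra.
have m12 : forall D, measurable D -> m1 D = m2 D.
  apply: (probability_unique (G := [set S `*` C | S in G & C in measurable])).
  - rewrite eqEsubset; split.
      rewrite measurable_prod_measurableType.
      apply: smallest_sub; first exact: smallest_sigma_algebra.
      move=> _ [S mS] [C mC] <-.
      have -> : S `*` C = (S `*` setT) `&` (setT `*` C).
        by apply/seteqP; split => -[a b] /=; tauto.
      apply: (@measurableI _ (g_sigma_algebraType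
        [set S `*` C | S in G & C in measurable])); last first.
        by apply: sub_sigma_algebra; exists setT => //; exists C.
      move: S mS; rewrite mG.
      have := @g_sigma_preimageE (A * B)%type A setT fst G.
      move=> E S mS.
      have : preimage_set_system setT (@fst A B) (@measurable _ (g_sigma_algebraType G)) (S `*` setT).
        exists S => //; rewrite setTI; apply/seteqP; split => -[a b] //=; tauto.
      rewrite -E; apply: smallest_sub; first exact: smallest_sigma_algebra.
      move=> _ [S' GS' <-]; apply: sub_sigma_algebra; exists S' => //; exists setT => //.
      by rewrite setTI; apply/seteqP; split => -[a b] //=; tauto.
    apply: smallest_sub; first exact: sigma_algebra_measurable.
    by move=> _ [S /Gm mS] [C mC] <-; exact: measurableX.
  - move=> _ _ [S GS] [C mC] <- [S' GS'] [C' mC'] <-.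
    rewrite -setXI; exists (S `&` S'); first exact: GI.
    by exists (C `&` C') => //; exact: measurableI.
  - move=> _ [S GS] [C mC] <-.
    transitivity (P (z @^-1` S `&` x @^-1` C)) => //.
    rewrite eqP// /m2 /= /mbind.
    rewrite ge0_integral_plaw//; last by apply: measurable_kernel; apply: measurableX => //; exact: Gm.
    rewrite integral_mkcond; apply: eq_integral => w _ /=.
    by rewrite patchE; exact/esym/(kgraphX k (z w) S C).
transitivity (\int[m1]_ab h ab)%E.
  by rewrite /m1 ge0_integral_plaw.
rewrite (eq_measure_integral m2); last by move=> D mD _; exact: m12.
rewrite /m2 ge0_integral_mbind// ge0_integral_plaw//.
- apply: eq_integral => w _; rewrite /kgraph.
  by rewrite ge0_integral_plaw.
- exact: measurable_fun_integral_kernel (measurable_kernel (kgraph k)) h h0 mh.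
- by move=> a; exact: integral_ge0.
Qed.

End disint.

(** * Product sigma-algebras *)

Section coordinates.
Context (I : choiceType) d (E : measurableType d) d' (Omega : measurableType d').
Implicit Types (J : set I) (Z : I -> Omega -> E).

Definition coords J Z : set (set Omega) :=
  \bigcup_(i in J) preimage_set_system setT (Z i) measurable.

(** Finite-dimensional rectangles with constraints in [J] only: a pi-system generating the same
    sigma-algebra as [coords], to which uniqueness of measures applies. *)
Definition boxes J Z : set (set Omega) :=
  [set B | exists A : I -> set E, [/\ forall i, measurable (A i),
     exists s : seq I, forall i, i \notin s -> A i = setT,
     forall i, ~ J i -> A i = setT & B = [set w | forall i, A i (Z i w)]]].

Lemma boxes_setI_closed J Z : setI_closed (boxes J Z).
Proof.
move=> _ _ [A [mA [s As] AJ ->]] [A' [mA' [s' As'] AJ' ->]].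
exists (fun i => A i `&` A' i); split.
- by move=> i; exact: measurableI.
- by exists (s ++ s') => i; rewrite mem_cat negb_or => /andP[/As -> /As' ->]; rewrite setTI.
- by move=> i nJ; rewrite AJ// AJ'// setTI.
- by apply/seteqP; split => w /= => [[Aw A'w] i|AA']; [split|split => i; case: (AA' i)].
Qed.

Lemma boxes_setT J Z : boxes J Z setT.
Proof.
exists (fun=> setT); split => //; first by exists [::].
by apply/seteqP; split.
Qed.

Lemma sigma_boxes J Z : <<s boxes J Z >> = <<s coords J Z >>.
Proof.
rewrite eqEsubset; split.
  apply: smallest_sub; first exact: smallest_sigma_algebra.
  move=> _ [A [mA [s As] AJ ->]].
  have -> : [set w | forall i, A i (Z i w)] = \big[setI/setT]_(i <- s) (Z i @^-1` A i) :> set Omega.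
    rewrite -bigcap_seq; apply/seteqP; split => w /= => [Aw i _|Aw i]; first exact: Aw.
    have [is_|/As ->//] := boolP (i \in s).
    exact: (Aw i is_).
  apply: (@bigsetI_measurable _ (g_sigma_algebraType (coords J Z))) => i _.
  have [Ji|/AJ ->] := pselect (J i); last exact: (@measurableT _ (g_sigma_algebraType (coords J Z))).
  by apply: sub_sigma_algebra; exists i => //; exists (A i) => //; rewrite setTI.
apply: sub_sigma_algebra2 => _ [i Ji [C mC <-]].
exists (fun j => if j == i then C else setT); split.
- by move=> j; case: ifP.
- by exists [:: i] => j; rewrite inE => /negbTE ->.
- by move=> j nJ; case: eqP => // ji; rewrite ji in nJ.
- rewrite setTI; apply/seteqP; split => w /=; last by move=> /(_ i); rewrite eqxx.
  by move=> Cw j; case: eqP => // ->.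
Qed.

End coordinates.

Section path.
Context (I : choiceType) d (E : measurableType d).

Definition path_gen : set (set (I -> E)) :=
  \bigcup_(i in setT) preimage_set_system setT (fun h : I -> E => h i) measurable.

Definition paths : measurableType path_gen.-sigma := g_sigma_algebraType path_gen.

Lemma measurable_coord (i : I) : measurable_fun setT (fun h : paths => h i : E).
Proof. by move=> _ C mC; apply: sub_sigma_algebra; exists i => //; exists C. Qed.

Lemma measurable_path d' (A : measurableType d') (f : A -> paths) :
  (forall i, measurable_fun setT (fun a => f a i : E)) -> measurable_fun setT f.
Proof.
move=> mf; apply: (@measurability _ _ _ _ setT f path_gen) => //.
move=> _ [_ [i _ [C mC <-]] <-]; rewrite !setTI.
by rewrite -[X in measurable X]setTI; exact: (mf i measurableT C mC).
Qed.

Lemma measurable_fun_coord d' (A : measurableType d') (f : A -> paths) i :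
  measurable_fun setT f -> measurable_fun setT (fun a => f a i : E).
Proof. by move=> mf; exact: (measurableT_comp (measurable_coord i) mf). Qed.

Lemma measurable_pathE :
  @measurable _ paths = <<s boxes setT (fun i (h : paths) => h i : E) >>.
Proof. by rewrite sigma_boxes. Qed.

End path.
Arguments paths I {d} E.

Section indist.

(* The sigma-algebra of [pprobability] does not separate points, since a
   [probability] carries arbitrary values on the non-measurable sets; so points
   are compared through measurable sets only. *)
Definition indist d (A : measurableType d) (x y : A) :=
  forall S, measurable S -> S x <-> S y.

Lemma indist_refl d (A : measurableType d) (x : A) : indist x x.
Proof. by []. Qed.

Lemma indist_sym d (A : measurableType d) (x y : A) : indist x y -> indist y x.
Proof. by move=> xy S mS; apply: iff_sym; exact: xy. Qed.

Lemma indist_trans d (A : measurableType d) (x y z : A) :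
  indist x y -> indist y z -> indist x z.
Proof. by move=> xy yz S mS; rewrite xy// yz. Qed.

Lemma indist_gen d (A : measurableType d) (G : set (set A)) (x y : A) :
  @measurable _ A = <<s G >> -> (forall S, G S -> S x <-> S y) -> indist x y.
Proof.
move=> mG Gxy; rewrite /indist mG.
have : <<s G >> `<=` [set S | S x <-> S y].
  apply: smallest_sub => //; split => //=.
  - by move=> S [Sxy Syx]; split => -[_ nS]; split => // ?; apply: nS; [exact: Syx|exact: Sxy].
  - by move=> F Fxy; split => -[n _] /Fxy; exists n.
by [].
Qed.

Lemma indist_map d d' (A : measurableType d) (B : measurableType d')
    (f : A -> B) x y : measurable_fun setT f -> indist x y -> indist (f x) (f y).
Proof.
move=> mf xy S mS.
by apply: (xy (f @^-1` S)); rewrite -[X in measurable X]setTI; exact: mf.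
Qed.

Lemma indist_pair d d' (A : measurableType d) (B : measurableType d')
    (x x' : A) (y y' : B) : indist x x' -> indist y y' -> indist (x, y) (x', y').
Proof.
move=> xx' yy'; apply: indist_trans (indist_map (pair1_measurable x') yy').
exact: (indist_map (pair2_measurable y) xx').
Qed.

Lemma indist_path (I : choiceType) d (A : measurableType d) (h h' : paths I A) :
  (forall i, indist (h i : A) (h' i)) -> indist h h'.
Proof.
move=> hh'; apply: (@indist_gen _ (paths I A) (@path_gen I _ A)) => //.
by move=> _ [i _ [C mC <-]]; rewrite setTI /=; exact: hh'.
Qed.

(** Singletons of the extended reals are measurable, so indistinguishability there is equality; this
    is how integrals ignore the points that measurable sets cannot separate. *)
Lemma indist_ereal d (A : measurableType d) (R : realType) (f : A -> \bar R) x y :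
  measurable_fun setT f -> indist x y -> f x = f y.
Proof.
move=> mf xy.
have /(_ erefl)/= := (indist_map mf xy (emeasurable_set1 (f x))).1.
by move=> ->.
Qed.

End indist.

Lemma integral_comp_plaw d d' d'' (A : measurableType d) (A' : measurableType d')
    (B : measurableType d'') (R : realType) (P : probability A R)
    (P' : probability A' R) (f : A -> B) (f' : A' -> B) (h : B -> \bar R) :
  measurable_fun setT f -> measurable_fun setT f' ->
  (forall S, measurable S -> P (f @^-1` S) = P' (f' @^-1` S)) ->
  measurable_fun setT h -> (forall b, 0 <= h b)%E ->
  (\int[P]_a h (f a) = \int[P']_a h (f' a))%E.
Proof.
move=> mf mf' eqP mh h0.
rewrite -(ge0_integral_plaw P mf)// -(ge0_integral_plaw P' mf')//.
by apply: eq_measure_integral => S mS _; exact: eqP.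
Qed.

Lemma law_of_integrals d d' d'' (A : measurableType d) (A' : measurableType d')
    (B : measurableType d'') (R : realType) (P : probability A R)
    (P' : probability A' R) (f : A -> B) (f' : A' -> B) :
  measurable_fun setT f -> measurable_fun setT f' ->
  (forall h : B -> \bar R, measurable_fun setT h -> (forall b, 0 <= h b)%E ->
    \int[P]_a h (f a) = \int[P']_a h (f' a))%E ->
  forall S, measurable S -> P (f @^-1` S) = P' (f' @^-1` S).
Proof.
move=> mf mf' eqI S mS.
have mfS : measurable (f @^-1` S) by rewrite -[X in measurable X]setTI; exact: mf.
have mfS' : measurable (f' @^-1` S) by rewrite -[X in measurable X]setTI; exact: mf'.
have := eqI (fun b => (\1_S b)%:E).
have -> : (fun a => (\1_S (f a))%:E) = (fun a => (\1_(f @^-1` S) a)%:E) :> (_ -> \bar R).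
  by apply/funext => a.
have -> : (fun a => (\1_S (f' a))%:E) = (fun a => (\1_(f' @^-1` S) a)%:E) :> (_ -> \bar R).
  by apply/funext => a.
rewrite !integral_indic// !setIT; apply.
  exact/measurable_EFinP.
by move=> b; rewrite lee_fin.
Qed.

(** * Probabilities on the Cantor space *)

Definition bits := paths nat bool.

Section interval_coding.
Context (R : realType).
Implicit Types (w : seq bool -> R) (p : seq bool) (u : R).

(* Prefixes of bit sequences are listed backwards, the last bit first; the
   prefix p is coded by the interval [lo w p, lo w p + w p[. *)
Fixpoint lo w p : R :=
  if p is b :: p' then lo w p' + (if b then w (false :: p') else 0) else 0.

Fixpoint code_prefix w u n : seq bool :=
  if n is m.+1 then
    let p := code_prefix w u m in (lo w p + w (false :: p) <= u) :: p
  else [::].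

Definition code_bits w u : bits :=
  fun n => let p := code_prefix w u n in lo w p + w (false :: p) <= u.

Fixpoint cyl p : set bits :=
  if p is b :: p' then cyl p' `&` [set x : bits | x (size p') = b] else setT.

(** The consistency conditions met by the masses of the cylinders of a probability. *)
Definition weights w :=
  [/\ w [::] = 1, forall p, w p = w (true :: p) + w (false :: p)
    & forall p, 0 <= w p].

Lemma size_code_prefix w u n : size (code_prefix w u n) = n.
Proof. by elim: n => //= n ->. Qed.

Lemma code_bits_cyl w u p : cyl p (code_bits w u) <-> code_prefix w u (size p) = p.
Proof.
elim: p => //= b p IH; split.
  by move=> [/IH pp]; rewrite /code_bits pp => ->.
by move=> [] bE /[dup] pE /IH ?; split => //; rewrite /code_bits pE -bE pE.
Qed.

(** The interval of [p] is cut into that of [false :: p] on the left and that of [true :: p] on the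
    right; the next bit says on which side of the cut [u] lies. *)
Lemma code_prefixE w u p : weights w -> 0 <= u < 1 ->
  code_prefix w u (size p) = p <-> lo w p <= u < lo w p + w p.
Proof.
move=> [w1 wD w0] u01; elim: p => [|b p IH] /=; first by rewrite w1 add0r.
split.
  move=> [] + pE; rewrite pE => bE.
  have /andP[l1 l2] := IH.1 pE.
  move: (wD p) bE (w0 (false :: p)) (w0 (true :: p)).
  by case: b; lra.
move=> bI; have pI : lo w p <= u < lo w p + w p.
  move: (wD p) (w0 (false :: p)) (w0 (true :: p)) bI.
  by case: b; lra.
rewrite (IH.2 pI); congr (_ :: _).
by move: bI; case: b; lra.
Qed.

Lemma lo_bounds w p : weights w -> 0 <= lo w p /\ lo w p + w p <= 1.
Proof.
move=> [w1 wD w0]; elim: p => [|b p [IH1 IH2]] /=; first by rewrite w1 add0r.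
move: (wD p) (w0 (false :: p)) (w0 (true :: p)).
by case: b; split; lra.
Qed.

Definition unif01 : set (measurableTypeR R) -> \bar R :=
  mrestr lebesgue_measure (measurable_itv `[0, 1[).

HB.instance Definition _ := Measure.on unif01.

Let unif01_setT : unif01 setT = 1%E.
Proof.
by rewrite /unif01 /= /mrestr setTI lebesgue_measure_itv/= lte_fin ltr01 sube0.
Qed.

HB.instance Definition _ := Measure_isProbability.Build _ _ _ unif01 unif01_setT.

(** A cylinder pulls back to its coding interval, of length [w p]. Hence any weights are the
    cylinder masses of an image of the uniform law, without an extension theorem for measures. *)
Lemma unif01_cyl w p : weights w ->
  unif01 [set u | cyl p (code_bits w u)] = (w p)%:E.
Proof.
move=> ww; rewrite /unif01 /mrestr.
have [l0 l1] := lo_bounds p ww.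
have -> : [set u | cyl p (code_bits w u)] `&` `[0, 1[ = `[lo w p, lo w p + w p[%classic.
  apply/seteqP; split => u /=; rewrite !in_itv/=.
    by move=> [/code_bits_cyl /(code_prefixE _ ww) + u01]; apply.
  move=> ui; have u01 : 0 <= u < 1 by lra.
  by split => //; apply/code_bits_cyl/(code_prefixE _ ww u01).
rewrite lebesgue_measure_itv/= lte_fin.
have [_ _ /(_ p)] := ww; rewrite le_eqVlt => /predU1P[<-|wp0].
  by rewrite addr0 ltxx.
by rewrite ltrDl wp0 -EFinD; congr EFin; lra.
Qed.

End interval_coding.

Section code_measurable.
Context (R : realType).

Let wspace := paths (seq bool) (measurableTypeR R).

Lemma measurable_lo p : measurable_fun setT (fun w : wspace => lo w p).
Proof.
elim: p => [|b p IH] /=; first exact: measurable_cst.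
apply: measurable_funD => //; case: b; last exact: measurable_cst.
exact: (@measurable_coord _ _ (measurableTypeR R)).
Qed.

Let threshold p : measurable_fun setT
  (fun wu : wspace * measurableTypeR R => lo wu.1 p + wu.1 (false :: p) <= wu.2).
Proof.
apply: measurable_fun_ler; last exact: measurable_snd.
apply: measurable_funD.
  by apply: (measurableT_comp (measurable_lo p)); exact: measurable_fst.
by apply: (measurableT_comp (@measurable_coord _ _ (measurableTypeR R) (false :: p)));
  exact: measurable_fst.
Qed.

Let measurable_code_prefix p : measurable
  [set wu : wspace * measurableTypeR R | code_prefix wu.1 wu.2 (size p) = p].
Proof.
elim: p => [|b p IH] /=.
  by rewrite (_ : [set _ | _] = setT)//; apply/seteqP; split.
rewrite (_ : [set _ | _] = [set wu | code_prefix wu.1 wu.2 (size p) = p] `&`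
   (fun wu : wspace * measurableTypeR R =>
      lo wu.1 p + wu.1 (false :: p) <= wu.2) @^-1` [set b]).
  by apply: measurableI => //; rewrite -[X in measurable X]setTI; exact: threshold.
apply/seteqP; split => -[w u] /=; first by move=> [] /[swap] /[dup] pE ->.
by move=> [pE bE]; rewrite pE bE.
Qed.

(** On each of the countably many events fixing the first [n] bits, the next bit compares [u] with a
    threshold that is measurable in [w]. Joint measurability is needed for weights that depend on a
    parameter. *)
Lemma measurable_code_bits : measurable_fun setT
  (fun wu : wspace * measurableTypeR R => code_bits wu.1 wu.2).
Proof.
apply: measurable_path => n.
apply: (measurable_fun_bool true); rewrite setTI.
rewrite (_ : _ @^-1` _ = \bigcup_(p : seq bool)
  ([set wu : wspace * measurableTypeR R | size p = n /\ code_prefix wu.1 wu.2 (size p) = p] `&`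
   (fun wu : wspace * measurableTypeR R =>
      lo wu.1 p + wu.1 (false :: p) <= wu.2) @^-1` [set true])).
  apply: countable_bigcupT_measurable => // p.
  apply: measurableI; last by rewrite -[X in measurable X]setTI; exact: threshold.
  have [pn|pn] := eqVneq (size p) n.
    rewrite (_ : [set _ | _] = [set wu | code_prefix wu.1 wu.2 (size p) = p]).
      exact: measurable_code_prefix.
    by apply/seteqP; split => wu //= [].
  rewrite (_ : [set _ | _] = set0)//.
  by apply/seteqP; split => wu //= [] sp; rewrite sp eqxx in pn.
apply/seteqP; split => -[w u] /=.
  move=> cb; exists (code_prefix w u n) => //=.
  by rewrite size_code_prefix; split.
by move=> [p _ /= [[<-]]]; rewrite /code_bits => ->.
Qed.

Lemma measurable_code_bits_unif (w : seq bool -> R) : measurable_fun setT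
  (fun u : measurableTypeR R => code_bits w u).
Proof.
exact: (measurableT_comp measurable_code_bits
  (@pair1_measurable _ _ wspace (measurableTypeR R) w)).
Qed.

Context d (B : measurableType d) (e : bits -> B) (me : measurable_fun setT e).

(** This is a probability for every family [w], even one violating [weights]; families that are
    consistent only almost everywhere thus need no correction. *)
Definition decode_law (w : wspace) : pprobability B R :=
  plaw (@unif01 R) (measurableT_comp me (measurable_code_bits_unif w)) : probability B R.

Lemma measurable_decode_law : measurable_fun setT decode_law.
Proof.
apply: measurable_pprobability => U mU.
pose cm : wspace -> pprobability (measurableTypeR R) R := fun=> (@unif01 R : probability _ _).
have mcm : measurable_fun setT cm by exact: measurable_cst.
pose S := (e \o (fun wu : wspace * measurableTypeR R => code_bits wu.1 wu.2)) @^-1` U.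
have mS : measurable S.
  rewrite -[X in measurable X]setTI.
  exact: (measurableT_comp me measurable_code_bits).
have := @measurable_fun_xsection_finite_kernel _ _ _ _ R (kprobability mcm) S (mem_set mS).
by congr (measurable_fun _ _); apply/funext => w; rewrite xsectionE.
Qed.

End code_measurable.

Section clopen.

(** As [n] varies, these are the clopen subsets of the Cantor space. *)
Definition depends n (S : set bits) :=
  forall x y : bits, (forall i, (i < n)%N -> x i = y i) -> S x -> S y.

(** The space is split bit by bit into cylinders of length [n], each of them contained in [S] or
    disjoint from it. A property that survives one split in reverse thus passes from cylinders to
    [S]. *)
Lemma depends_ind (p : set bits -> Prop) n S : depends n S -> p set0 ->
  (forall q, size q = n -> p (cyl q)) ->
  (forall A q, p (A `&` cyl (true :: q)) -> p (A `&` cyl (false :: q)) -> p (A `&` cyl q)) ->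
  p S.
Proof.
move=> dS p0 pcyl psplit.
suff H k q : (size q + k)%N = n -> p (S `&` cyl q).
  by rewrite -(setIT S); exact: (H n [::]).
elim: k q => [|k IH] q; last first.
  by move=> qk; apply: psplit; apply: IH; rewrite /= addSnnS.
rewrite addn0 => qn.
have cylP x y : cyl q x -> cyl q y -> forall i, (i < n)%N -> x i = y i.
  rewrite -qn; elim: q {qn} => //= b q IHq [cx xb] [cy yb] i.
  rewrite ltnS leq_eqVlt => /predU1P[->|]; first by rewrite xb yb.
  exact: IHq.
have [[x [Sx cx]]|nS] := pselect (exists x, (S `&` cyl q) x).
  rewrite (_ : _ `&` _ = cyl q); first exact: pcyl.
  apply/seteqP; split => [y []//|y cy]; split => //.
  by apply: dS Sx; exact: cylP.
rewrite (_ : _ `&` _ = set0)//.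
by apply/seteqP; split => // x Sx; apply: nS; exists x.
Qed.

Lemma cyl_split (A : set bits) q :
  A `&` cyl q = (A `&` cyl (true :: q)) `|` (A `&` cyl (false :: q)).
Proof.
apply/seteqP; split => x /=; last by tauto.
by move=> [Ax cx]; case: (x (size q)); [left|right].
Qed.

Lemma cyl_disj (A : set bits) q :
  (A `&` cyl (true :: q)) `&` (A `&` cyl (false :: q)) = set0.
Proof.
by apply/seteqP; split => x //= [[_ [_ xt]] [_ [_ xf]]]; rewrite xt in xf.
Qed.

Lemma measurable_cyl q : measurable (cyl q).
Proof.
elim: q => [|b q IH] /=; first exact: (@measurableT _ bits).
apply: (@measurableI _ bits) => //.
rewrite (_ : [set _ | _] = (fun x : bits => x (size q)) @^-1` [set b])//.
by rewrite -[X in measurable X]setTI; exact: (@measurable_coord _ _ bool).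
Qed.

Lemma depends_measurable n S : depends n S -> measurable S.
Proof.
move=> dS; apply: (depends_ind dS) => [//|q _|A q m1 m2]; first exact: measurable_cyl.
by rewrite cyl_split; exact: measurableU.
Qed.

Lemma measurable_bitsE :
  @measurable _ bits = <<s [set S | exists n, depends n S] >>.
Proof.
rewrite eqEsubset; split.
  apply: sub_sigma_algebra2 => _ [n _ [C mC <-]]; exists n.+1 => x y xy /=.
  by move=> [_ Cx]; split => //; rewrite /= -xy.
apply: smallest_sub; first exact: sigma_algebra_measurable.
by move=> S [n /depends_measurable].
Qed.

Lemma depends_setI_closed : setI_closed [set S | exists n, depends n S].
Proof.
move=> S S' [n dS] [n' dS']; exists (maxn n n') => x y xy [Sx S'x]; split.
  by apply: dS Sx => i ni; apply: xy; rewrite leq_max ni.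
by apply: dS' S'x => i ni; apply: xy; rewrite leq_max ni orbT.
Qed.

Lemma bits_unique (R : realType) (m1 m2 : {measure set bits -> \bar R}) :
  (m1 setT < +oo)%E ->
  (forall q, m1 (cyl q) = m2 (cyl q)) -> forall S, measurable S -> m1 S = m2 S.
Proof.
move=> m1oo eqc S0 mS0.
apply: (@finite_measure_unique _ bits R [set S | exists n, depends n S] m1 m2 _
  depends_setI_closed) => //.
- by move=> S [n]; exact: depends_measurable.
- by exists 0%N.
- move=> S [n dS].
  suff [] : measurable S /\ m1 S = m2 S by [].
  apply: (@depends_ind (fun S => measurable S /\ m1 S = m2 S) _ _ dS) => [|q _|A q [mt et] [mf ef]].
  + by rewrite !measure0.
  + by split; [exact: measurable_cyl|exact: eqc].
  + rewrite cyl_split; split; first exact: measurableU.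
    rewrite !measureU//; try exact: cyl_disj.
    by congr (_ + _)%E; [exact: et|exact: ef].
- by rewrite -measurable_bitsE.
Qed.

End clopen.

Section ultra_limit.
Context (R : realType) (U : set_system nat) (UU : UltraFilter U).

(** The image of an ultrafilter is an ultrafilter, and segments are compact. *)
Lemma ultra_cvg (a b : R) (u : nat -> R) : (forall n, a <= u n <= b) ->
  exists2 l, a <= l <= b & u n @[n --> U] --> l.
Proof.
move=> uab.
have UuF : UltraFilter (fmap u U).
  have PU : ProperFilter U by exact: ultra_proper.
  apply: Build_UltraFilter.
  move=> G PG sG; apply/seteqP; split => // A GA.
  have [//|nA] := @in_ultra_setVsetC _ U (u @^-1` A) UU.
  have : G (A `&` ~` A) by apply: filterI => //; apply: sG.
  by rewrite setICr => /filter_ex [].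
have := @segment_compact R a b; rewrite compact_ultra => /(_ _ UuF).
case.
  rewrite /fmap /=; apply: (@filterS _ U _ setT); last exact: filterT.
  by move=> n _ /=; rewrite in_itv/=; exact: uab.
by move=> l [/= + ul]; rewrite in_itv/= => lab; exists l.
Qed.

(** Countable additivity is not passed to the limit: the limits of the cylinder masses are merely
    finitely additive weights, and [unif01_cyl] realizes these by a measure. *)
Lemma cantor_limit (m : nat -> probability bits R) :
  exists mu : probability bits R, forall n S, depends n S ->
    fine (m k S) @[k --> U] --> fine (mu S).
Proof.
have fin01 k S : measurable S -> 0 <= fine (m k S) <= 1.
  move=> mS; have fS : m k S \is a fin_num by exact: fin_num_measure.
  rewrite fine_ge0//= -lee_fin fineK//; exact: probability_le1.
have wex q : exists l : R, fine (m k (cyl q)) @[k --> U] --> l.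
  have [l _ ul] := ultra_cvg (fun k => fin01 k _ (measurable_cyl q)).
  by exists l.
have [w wP] := choice wex.
have fineD k (A : set bits) q : measurable (A `&` cyl (true :: q)) -> measurable (A `&` cyl (false :: q)) ->
    fine (m k (A `&` cyl q)) = fine (m k (A `&` cyl (true :: q))) + fine (m k (A `&` cyl (false :: q))).
  move=> mt mf; rewrite cyl_split measureU//; last exact: cyl_disj.
  by rewrite fineD//; exact: fin_num_measure.
have ww : weights w.
  split.
  - apply: (@cvg_unique _ _ _ _ _ _ (wP [::])) => //=.
    rewrite (_ : (fun k => _) = fun=> 1); first exact: cvg_cst.
    by apply/funext => k; rewrite /= probability_setT.
  - move=> q; apply: (@cvg_unique _ _ _ _ _ _ (wP q)) => //.
    rewrite (_ : (fun k => _) = fun k => fine (m k (cyl (true :: q))) + fine (m k (cyl (false :: q)))).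
      by apply: cvgD; exact: wP.
    apply/funext => k; have := @fineD k setT q.
    by rewrite !setTI; apply; exact: measurable_cyl.
  - move=> q; apply: (cvgr_to_ge (wP q)).
    by apply: filterE => k; case/andP: (fin01 k _ (measurable_cyl q)).
pose mu : probability bits R := plaw (@unif01 R) (measurable_code_bits_unif w).
have muc q : mu (cyl q) = (w q)%:E by exact: unif01_cyl.
exists mu => n S dS.
suff [] : measurable S /\ fine (m k S) @[k --> U] --> fine (mu S) by [].
apply: (@depends_ind (fun S => measurable S /\ fine (m k S) @[k --> U] --> fine (mu S)) _ _ dS).
- split => //; rewrite measure0.
  rewrite (_ : (fun k => _) = fun=> 0); first exact: cvg_cst.
  by apply/funext => k; rewrite measure0.
- move=> q _; split; first exact: measurable_cyl.
  by rewrite muc; exact: wP.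
- move=> A q [mt ct] [mf cf].
  split; first by rewrite cyl_split; exact: measurableU.
  rewrite (_ : fine (mu _) = fine (mu (A `&` cyl (true :: q))) + fine (mu (A `&` cyl (false :: q)))).
    rewrite (_ : (fun k => _) = fun k => fine (m k (A `&` cyl (true :: q))) + fine (m k (A `&` cyl (false :: q)))).
      exact: cvgD.
    by apply/funext => k; exact: fineD.
  rewrite [in LHS]cyl_split measureU//; last exact: cyl_disj.
  by rewrite constructive_ereal.fineD//; exact: fin_num_measure.
Qed.

End ultra_limit.

(** * Measurable retracts of the Cantor space *)

(** The retraction identity holds only up to [indist] because [pprobability E R] has to be coded as
    well. *)
Definition coded d (E : measurableType d) := exists (c : E -> bits) (e : bits -> E),
  [/\ measurable_fun setT c, measurable_fun setT e & forall x, indist (e (c x)) x].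

Section coded.

Lemma coded_retract d d' (E : measurableType d) (E' : measurableType d')
    (c : E -> E') (e : E' -> E) :
  measurable_fun setT c -> measurable_fun setT e ->
  (forall x, indist (e (c x)) x) -> coded E' -> coded E.
Proof.
move=> mc me ecK [c' [e' [mc' me' ecK']]]; exists (c' \o c), (e \o e'); split.
- exact: measurableT_comp.
- exact: measurableT_comp.
- by move=> x; apply: indist_trans (ecK x); apply: (indist_map me); exact: ecK'.
Qed.

Section code_paths.
Context (I : countType) d (E : measurableType d).

(** The bits of all coordinates are interleaved by numbering the pairs (coordinate, position);
    numbers of no pair get [false]. *)
Definition code_paths (c : E -> bits) (h : paths I E) : bits :=
  fun n => if unpickle n is Some (i, k) then c (h i) k else false.

Definition decode_paths (e : bits -> E) (b : bits) : paths I E :=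
  fun i => e (fun k : nat => b (pickle (i, k))).

Lemma measurable_code_paths c :
  measurable_fun setT c -> measurable_fun setT (code_paths c).
Proof.
move=> mc; apply: measurable_path => n; rewrite /code_paths.
case: (unpickle n) => [[i k]|]; last exact: measurable_cst.
apply: (@measurable_fun_coord _ _ bool _ _ (fun h : paths I E => c (h i))).
by apply: (measurableT_comp mc); exact: measurable_coord.
Qed.

Lemma measurable_decode_paths e :
  measurable_fun setT e -> measurable_fun setT (decode_paths e).
Proof.
move=> me; apply: measurable_path => i; apply: (measurableT_comp me).
by apply: measurable_path => k; exact: (@measurable_coord _ _ bool).
Qed.

Lemma coded_paths : coded E -> coded (paths I E).
Proof.
move=> [c [e [mc me ecK]]]; exists (code_paths c), (decode_paths e); split.
- exact: measurable_code_paths.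
- exact: measurable_decode_paths.
- move=> h; apply: indist_path => i; rewrite /decode_paths /code_paths.
  rewrite (_ : (fun k : nat => _) = c (h i)); first exact: ecK.
  by apply/funext => k; rewrite pickleK.
Qed.

End code_paths.

(** A pair is a retract of a path indexed by [bool]. *)
Lemma coded_prod d d' (E : measurableType d) (E' : measurableType d') :
  coded E -> coded E' -> coded (E * E')%type.
Proof.
move=> [c [e [mc me ecK]]] [c' [e' [mc' me' ecK']]].
apply: (@coded_retract _ _ _ (paths bool bits)
  (fun x b => if b then c x.1 else c' x.2) (fun h => (e (h true), e' (h false)))).
- apply: measurable_path => -[].
    by apply: (measurableT_comp mc); exact: measurable_fst.
  by apply: (measurableT_comp mc'); exact: measurable_snd.
- apply: measurable_fun_pair.
    by apply: (measurableT_comp me); exact: (@measurable_coord _ _ bits).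
  by apply: (measurableT_comp me'); exact: (@measurable_coord _ _ bits).
- by move=> [x y]; exact: indist_pair.
- by apply: coded_paths; exists id, id; split => //; exact: measurable_id.
Qed.

(** A real is coded by its Dedekind cut along an enumeration of the rationals and recovered as a
    supremum, in which rationals outside the cut enter as [-oo]. *)
Lemma coded_real (R : realType) : coded (measurableTypeR R).
Proof.
pose q n : R := if unpickle n is Some r then ratr r else 0.
pose s (b : bits) n : \bar R := if b n then (q n)%:E else -oo%E.
exists (fun x n => q n < x), (fun b => fine (esups (s b) 0)); split.
- apply: measurable_path => n.
  by apply: measurable_fun_ltr; [exact: measurable_cst|exact: measurable_id].
- apply: (@measurableT_comp _ _ _ _ _ _ fine); first exact: fine_measurable.
  apply: measurable_fun_esups => n.
  apply: measurable_fun_ifT; [|exact: measurable_cst|exact: measurable_cst].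
  exact: (@measurable_coord _ _ bool).
- move=> x; rewrite (_ : fine _ = x)//.
  rewrite /esups /sdrop /=; rewrite (_ : ereal_sup _ = x%:E)//.
  apply/eqP; rewrite eq_le; apply/andP; split.
    apply: ge_ereal_sup => _ [n _ <-]; rewrite /s.
    by case: ifPn => [/ltW|_]; rewrite ?leNye// lee_fin.
  apply/lee_subgt0Pr => eps eps0.
  have : x - eps < x by rewrite ltrBlDr ltrDl.
  move=> /rat_in_itvoo[r]; rewrite in_itv/= => /andP[xr rx].
  rewrite -EFinB; apply: (@le_trans _ _ (ratr r)%:E); first by rewrite lee_fin ltW.
  apply: ereal_sup_ubound; exists (pickle r) => //.
  by rewrite /s /q pickleK rx.
Qed.

(** A probability is coded by the masses of the coded cylinders, a countable family of reals, and
    recovered by [decode_law]. *)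
Lemma coded_pprobability (R : realType) d (E : measurableType d) :
  coded E -> coded (pprobability E R).
Proof.
move=> [c [e [mc me ecK]]].
have mcS (S : set bits) : measurable S -> measurable (c @^-1` S).
  by move=> mS; rewrite -[X in measurable X]setTI; exact: mc.
pose w (p : pprobability E R) : paths (seq bool) (measurableTypeR R) :=
  fun s => fine ((p : probability E R) (c @^-1` cyl s)).
suff [mw [md wK]] : measurable_fun setT w /\ measurable_fun setT (@decode_law R _ _ _ me) /\
    forall p, indist (decode_law me (w p)) p.
  apply: (coded_retract mw md wK).
  by apply: coded_paths; exact: coded_real.
split; [|split].
- apply: measurable_path => s; apply: (@measurableT_comp _ _ _ _ _ _ fine).
    exact: fine_measurable.
  exact: (measurable_kernel (kprobability (@measurable_id _ (pprobability E R) setT))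
     _ (mcS _ (measurable_cyl s))).
- exact: measurable_decode_law.
- move=> p.
  have finp s : (p : probability E R) (c @^-1` cyl s) = (w p s)%:E.
    by rewrite /w fineK//; apply: fin_num_measure; exact: (mcS _ (measurable_cyl _)).
  have ww : weights (w p).
    split.
    - by rewrite /w /= preimage_setT probability_setT.
    - move=> s; apply: EFin_inj; rewrite EFinD -!finp.
      have := cyl_split setT s; rewrite !setTI => ->.
      rewrite preimage_setU measureU//.
      + exact: (mcS _ (measurable_cyl _)).
      + exact: (mcS _ (measurable_cyl _)).
      + by rewrite -preimage_setI; have := cyl_disj setT s; rewrite !setTI => ->.
    - by move=> s; apply: fine_ge0.
  apply: (@indist_gen _ (pprobability E R) (@pset _ E R)) => //.
  move=> _ [r _ [A mA <-]]; rewrite /mset /=.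
  suff <- : plaw (@unif01 R) (measurableT_comp me (measurable_code_bits_unif (w p))) A =
     (p : probability E R) A by [].
  have meA : measurable (e @^-1` A) by rewrite -[X in measurable X]setTI; exact: me.
  transitivity ((p : probability E R) (c @^-1` (e @^-1` A))).
    apply: (@bits_unique R (plaw (@unif01 R) (measurable_code_bits_unif (w p)))
      (plaw (p : probability E R) mc) _ _ (e @^-1` A) meA).
      by rewrite [ltLHS]probability_setT ltry.
    by move=> s; rewrite [RHS]finp; exact: unif01_cyl.
  by congr (_ _); apply/seteqP; split => x /=; rewrite ecK.
Qed.

End coded.

(** * Polish spaces as measurable retracts of the Cantor space *)

Lemma countable_base (T : ptopologicalType) : @second_countable T ->
  exists U : nat -> set T, (forall n, open (U n)) /\
    forall x V, nbhs x V -> exists n, U n x /\ U n `<=` V.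
Proof.
move=> [B cB [oB bB]].
have [B0|[U]] := pfcard_geP cB.
  by have [W /= [BW _] _] := bB point setT filterT; rewrite B0 in BW.
exists U; split => [n|x V xV]; first exact/oB/funS.
have [W /= [BW Wx] WV] := bB x V xV.
by have [n _ nW] := @surj _ _ _ _ U _ BW; exists n; rewrite nW.
Qed.

Section polish_coding.
Context (R : realType) (T : completePseudoMetricType R).
Variable U : nat -> set T.
Hypothesis openU : forall n, open (U n).
Hypothesis baseU : forall x V, nbhs x V -> exists n, U n x /\ U n `<=` V.
Hypothesis hT : hausdorff_space T.

Definition base_code (x : borel T) : bits := fun n => `[< U n x >].

Definition small_base k n : bool :=
  `[< forall y z, U n y -> U n z -> ball y (k.+1%:R^-1 : R) z >].

Definition base_center n : T := xget point (U n).

(* index i is the first one, in the code b, of a basic open set of diameter at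
   most 1 / (k + 1) *)
Definition first_small k i : set bits :=
  [set b | b i && small_base k i /\ forall j, (j < i)%N -> ~~ (b j && small_base k j)].

(** A visibly measurable set that contains all codes of points and on which the centers of the first
    small basic sets form a Cauchy sequence, so that completeness provides a decoded point. *)
Definition coherent : set bits :=
  [set b | (forall k, exists i, first_small k i b) /\
    forall k l i j, first_small k i b -> first_small l j b -> U i `&` U j !=set0].

(** The radius is twice the scale because the decoded point is obtained as a limit of centers, and
    the centers at scales [k] and [l] are only within the sum of both scales. Incoherent sequences
    are sent to [point]. *)
Definition base_decode (b : bits) : borel T :=
  xget point [set x : T | coherent b /\
    forall k i, first_small k i b -> ball (base_center i) (2 * k.+1%:R^-1 : R) x].

Lemma first_small_uniq k i j b : first_small k i b -> first_small k j b -> i = j.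
Proof.
move=> [bi ni] [bj nj]; have [/nj|/ni|//] := ltngtP i j; by [rewrite bi|rewrite bj].
Qed.

Lemma first_small_ex k (b : bits) : (exists i, b i && small_base k i) ->
  exists i, first_small k i b.
Proof.
move=> ex; case: (ex_minnP ex) => i bi imin; exists i; split => // j ji.
by apply: contraTN ji => /imin; rewrite -leqNgt.
Qed.

Lemma small_base_ex k (x : T) : exists i, U i x /\ small_base k i.
Proof.
have e0 : 0 < (k.+1%:R^-1 / 2 : R) by rewrite divr_gt0.
have [i [Ux UV]] := baseU (nbhsx_ballx x _ e0).
exists i; split => //; apply/asboolP => y z /UV xy /UV xz.
by apply: (ball_splitr xy xz).
Qed.

Lemma base_center_in n x : U n x -> U n (base_center n).
Proof. by move=> Ux; apply: (@xgetPex _ point (U n)); exists x. Qed.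

Lemma coherent_center k l i j b : coherent b -> first_small k i b ->
  first_small l j b ->
  ball (base_center i) (k.+1%:R^-1 + l.+1%:R^-1 : R) (base_center j).
Proof.
move=> [_ cb] si sj; have [x [Ui Uj]] := cb _ _ _ _ si sj.
have [/andP[_ /asboolP smi] _] := si.
have [/andP[_ /asboolP smj] _] := sj.
apply: (@ball_triangle _ _ x).
- by apply: smi => //; exact: base_center_in Ui.
- by apply: smj => //; exact: base_center_in Uj.
Qed.

Lemma invS_small (e : R) : 0 < e -> exists k, k.+1%:R^-1 < e.
Proof.
move=> e0; have [k _ /(_ _ (leqnn k)) ke] := near_infty_natSinv_lt (PosNum e0).
by exists k.
Qed.

Lemma base_decodeP b : coherent b -> forall k i, first_small k i b ->
  ball (base_center i) (2 * k.+1%:R^-1 : R) (base_decode b).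
Proof.
move=> cb.
suff [x xP] : exists x : T, forall k i, first_small k i b ->
    ball (base_center i) (2 * k.+1%:R^-1 : R) x.
  have : [set x : T | coherent b /\ forall k i, first_small k i b ->
      ball (base_center i) (2 * k.+1%:R^-1 : R) x] (base_decode b).
    by apply: (@xgetPex _ point); exists x.
  by case.
have [idx idxP] := choice cb.1.
pose s k := base_center (idx k).
have cs : cvg (s k @[k --> \oo]).
  apply: cauchy_cvg; apply: cauchy_exP => e e0.
  have [k ke] : exists k, k.+1%:R^-1 < (e / 2 : R) by apply: invS_small; rewrite divr_gt0.
  exists (s k); exists k => // n /= kn.
  apply: (@le_ball _ _ _ (k.+1%:R^-1 + n.+1%:R^-1)); last exact: (coherent_center cb).
  have nk : n.+1%:R^-1 <= k.+1%:R^-1 :> R by rewrite lef_pV2 ?posrE// ler_nat.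
  have lin (x y z : R) : x < z / 2 -> y <= x -> x + y <= z by lra.
  exact: lin ke nk.
exists (lim (s k @[k --> \oo])) => k i si.
have e0 : 0 < (k.+1%:R^-1 / 2 : R) by rewrite divr_gt0.
have [l le] := invS_small e0.
have [n _ nP] := cvg_ball cs e0.
have lN : (l <= maxn l n)%N by rewrite leq_maxl.
have := nP (maxn l n) (leq_maxr l n); move/ball_sym => lims.
apply: (@le_ball _ _ _ ((k.+1%:R^-1 + (maxn l n).+1%:R^-1) + k.+1%:R^-1 / 2)).
  have ll : (maxn l n).+1%:R^-1 <= l.+1%:R^-1 :> R by rewrite lef_pV2 ?posrE// ler_nat.
  have lin (x y z : R) : x < z / 2 -> y <= x -> (z + y) + z / 2 <= 2 * z by lra.
  exact: lin le ll.
apply: (@ball_triangle _ _ (s (maxn l n))) => //.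
exact: (coherent_center cb si (idxP _)).
Qed.

Lemma base_decode_point b : ~ coherent b -> base_decode b = point.
Proof. by move=> ncb; apply: xgetPN => x [/ncb]. Qed.

Lemma coherent_code x : coherent (base_code x).
Proof.
split.
  move=> k; apply: first_small_ex; have [i [Ux sm]] := small_base_ex k x.
  by exists i; rewrite sm andbT; apply/asboolP.
move=> k l i j [/andP[/asboolP Ui _] _] [/andP[/asboolP Uj _] _].
by exists x.
Qed.

Lemma base_codeK x : base_decode (base_code x) = x.
Proof.
apply: hT => A B nA nB.
move: nA => /nbhs_ballP[e /= e0 eA].
have e0' : 0 < e / 3 by rewrite divr_gt0.
have [k ke] := invS_small e0'.
have cx := coherent_code x.
have [i si] := cx.1 k.
have [/andP[/asboolP Ux /asboolP sm] _] := si.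
exists x; split; last exact: nbhs_singleton nB.
have lin (y z : R) : y < z / 3 -> 2 * y + y <= z by lra.
apply: eA; apply: (@le_ball _ _ _ (2 * k.+1%:R^-1 + k.+1%:R^-1)); first exact: lin ke.
apply: (@ball_triangle _ _ (base_center i)).
  by apply: ball_sym; exact: base_decodeP.
by apply: sm => //; exact: base_center_in Ux.
Qed.

Lemma measurable_base_code : measurable_fun setT base_code.
Proof.
apply: measurable_path => n; apply: (measurable_fun_bool true); rewrite setTI.
rewrite (_ : _ @^-1` _ = U n); first exact: sub_sigma_algebra.
by apply/seteqP; split => x /=; rewrite /base_code => /asboolP.
Qed.

Lemma first_small_depends k i : depends i.+1 (first_small k i).
Proof.
move=> x y xy [xi nx]; split; first by rewrite -xy.
by move=> j ji; rewrite -xy ?nx// ltnW.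
Qed.

Lemma measurable_coherent : measurable coherent.
Proof.
rewrite (_ : coherent = (\bigcap_k \bigcup_i first_small k i) `&`
  \bigcap_k \bigcap_l \bigcap_i \bigcap_j
    (~` (first_small k i) `|` (~` (first_small l j) `|` [set _ | U i `&` U j !=set0]))).
  apply: measurableI.
    apply: bigcapT_measurable => k; apply: bigcupT_measurable => i.
    exact: depends_measurable (@first_small_depends k i).
  do 4 (apply: bigcapT_measurable => ?).
  apply: measurableU; first (by apply: measurableC; exact: depends_measurable (@first_small_depends _ _)).
  apply: measurableU; first (by apply: measurableC; exact: depends_measurable (@first_small_depends _ _)).
  exact: (@depends_measurable 0).
apply/seteqP; split => b.
  move=> [bf bc]; split => [k _|]; first by have [i] := bf k; exists i.
  move=> k _ l _ i _ j _ /=.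
  have [si|] := pselect (first_small k i b); last by left.
  have [sj|] := pselect (first_small l j b); last by right; left.
  by right; right; exact: bc si sj.
move=> [bf bc]; split => [k|k l i j si sj]; first by have [i _] := bf k I; exists i.
by have [//|[//|]] := bc k I l I i I j I.
Qed.

(** It is enough to treat closed sets [C]. A coherent sequence decodes into [C] iff at every scale
    [C] comes within twice the scale of the current center, which is a countable union of conditions
    on finitely many bits; incoherent sequences contribute all or nothing. *)
Lemma measurable_base_decode : measurable_fun setT base_decode.
Proof.
apply: (@measurability _ _ _ _ setT base_decode (@open T)) => //.
move=> _ [W oW <-]; rewrite setTI.
suff H C : closed C -> measurable (base_decode @^-1` C).
  have cW : closed (~` W) by rewrite closedC.
  by have := measurableC (H _ cW); rewrite -preimage_setC setCK.
move=> cC {W oW}.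
pose near_i k i := `[< exists2 y, C y & ball (base_center i) (2 * k.+1%:R^-1 : R) y >].
rewrite (_ : _ @^-1` _ =
  (coherent `&` \bigcap_k \bigcup_(i in [set i | near_i k i]) first_small k i) `|`
  (~` coherent `&` [set _ | C point])).
  apply: measurableU; apply: measurableI.
  - exact: measurable_coherent.
  - apply: bigcapT_measurable => k; apply: bigcup_measurable => i _.
    exact: depends_measurable (@first_small_depends k i).
  - by apply: measurableC; exact: measurable_coherent.
  - exact: (@depends_measurable 0).
apply/seteqP; split => b /=.
  move=> Cb; have [cb|ncb] := pselect (coherent b).
    left; split => // k _; have [i si] := cb.1 k; exists i => //.
    by apply/asboolP; exists (base_decode b) => //; exact: base_decodeP.
  by right; split => //; rewrite -(base_decode_point ncb).
move=> [[cb bi]|[ncb Cp]]; last first.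
  by rewrite base_decode_point.
apply: (cC (base_decode b)) => A /nbhs_ballP[e /= e0 eA].
have [k ke] : exists k, k.+1%:R^-1 < (e / 4 : R) by apply: invS_small; rewrite divr_gt0.
have [i /asboolP[y Cy yi] si] := bi k I.
exists y; split => //; apply: eA.
have lin (y' z : R) : y' < z / 4 -> 2 * y' + 2 * y' <= z by lra.
apply: (@le_ball _ _ _ (2 * k.+1%:R^-1 + 2 * k.+1%:R^-1)); first exact: lin ke.
apply: (@ball_triangle _ _ (base_center i)) => //.
by apply: ball_sym; exact: base_decodeP.
Qed.

End polish_coding.

Lemma coded_polish (R : realType) (T : completePseudoMetricType R) :
  polish T -> coded (borel T).
Proof.
move=> [hT /countable_base[U [oU bU]]].
exists (base_code U), (base_decode U); split.
- exact: measurable_base_code.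
- exact: measurable_base_decode.
- by move=> x; rewrite base_codeK//; exact: indist_refl.
Qed.

(** * Two-sided stationary Markov chains *)

Section shifts.
Context d (E : measurableType d).

(** Histories run backwards: index 0 is the present, and [consp] appends a new present. *)
Definition consp (hz : paths nat E * E) : paths nat E :=
  fun n => if n is m.+1 then hz.1 m else hz.2.

Definition beheadp (h : paths nat E) : paths nat E := fun n => h n.+1.

(** This keeps the [n.+1] most recent entries; the others are reset to a default, so that a window
    is again a path. *)
Definition truncp n (h : paths nat E) : paths nat E :=
  fun j => if (j <= n)%N then h j else point.

(* The time-reversed past of a two-sided path. *)
Definition pastp (t : int) (w : paths int E) : paths nat E := fun j => w (t - j%:Z).

Lemma measurable_consp : measurable_fun setT consp.
Proof.
apply: measurable_path => -[|n] /=; first exact: measurable_snd.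
by apply: measurable_fun_coord; exact: measurable_fst.
Qed.

Lemma measurable_beheadp : measurable_fun setT beheadp.
Proof. by apply: measurable_path => n; exact: measurable_coord. Qed.

Lemma measurable_truncp n : measurable_fun setT (truncp n).
Proof.
apply: measurable_path => j; rewrite /truncp; case: (j <= n)%N.
  exact: measurable_coord.
exact: measurable_cst.
Qed.

Lemma measurable_pastp t : measurable_fun setT (pastp t).
Proof. by apply: measurable_path => j; exact: measurable_coord. Qed.

Lemma truncp_consp n h z : truncp n.+1 (consp (h, z)) = consp (truncp n h, z).
Proof. by apply/funext => -[|j]. Qed.

Lemma boxes_truncp (B : set (paths nat E)) :
  boxes setT (fun i (h : paths nat E) => h i : E) B ->
  exists N, forall h, B h <-> B (truncp N h).
Proof.
move=> [A [_ [s As] _ ->]]; exists (\max_(j <- s) j)%N => h.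
have As' i : ~~ (i <= \max_(j <- s) j)%N -> A i = setT.
  move=> ni; apply: As; apply: contra ni => is_.
  exact: (@leq_bigmax_seq _ s xpredT id i is_ isT).
split => /= Ah i; have := Ah i; rewrite /truncp; case: ifPn => //.
  by move=> /As' ->.
by move=> /As' ->.
Qed.

End shifts.

Section chain.
Context d (E : measurableType d) (R : realType) (k : R.-pker E ~> E)
  (mu : probability E R).
Hypothesis inv_mu : forall S, measurable S -> (\int[mu]_x k x S = mu S)%E.

Let mhead : measurable_fun setT (fun h : paths nat E => h 0%N : E) :=
  @measurable_coord nat _ E 0%N.

(** The law of the reversed trajectory after [n] steps from [mu]. Entries beyond index [n] merely
    repeat the initial state. *)
Fixpoint chain n : probability (paths nat E) R :=
  if n is m.+1 then
    plaw (mbind (chain m) (kgraph (kmap k mhead))) (@measurable_consp _ E)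
  else plaw mu (@measurable_path nat _ E _ E (fun z _ => z) (fun=> @measurable_id _ E setT)).

Lemma ge0_integral_chainS n (f : paths nat E -> \bar R) :
  measurable_fun setT f -> (forall h, 0 <= f h)%E ->
  (\int[chain n.+1]_h f h =
   \int[chain n]_h \int[k (h 0%N)]_z f (consp (h, z)))%E.
Proof.
move=> mf f0.
have mfc : measurable_fun setT (f \o @consp _ E).
  by apply: (measurableT_comp mf); exact: measurable_consp.
rewrite /= ge0_integral_plaw// ge0_integral_mbind//.
apply: eq_integral => h _; rewrite /kgraph ge0_integral_plaw//.
Qed.

Lemma chain_head n (f : E -> \bar R) :
  measurable_fun setT f -> (forall z, 0 <= f z)%E ->
  (\int[chain n]_h f (h 0%N) = \int[mu]_z f z)%E.
Proof.
move=> + f0; elim: n f f0 => [|n IH] f f0 mf.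
  by rewrite /= ge0_integral_plaw//; exact: (measurableT_comp mf mhead).
rewrite ge0_integral_chainS//; last exact: (measurableT_comp mf mhead).
rewrite (IH (fun x => \int[k x]_z f z)%E).
- rewrite -ge0_integral_mbind//; apply: eq_measure_integral => S mS _.
  exact: inv_mu.
- by move=> z; exact: integral_ge0.
- exact: measurable_fun_integral_kernel (measurable_kernel k) f f0 mf.
Qed.

(** The start being invariant, the [n.+1] last states have the same law whenever they are observed.
    The induction removes the newest state on both sides until only [chain_head] remains. *)
Lemma chain_trunc n N (f : paths nat E -> \bar R) : (n <= N)%N ->
  measurable_fun setT f -> (forall h, 0 <= f h)%E ->
  (\int[chain N]_h f (truncp n h) = \int[chain n]_h f (truncp n h))%E.
Proof.
elim: n N f => [|n IH] [|N] f // nN mf f0.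
  have trunc0 : truncp 0 = (fun z => consp (fun=> point, z)) \o
      (fun h : paths nat E => h 0%N) :> (_ -> _).
    by apply/funext => h; apply/funext => -[|j].
  rewrite trunc0.
  have mz : measurable_fun setT (fun z => f (consp (fun=> point, z) : paths nat E)).
    apply: (measurableT_comp mf); apply: (measurableT_comp (@measurable_consp _ E)).
    exact: (@pair1_measurable _ _ (paths nat E) E (fun=> point)).
  by rewrite !(@chain_head _ (fun z => f (consp (fun=> point, z))))//.
have mft : measurable_fun setT (fun h => f (truncp n.+1 h)).
  by apply: (measurableT_comp mf); exact: measurable_truncp.
rewrite !ge0_integral_chainS//.
under eq_integral do under eq_integral do rewrite truncp_consp.
under [RHS]eq_integral do under eq_integral do rewrite truncp_consp.
apply: (IH N (fun h => \int[k (h 0%N)]_z f (consp (h, z)))%E) => //.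
  apply: (@measurable_fun_integral_sfinite_kernel _ _ _ _ R
    (fun hz => f (consp hz)) (kmap k mhead)) => //.
  by apply: (measurableT_comp mf); exact: measurable_consp.
by move=> h; exact: integral_ge0.
Qed.

Lemma chain_drop n a (f : paths nat E -> \bar R) :
  measurable_fun setT f -> (forall h, 0 <= f h)%E ->
  (\int[chain (n + a)]_h f (fun j => h (a + j)%N) = \int[chain n]_h f h)%E.
Proof.
move=> mf f0; elim: a => [|a IH]; first by rewrite addn0.
rewrite addnS ge0_integral_chainS//.
  rewrite -[RHS]IH; apply: eq_integral => h _.
  rewrite (_ : (fun z => _) = cst (f (fun j => h (a + j)%N))); last first.
    by apply/funext => z; congr f; apply/funext => j; rewrite addSn.
  by rewrite integral_cst// prob_kernel mule1.
apply: (@measurableT_comp _ _ _ _ _ _ f) => //.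
by apply: measurable_path => j; exact: measurable_coord.
Qed.

(** The present of the reversed path is placed at time [N], so that [N + N] steps of the chain cover
    the times from [-N] to [N]. After time [N] the absolute value only yields filler values. *)
Definition window N (h : paths nat E) : paths int E := fun t => h `|N%:Z - t|%N.

Lemma measurable_window N : measurable_fun setT (window N).
Proof. by apply: measurable_path => t; exact: measurable_coord. Qed.

Definition window_law N : probability (paths int E) R :=
  plaw (chain (N + N)) (measurable_window N).

Lemma window_lawE t n N (f : paths nat E -> \bar R) :
  (`|t| + n <= N)%N -> measurable_fun setT f -> (forall h, 0 <= f h)%E ->
  (\int[window_law N]_w f (truncp n (pastp t w)) =
   \int[chain n]_h f (truncp n h))%E.
Proof.
move=> tnN mf f0.
have mft : measurable_fun setT (fun h => f (truncp n h)).
  by apply: (measurableT_comp mf); exact: measurable_truncp.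
rewrite /window_law ge0_integral_plaw//; last first.
  by apply: (measurableT_comp mft); exact: measurable_pastp.
(* Time [t] lies [a] steps before the present [N]; dropping them leaves a chain of [N + N - a]
   steps, still at least [n]. *)
pose a := `|N%:Z - t|%N.
have aN : (a <= N + N - n)%N by rewrite /a; lia.
rewrite (_ : (N + N = (N + N - a) + a)%N); last by lia.
rewrite (_ : (fun w => _) = fun h : paths nat E =>
    f (truncp n (fun j => h (a + j)%N))); last first.
  apply/funext => h; congr f; congr truncp; apply/funext => j.
  by rewrite /pastp /window; congr h; rewrite /a; lia.
rewrite (@chain_drop _ _ (fun h => f (truncp n h)))//.
by apply: chain_trunc => //; lia.
Qed.

End chain.

Section two_sided.
Context d (E : measurableType d) (R : realType) (k : R.-pker E ~> E)
  (mu : probability E R).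
Hypothesis inv_mu : forall S, measurable S -> (\int[mu]_x k x S = mu S)%E.
Hypothesis codedE : coded E.

Lemma preimage_measurable d1 d2 (A : measurableType d1) (B : measurableType d2)
  (f : A -> B) S : measurable_fun setT f -> measurable S -> measurable (f @^-1` S).
Proof. by move=> mf mS; rewrite -[X in measurable X]setTI; exact: mf. Qed.

(** The law of a fixed finite window does not depend on [N] once [N] is large. The ultralimit of the
    coded window laws therefore has exactly these finite-dimensional laws. *)
Lemma exists_limit_law : exists L : probability (paths int E) R,
  forall t n (f : paths nat E -> \bar R), measurable_fun setT f ->
    (forall h, 0 <= f h)%E ->
    (\int[L]_w f (truncp n (pastp t w)) = \int[chain k mu n]_h f (truncp n h))%E.
Proof.
have [c [e [mc me ecK]]] := codedE.
have [U [UU ooU]] := ultraFilterLemma (@eventually_filter).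
pose m N : probability bits R :=
  plaw (window_law k mu N) (measurable_code_paths mc).
have [nu nuP] := cantor_limit UU m.
exists (plaw nu (measurable_decode_paths me)) => t n f mf f0.
(* [beta] reads the bits of the window off the code of a two-sided path, [gam] computes them from a
   reversed path, and [del] decodes them. The laws are compared at the level of these bits. *)
pose beta (b : bits) : paths (nat * nat)%type bool :=
  fun jk => (jk.1 <= n)%N && b (pickle (t - jk.1%:Z, jk.2)).
pose gam (h : paths nat E) : paths (nat * nat)%type bool :=
  fun jk => (jk.1 <= n)%N && c (h jk.1) jk.2.
pose del (x : paths (nat * nat)%type bool) : paths nat E :=
  fun j => if (j <= n)%N then e (fun i => x (j, i)) else point.
have mbeta : measurable_fun setT beta.
  apply: measurable_path => -[j i]; rewrite /beta /=; case: (j <= n)%N => /=.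
    exact: (@measurable_coord _ _ bool).
  exact: measurable_cst.
have mgam : measurable_fun setT gam.
  apply: measurable_path => -[j i]; rewrite /gam /=; case: (j <= n)%N => /=.
    apply: (@measurable_fun_coord _ _ bool _ _ (fun h : paths nat E => c (h j))).
    by apply: (measurableT_comp mc); exact: measurable_coord.
  exact: measurable_cst.
have mdel : measurable_fun setT del.
  apply: measurable_path => j; rewrite /del; case: (j <= n)%N.
    apply: (measurableT_comp me); apply: measurable_path => i.
    exact: (@measurable_coord _ _ bool).
  exact: measurable_cst.
have gam_trunc h : gam (truncp n h) = gam h.
  by apply/funext => -[j i]; rewrite /gam /truncp /=; case: (j <= n)%N.
have beta_code w : beta (code_paths c w) = gam (truncp n (pastp t w)).
  rewrite gam_trunc; apply/funext => -[j i]; rewrite /beta /gam /code_paths /=.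
  by rewrite pickleK.
have del_beta b : del (beta b) = truncp n (pastp t (decode_paths e b)).
  apply/funext => j; rewrite /del /truncp /beta /=.
  by case: (j <= n)%N => //=; congr e; apply/funext => i.
have del_gam h : indist (del (gam h)) (truncp n h).
  apply: indist_path => j; rewrite /del /truncp /gam /=.
  by case: (j <= n)%N => /=; [exact: ecK|exact: indist_refl].
have mEf : measurable_fun setT (fun h => f (truncp n h)).
  by apply: (measurableT_comp mf); exact: measurable_truncp.
have law S : measurable S -> nu (beta @^-1` S) = chain k mu n (gam @^-1` S).
  apply: (@probability_unique _ _ R _ (plaw nu mbeta) (plaw (chain k mu n) mgam)
    (@measurable_pathE _ _ bool) (@boxes_setI_closed _ _ bool _ _ _ _)).
  move=> B bB.
  have mB : measurable B by rewrite measurable_pathE; exact: sub_sigma_algebra.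
  rewrite /plaw /pushforward.
  (* The window carries infinitely many bits, but a box constrains finitely many of them, and
     [cantor_limit] speaks of such sets. *)
  have [n' dB] : exists n', depends n' (beta @^-1` B).
    move: bB => [A [_ [s As] _ ->]].
    pose pk (jk : nat * nat) : nat := (pickle (t - jk.1%:Z, jk.2)).+1.
    exists (\max_(jk <- s) pk jk)%N => x y xy /= Ax jk.
    have [sjk|/As ->//] := boolP (jk \in s).
    move: (Ax jk); rewrite /beta xy//.
    exact: (@leq_bigmax_seq _ s xpredT pk jk sjk isT).
  have win N : (`|t| + n <= N)%N ->
      m N (beta @^-1` B) = chain k mu n (gam @^-1` B).
    move=> tnN; rewrite /m /plaw /pushforward /=.
    transitivity (window_law k mu N ((fun w => gam (truncp n (pastp t w))) @^-1` B)).
      by congr (window_law _ _ _ _); apply/seteqP; split => w /=; rewrite beta_code.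
    transitivity (chain k mu n ((fun h => gam (truncp n h)) @^-1` B)); last first.
      by congr (chain _ _ _ _); apply/seteqP; split => h /=; rewrite gam_trunc.
    apply: law_of_integrals mB => //.
    - apply: (measurableT_comp mgam); apply: measurableT_comp.
        exact: measurable_truncp.
      exact: measurable_pastp.
    - by apply: (measurableT_comp mgam); exact: measurable_truncp.
    - move=> h mh h0; apply: (window_lawE inv_mu tnN (f := fun x => h (gam x))) => //.
      exact: measurableT_comp mh mgam.
  have := nuP _ _ dB.
  have eqn : \forall N \near U, fine (m N (beta @^-1` B)) = fine (chain k mu n (gam @^-1` B)).
    by apply: ooU; exists (`|t| + n)%N => // N tnN; exact: (congr1 fine (win N tnN)).
  move=> lim1.
  have lim2 : fine (m N (beta @^-1` B)) @[N --> U] --> fine (chain k mu n (gam @^-1` B)).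
    by apply: cvg_near_cst; apply: filterS eqn => N ->.
  have e1 : fine (nu (beta @^-1` B)) = fine (chain k mu n (gam @^-1` B)).
    by apply: (cvg_unique _ lim1 lim2).
  have := congr1 (@EFin R) e1.
  rewrite !fineK => [//||]; apply: fin_num_measure; exact: preimage_measurable.
rewrite ge0_integral_plaw//; last first.
  by apply: (measurableT_comp mEf); exact: measurable_pastp.
under eq_integral do rewrite -del_beta.
rewrite (integral_comp_plaw (f := beta) (f' := gam) (P' := chain k mu n)
  (h := fun x => f (del x)))//; last exact: (measurableT_comp mf mdel).
by apply: eq_integral => h _; apply: indist_ereal (del_gam h).
Qed.

End two_sided.

Definition stationary_markov d (E : measurableType d) (R : realType)
    (k : R.-pker E ~> E) (L : probability (paths int E) R) :=
  (forall t, disint L (pastp t) (fun w => w (t + 1) : E)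
     (fun h : paths nat E => k (h 0%N))) /\
  (forall t S, measurable S -> L (pastp t @^-1` S) = L (pastp 0 @^-1` S)).

Section two_sided_markov.
Context d (E : measurableType d) (R : realType) (k : R.-pker E ~> E)
  (mu : probability E R).
Hypothesis inv_mu : forall S, measurable S -> (\int[mu]_x k x S = mu S)%E.
Hypothesis codedE : coded E.

Let mhead : measurable_fun setT (fun h : paths nat E => h 0%N : E) :=
  @measurable_coord nat _ E 0%N.

(** Both properties are tested on boxes, hence on finite windows, where the limit law agrees with
    [chain]: the Markov property is the recursion defining the chain, and stationarity holds because
    [chain] does not see the time [t]. *)
Lemma exists_stationary_markov : exists2 L : probability (paths int E) R,
  stationary_markov k L &
  forall t B, measurable B -> L [set w | B (w t)] = mu B.
Proof.
have [L LP] := exists_limit_law inv_mu codedE; exists L; last first.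
  move=> t B mB.
  have -> : [set w : paths int E | B (w t)] =
      (fun w => truncp 0 (pastp t w)) @^-1` ((fun h : paths nat E => h 0%N : E) @^-1` B).
    by apply/seteqP; split => w /=; rewrite /truncp /pastp /= subr0.
  transitivity (chain k mu 0 (truncp 0 @^-1` ((fun h : paths nat E => h 0%N : E) @^-1` B))).
    apply: law_of_integrals; last exact: preimage_measurable.
    - by apply: measurableT_comp; [exact: measurable_truncp|exact: measurable_pastp].
    - exact: measurable_truncp.
    - by move=> h mh h0; exact: LP.
  by [].
split.
- move=> t.
  apply: (@disintP _ _ _ _ _ _ R (boxes setT (fun i (h : paths nat E) => h i : E))
    L (pastp t) _ (kmap k mhead)).
  + exact: measurable_pathE.
  + exact: boxes_setI_closed.
  + exact: boxes_setT.
  + exact: measurable_pastp.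
  + exact: measurable_coord.
  move=> S C bS mC.
  have mS : measurable S by rewrite measurable_pathE; exact: sub_sigma_algebra.
  have [n Sn] := boxes_truncp bS.
  (* [f] tests the newest state against [C] and the rest of the path against [S]; [g] is what
     remains once the newest state is integrated out. *)
  pose f (h : paths nat E) : \bar R := (\1_S (beheadp h) * \1_C (h 0%N))%:E.
  have mf : measurable_fun setT f.
    apply/measurable_EFinP; apply: measurable_funM.
      by apply: measurableT_comp; [exact: measurable_indic|exact: measurable_beheadp].
    apply: (@measurableT_comp _ _ _ _ _ _ (\1_C : E -> R)); first exact: measurable_indic.
    exact: measurable_coord.
  have f0 h : (0 <= f h)%E by rewrite lee_fin.
  pose g (h : paths nat E) : \bar R := ((\1_S h)%:E * k (h 0%N) C)%E.
  have mg : measurable_fun setT g.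
    apply: emeasurable_funM; first exact/measurable_EFinP.
    exact: (measurable_kernel (kmap k mhead)).
  have g0 h : (0 <= g h)%E by apply: mule_ge0; rewrite ?lee_fin.
  have indS h : \1_S (truncp n h) = \1_S h :> R.
    have Sh : (truncp n h \in S) = (h \in S).
      by apply/idP/idP => /set_mem Sx; apply/mem_set; [exact: (Sn h).2|exact: (Sn h).1].
    by rewrite !indicE Sh.
  transitivity (\int[L]_w f (truncp n.+1 (pastp (t + 1) w)))%E.
    rewrite -(setIT (_ `&` _)) -integral_indic//; last first.
      apply: measurableI; apply: preimage_measurable => //.
        exact: measurable_pastp.
      exact: measurable_coord.
    apply: eq_integral => w _; rewrite /f; congr EFin.
    have -> : beheadp (truncp n.+1 (pastp (t + 1) w)) = truncp n (pastp t w).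
      apply/funext => j; rewrite /beheadp /truncp ltnS; case: ifP => // _.
      by rewrite /pastp; congr w; rewrite -addn1 PoszD; ring.
    by rewrite indS indicI /= /truncp /pastp subr0.
  rewrite LP// ge0_integral_chainS//; last first.
    by apply: (measurableT_comp mf); exact: measurable_truncp.
  transitivity (\int[chain k mu n]_h g (truncp n h))%E.
    apply: eq_integral => h _; rewrite /g /=.
    transitivity (\int[k (h 0%N)]_z ((\1_S (truncp n h))%:E * (\1_C z)%:E))%E.
      by apply: eq_integral => z _; rewrite truncp_consp /f EFinM.
    rewrite ge0_integralZl//.
    + by rewrite integral_indic// setIT.
    + exact/measurable_EFinP.
  rewrite -(LP t n g mg g0) [RHS]integral_mkcond; apply: eq_integral => w _.
  rewrite patchE /g indS /kmap /truncp /= indicE.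
  have -> : (w \in pastp t @^-1` S) = (pastp t w \in S) by [].

  by case: ifPn => /= Sw; [rewrite mul1e|rewrite mul0e].
- move=> t S mS.
  apply: (@probability_unique _ _ R _ (plaw L (@measurable_pastp _ E t))
    (plaw L (@measurable_pastp _ E 0)) (@measurable_pathE _ _ E)
    (@boxes_setI_closed _ _ E _ _ _ _)) mS.
  move=> B bB.
  have mB : measurable B by rewrite measurable_pathE; exact: sub_sigma_algebra.
  have [n Bn] := boxes_truncp bB.
  have H s : L (pastp s @^-1` B) = chain k mu n (truncp n @^-1` B).
    transitivity (L ((fun w => truncp n (pastp s w)) @^-1` B)).
      by congr (L _); apply/seteqP; split => w; [exact: (Bn _).1|exact: (Bn _).2].
    apply: law_of_integrals mB.
    + by apply: measurableT_comp; [exact: measurable_truncp|exact: measurable_pastp].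
    + exact: measurable_truncp.
    + by move=> h mh h0; exact: LP.
  exact: (etrans (H t) (esym (H 0))).
Qed.

End two_sided_markov.

(** * Invariant laws of weakly continuous kernels *)

Section bounded_integrals.
Context d (A : measurableType d) (R : realType).
Implicit Types (m : probability A R) (f g : A -> R).

Lemma bounded_integrable m f M : measurable_fun setT f ->
  (forall x, `|f x| <= M) -> m.-integrable setT (EFin \o f).
Proof.
move=> mf fM; apply: measurable_bounded_integrable => //.
  by rewrite [ltLHS]probability_setT ltry.
exists M; split; first exact: num_real.
by move=> N MN x _ /=; apply: le_trans (fM x) _; exact: ltW.
Qed.

Lemma Rintegral_dist m f g M e : measurable_fun setT f -> measurable_fun setT g ->
  (forall x, `|f x| <= M) -> (forall x, `|g x| <= M) -> 0 <= e ->
  {ae m, forall x, `|f x - g x| <= e} ->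
  `|\int[m]_x f x - \int[m]_x g x| <= e.
Proof.
move=> mf mg fM gM e0 fg.
have If := bounded_integrable m mf fM; have Ig := bounded_integrable m mg gM.
have mfg : measurable_fun setT (fun x => f x - g x) by exact: measurable_funB.
have Ifg : m.-integrable setT (EFin \o (fun x => f x - g x)).
  apply: (@bounded_integrable m _ (M + M)) => // x.
  by apply: le_trans (ler_normB _ _) _; exact: lerD.
rewrite -RintegralB//; apply: le_trans (le_normr_Rintegral measurableT Ifg) _.
rewrite /Rintegral -lee_fin fineK; last first.
  apply: integrable_fin_num => //.
  apply: (@bounded_integrable m _ (M + M)); first exact: measurableT_comp.
  by move=> x; rewrite normr_id; apply: le_trans (ler_normB _ _) _; exact: lerD.
apply: (@le_trans _ _ (\int[m]_x e%:E)%E).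
  apply: ae_ge0_le_integral => //.
  - by apply/measurable_EFinP; exact: measurableT_comp.
  - by apply: filterS fg => x fgx _; rewrite lee_fin.
by rewrite integral_cst// [X in (_ * X)%E]probability_setT mule1.
Qed.

Lemma Rintegral_plaw d' (B : measurableType d') (P : probability A R)
    (h : A -> B) (mh : measurable_fun setT h) (f : B -> R) :
  measurable_fun setT f -> (forall x, 0 <= f x) ->
  \int[plaw P mh]_y f y = \int[P]_x f (h x).
Proof.
move=> mf f0; rewrite /Rintegral ge0_integral_plaw//.
exact/measurable_EFinP.
Qed.

Lemma Rintegral_01 m f : measurable_fun setT f ->
  (forall x, 0 <= f x <= 1) -> 0 <= \int[m]_x f x <= 1.
Proof.
move=> mf f01.
have If : m.-integrable setT (EFin \o f).
  apply: (@bounded_integrable m _ 1) => // x.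
  by have /andP[f0 f1] := f01 x; rewrite ger0_norm.
rewrite Rintegral_ge0; last by move=> x _; case/andP: (f01 x).
have I1 : m.-integrable setT (EFin \o (fun=> 1 : R)).
  by apply: (@bounded_integrable m _ 1) => // x; rewrite normr1.
have := @le_Rintegral _ _ _ m setT f (fun=> 1) measurableT If I1.
rewrite Rintegral_cst// [X in fine X]probability_setT mulr1; apply.
by move=> x _; case/andP: (f01 x).
Qed.

End bounded_integrals.

Section average.
Context d (A : measurableType d) (R : realType).
Variables (P : nat -> probability A R) (N : nat).

(** The same mean serves for the Cesaro means in the existence of an invariant law of [T] and, with
    [N = 1], for averaging two joint laws. *)
Definition mavg : set A -> \bar R :=
  mscale (N.+1%:R^-1 : R)%:nng (msum P N.+1).

HB.instance Definition _ := Measure.on mavg.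

Let mavg_setT : mavg setT = 1%E.
Proof.
transitivity (N.+1%:R^-1%:E * \sum_(j < N.+1) (1%R : R)%:E)%E.
  by congr (_ * _)%E; apply: eq_bigr => j _; exact: probability_setT.
by rewrite sumEFin sumr_const card_ord -EFinM mulVf.
Qed.

HB.instance Definition _ := Measure_isProbability.Build _ _ _ mavg mavg_setT.

Lemma mavgE S : mavg S = (N.+1%:R^-1%:E * \sum_(j < N.+1) P j S)%E.
Proof. by []. Qed.

Lemma ge0_integral_mavg (f : A -> \bar R) :
  measurable_fun setT f -> (forall x, 0 <= f x)%E ->
  (\int[mavg]_x f x = N.+1%:R^-1%:E * \sum_(j < N.+1) \int[P j]_x f x)%E.
Proof.
by move=> mf f0; rewrite /mavg ge0_integral_mscale// ge0_integral_measure_sum.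
Qed.

Lemma Rintegral_mavg (f : A -> R) : measurable_fun setT f ->
  (forall x, 0 <= f x <= 1) ->
  \int[mavg]_x f x = N.+1%:R^-1 * \sum_(j < N.+1) \int[P j]_x f x.
Proof.
move=> mf f01; have f0 x : 0 <= f x by case/andP: (f01 x).
rewrite /Rintegral ge0_integral_mavg//; last exact/measurable_EFinP.
have fin j : (\int[P j]_x (f x)%:E)%E \is a fin_num.
  apply: integrable_fin_num => //; apply: (@bounded_integrable _ _ _ _ _ 1) => // x.
  by have /andP[_ f1] := f01 x; rewrite ger0_norm.
suff -> : (\sum_(j < N.+1) \int[P j]_x (f x)%:E)%E = (\sum_(j < N.+1) \int[P j]_x f x)%:E by [].
by rewrite -sumEFin; apply: eq_bigr => j _; rewrite /Rintegral fineK ?fin.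
Qed.

End average.

Lemma continuous_measurable_borel (R : realType) (T : ptopologicalType) (f : T -> R) :
  continuous f -> measurable_fun setT (f : borel T -> R).
Proof.
move=> /continuousP cf.
apply: (@measurability _ _ (borel T) _ setT (f : borel T -> R) _ (RGenOpens.measurableE R)).
move=> _ [_ [a [b ->]] <-]; rewrite setTI; apply: sub_sigma_algebra.
by apply: cf; exact: interval_open.
Qed.

Section open_indicator.
Context (R : realType) (T : completePseudoMetricType R).

(* The indicator of an open set is the increasing limit of the continuous
   functions min(1, n u), where u vanishes exactly off the open set. *)
Lemma open_separating (W : set T) : open W -> exists u : T -> R,
  [/\ continuous u, forall x, 0 <= u x & forall x, (0 < u x) <-> W x].
Proof.
move=> oW; pose u (x : T) : R := contract (@edist_inf R T (~` W) x).
have u0 x : 0 <= u x.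
  by rewrite -(@contract0 R) le_contract edist_inf_ge0.
exists u; split => // [x|x].
- apply/cvgrPdist_lt => e e0.
  exact: (@edist_inf_continuous R T (~` W) x _ (nbhsx_ballx _ _ e0)).
- split.
    apply: contraPP => nWx; rewrite /u edist_inf0// contract0.
    by rewrite ltxx.
  move=> Wx; rewrite -(@contract0 R) lt_contract.
  have [e /= e0 eW] := (nbhs_ballP _ _).1 (open_nbhs_nbhs (conj oW Wx)).
  apply: (@lt_le_trans _ _ e%:E); first by rewrite lte_fin.
  apply: le_ereal_inf_tmp => _ [a nWa <-]; rewrite leNgt; apply/negP.
  by move=> /edist_lt_ball /= /eW.
Qed.

Lemma borel_unique (m1 m2 : probability (borel T) R) :
  (forall f : T -> R, continuous f -> (forall x, 0 <= f x <= 1) ->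
    \int[m1]_x f x = \int[m2]_x f x) ->
  forall S, measurable S -> m1 S = m2 S.
Proof.
move=> eqf S mS.
apply: (@probability_unique _ (borel T) R (@open T) m1 m2 _ _ _ S mS) => //.
  by move=> ? ? ? ?; exact: openI.
move=> W oW; have [u [cu u0 uW]] := open_separating oW.
pose g n (x : T) : R := Num.min 1 (n%:R * u x).
have g01 n x : 0 <= g n x <= 1.
  by rewrite le_min ler01 mulr_ge0//= ge_min lexx.
have cg n : continuous (g n).
  move=> x; apply: (@continuous_min _ _ (fun=> 1) (fun x => n%:R * u x)); first exact: cvg_cst.
  by apply: cvgM; [exact: cvg_cst|exact: cu].
have mg n : measurable_fun setT (fun x : borel T => (g n x)%:E).
  by apply/measurable_EFinP; exact: continuous_measurable_borel.
have limg x : (g n x)%:E @[n --> \oo] --> ((\1_W x)%:E : \bar R).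
  have [Wx|nWx] := pselect (W x).
    apply: cvg_near_cst; have /uW ux := Wx.
    exists (Num.truncn (u x)^-1).+1 => // n /= nu.
    rewrite /g indicE mem_set// min_l//.
    rewrite -ler_pdivrMr// mul1r ltW//; apply: (lt_le_trans (truncnS_gt _)).
    by rewrite ler_nat.
  rewrite indicE memNset//; rewrite (_ : (fun n => _) = fun=> 0%E); first exact: cvg_cst.
  apply/funext => n; rewrite /g.
  have -> : u x = 0.
    by apply/eqP; rewrite eq_le u0 andbT leNgt; apply/negP => /uW.
  by rewrite mulr0 min_r.
have nd x : {homo (fun n => (g n x)%:E) : a b / (a <= b)%N >-> (a <= b)%E}.
  move=> a b ab; rewrite lee_fin /g le_min ge_min lexx /= ge_min; apply/orP; right.
  by rewrite ler_wpM2r// ler_nat.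
have H (m : probability (borel T) R) : m W = limn (fun n => \int[m]_x (g n x)%:E)%E.
  rewrite -monotone_convergence//; last first.
    by move=> n x _; rewrite lee_fin; case/andP: (g01 n x).
  rewrite -[in LHS](setIT W) -integral_indic//; last exact: sub_sigma_algebra.
  by apply: eq_integral => x _; apply/esym/cvg_lim.
rewrite !H; congr (limn _); apply/funext => n.
have := eqf (g n) (cg n) (g01 n); rewrite /Rintegral.
have fin (m : probability (borel T) R) : (\int[m]_x (g n x)%:E)%E \is a fin_num.
  apply: integrable_fin_num => //; apply: (@bounded_integrable _ _ _ _ _ 1) => //.
    exact: continuous_measurable_borel.
  by move=> x; have /andP[? ?] := g01 n x; rewrite ger0_norm.
by move=> /(congr1 (@EFin R)); rewrite !fineK ?fin.
Qed.

End open_indicator.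

Lemma cvg_finite_sum (R : realType) (T I : Type) (F : set_system T) (FF : Filter F)
    (r : seq I) (u : I -> T -> R) (l : I -> R) :
  (forall i, u i t @[t --> F] --> l i) ->
  \sum_(i <- r) u i t @[t --> F] --> \sum_(i <- r) l i.
Proof.
move=> ul; elim: r => [|i r IH].
  rewrite big_nil (_ : (fun t => _) = fun=> 0); first exact: cvg_cst.
  by apply/funext => t; rewrite big_nil.
rewrite big_cons (_ : (fun t => _) = fun t => u i t + \sum_(j <- r) u j t).
  exact: cvgD.
by apply/funext => t; rewrite big_cons.
Qed.

Section compact_limit.
Context (R : realType) (X : completePseudoMetricType R).
Hypothesis compactX : compact [set: X].

Lemma compact_unif_continuous (f : X -> R) (e : R) : continuous f -> 0 < e ->
  exists2 r, 0 < r & forall x y, ball x r y -> `|f x - f y| < e.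
Proof.
move=> cf e0; move/compact_near_coveringP: compactX.
move=> /(_ R (0^'+) (fun r x => forall y, ball x r y -> `|f x - f y| < e)).
case.
  move=> x _.
  have /cvgrPdist_lt/(_ (e / 2) ltac:(by rewrite divr_gt0)) := cf x.
  move=> /nbhs_ballP[r /= r0 rP].
  exists (ball x (r / 2), [set s : R | 0 < s < r / 2]) => /=.
    split; first by apply: nbhsx_ballx; rewrite divr_gt0.
    by near=> s => /=; apply/andP; split; near: s;
      [exact: nbhs_right_gt|apply: nbhs_right_lt; rewrite divr_gt0].
  move=> [x' s] /= [xx' /andP[s0 sr]] y x'y.
  rewrite (splitr e); apply: le_lt_trans (ler_distD (f x) _ _) _.
  rewrite ltrD//; last first.
    apply: rP; apply: (@ball_splitr _ _ x') => //.
      exact: ball_sym.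
    by apply: le_ball x'y; exact: ltW.
  rewrite distrC; apply: rP; apply: le_ball xx'.
  by rewrite ler_pdivrMr// ler_pMr// ler1n.
move=> r /= r0 rP; exists (r / 2); first by rewrite divr_gt0.
move=> x y xy; apply: (rP (r / 2) _ _ x I y xy) => /=; last by rewrite divr_gt0.
by rewrite sub0r normrN gtr0_norm ?divr_gt0// ltr_pdivrMr// ltr_pMr// ltr1n.
Unshelve. all: end_near. Qed.

Variable U0 : nat -> set X.
Hypothesis openU0 : forall n, open (U0 n).
Hypothesis baseU0 : forall x V, nbhs x V -> exists n, U0 n x /\ U0 n `<=` V.
Hypothesis hX : hausdorff_space X.

(** Finitely many small basic sets cover the compact space, so the first index of such a set around
    a point is bounded uniformly in the point. The existence of this index becomes a condition on
    finitely many bits. *)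
Lemma first_small_bounded k : exists N, forall x,
  exists2 i, (i <= N)%N & first_small U0 k i (base_code U0 x).
Proof.
move/compact_near_coveringP: compactX.
move=> /(_ nat \oo (fun N x => exists2 i, (i <= N)%N & U0 i x /\ small_base U0 k i)).
case.
  move=> x _; have [i [Ux sm]] := small_base_ex baseU0 k x.
  exists (U0 i, [set N | (i <= N)%N]) => /=.
    by split; [exact: open_nbhs_nbhs|exact: nbhs_infty_ge].
  by move=> [y N] /= [Uy iN]; exists i.
move=> N _ NP; exists N => x.
have [i iN [Ux sm]] := NP N (leqnn N) x I.
have [j sj] : exists j, first_small U0 k j (base_code U0 x).
  by apply: first_small_ex; exists i; rewrite sm andbT; apply/asboolP.
exists j => //; rewrite leqNgt; apply/negP => Nj.
have [_ /(_ i (leq_ltn_trans iN Nj))] := sj.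
by rewrite sm andbT => /asboolP.
Qed.

Variables (U : set_system nat) (UU : UltraFilter U).

(** The limit is taken on codes and then decoded. Mass could escape to incoherent sequences; it does
    not, since by compactness coherence is implied by countably many conditions on finitely many
    bits that all codes satisfy. *)
Lemma compact_limit_base (m : nat -> probability (borel X) R) :
  exists p : probability (borel X) R, forall f : X -> R, continuous f ->
    (forall x, 0 <= f x <= 1) ->
    \int[m N]_x f x @[N --> U] --> \int[p]_x f x.
Proof.
pose mc := measurable_base_code openU0.
pose n N : probability bits R := plaw (m N) mc.
have [nu nuP] := cantor_limit UU n.
pose p : probability (borel X) R := plaw nu (@measurable_base_decode _ _ U0).
exists p => f cf f01.
(* A condition on finitely many bits satisfied by all codes has mass 1 before the limit, hence also
   in the limit. *)
have nu1 S k : depends k S -> (forall x, S (base_code U0 x)) -> {ae nu, forall b, S b}.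
  move=> dS Sx.
  have mS := depends_measurable dS.
  have E : fine (nu S) = 1.
    apply: (cvg_unique _ (nuP _ _ dS)) => //.
    rewrite (_ : (fun N => _) = fun=> 1); first exact: cvg_cst.
    apply/funext => N; rewrite (_ : n N S = 1%E)//.
    transitivity (m N setT); last exact: probability_setT.
    by congr (m N _); apply/seteqP; split => // x _; exact: Sx.
  exists (~` S); split; [exact: measurableC| |exact: subset_refl].
  rewrite probability_setC// -[nu S]fineK; last exact: fin_num_measure.
  by rewrite E subee.
have coh : {ae nu, forall b, coherent U0 b}.
  have c1 k : {ae nu, forall b, exists i, first_small U0 k i b}.
    have [I IP] := first_small_bounded k.
    have := @nu1 [set b | exists2 i, (i <= I)%N & first_small U0 k i b] I.+1.
    case.
    - move=> x y xy [i iI sx]; exists i => //.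
      by apply: first_small_depends sx => j ji; apply: xy; exact: leq_trans ji _.
    - by move=> x; exact: IP.
    - by move=> S [mS S0 sS]; exists S; split => //; apply: subset_trans sS => b /= nb [i iI si]; apply: nb; exists i.
  have c2 k l i j : {ae nu, forall b, first_small U0 k i b -> first_small U0 l j b ->
      U0 i `&` U0 j !=set0}.
    have [|nUij] := pselect (U0 i `&` U0 j !=set0); first by move=> ?; apply: aeW.
    have := @nu1 [set b | ~ (first_small U0 k i b /\ first_small U0 l j b)] (maxn i.+1 j.+1).
    case.
    - move=> x y xy nx [yi yj]; apply: nx; split.
        by apply: first_small_depends yi => a ai; apply/esym/xy; rewrite leq_max ai.
      by apply: first_small_depends yj => a aj; apply/esym/xy; rewrite leq_max aj orbT.
    - move=> x [[/andP[/asboolP xi _] _] [/andP[/asboolP xj _] _]].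
      by apply: nUij; exists x.
    - move=> S [mS S0 sS]; exists S; split => //; apply: subset_trans sS => b /= nb nsij.
      by apply: nb => si sj; case: nsij.
  have := ae_foralln c1.
  have := ae_foralln (fun k => ae_foralln (fun l => ae_foralln (fun i => ae_foralln (c2 k l i)))).
  by apply: filterS2 => b bc bf; split.
apply/cvgrPdist_le => e e0.
have e3 : 0 < e / 3 by rewrite divr_gt0.
have [r r0 fr] := compact_unif_continuous cf e3.
have [k kr] : exists k, k.+1%:R^-1 < (r / 2 : R) by apply: invS_small; rewrite divr_gt0.
have [J JP] := first_small_bounded k.
(* A step function of finitely many bits replaces [f] by its value at the center of the first small
   set. The scale [k] is chosen so that the decoded point is within the modulus [r] of that center,
   which costs at most [e / 3]. *)
pose s (b : bits) : R := \sum_(i < J.+1) f (base_center U0 i) * \1_(first_small U0 k i) b.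
have sE b i : (i <= J)%N -> first_small U0 k i b -> s b = f (base_center U0 i).
  move=> iJ si; rewrite /s (bigD1 (Ordinal (iJ : (i < J.+1)%N)))//= indicE mem_set// mulr1.
  rewrite big1 ?addr0// => j ji; rewrite indicE memNset ?mulr0// => sj.
  by move/eqP: ji; apply; apply: val_inj; exact: (first_small_uniq sj si).
have ms : measurable_fun setT s.
  apply: measurable_sum => i; apply: measurable_funM; first exact: measurable_cst.
  by apply: measurable_indic; exact: depends_measurable (@first_small_depends _ _ U0 k i).
have s0 b : 0 <= s b.
  by apply: sumr_ge0 => i _; apply: mulr_ge0 => //; case/andP: (f01 (base_center U0 i)).
have sJ b : `|s b| <= J.+1%:R.
  rewrite ger0_norm//; apply: (@le_trans _ _ (\sum_(i < J.+1) (1 : R))); last first.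
    by rewrite sumr_const card_ord.
  apply: ler_sum => i _; rewrite indicE; have /andP[_ f1] := f01 (base_center U0 i).
  by case: (_ \in _); rewrite ?mulr1 ?mulr0.
have fJ x : `|f x| <= J.+1%:R.
  have /andP[fx0 fx1] := f01 x; rewrite ger0_norm//; apply: le_trans fx1 _.
  by rewrite ler1n.
have fs b i : coherent U0 b -> (i <= J)%N -> first_small U0 k i b ->
    `|f (base_decode U0 b) - s b| <= e / 3.
  move=> cb iJ si; rewrite (sE b i iJ si) distrC; apply: ltW; apply: fr.
  apply: le_ball (base_decodeP cb si).
  by have : forall x : R, x < r / 2 -> 2 * x <= r by [move=> x; lra]; apply.
have mf : measurable_fun setT (f : borel X -> R) by exact: continuous_measurable_borel.
have mfd : measurable_fun setT (fun b => f (base_decode U0 b)).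
  exact: (measurableT_comp mf (@measurable_base_decode _ _ U0)).
have pE : `|\int[p]_x f x - \int[nu]_b s b| <= e / 3.
  rewrite Rintegral_plaw//; last by move=> x; case/andP: (f01 x).
  apply: (@Rintegral_dist _ _ _ _ _ _ J.+1%:R) => //; first exact: ltW.
  have := @nu1 [set b | exists2 i, (i <= J)%N & first_small U0 k i b] J.+1.
  case.
  - move=> x y xy [i iI sx]; exists i => //.
    by apply: first_small_depends sx => j ji; apply: xy; exact: leq_trans ji _.
  - by move=> x; exact: JP.
  - move=> S [mS S0 sS].
    have aeS : {ae nu, forall b, exists2 i, (i <= J)%N & first_small U0 k i b} by exists S.
    by apply: filterS2 coh aeS => b cb [i iJ si]; exact: fs iJ si.
have mE N : `|\int[m N]_x f x - \int[n N]_b s b| <= e / 3.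
  rewrite Rintegral_plaw//.
  apply: (@Rintegral_dist _ _ _ _ _ _ J.+1%:R) => //; [|exact: ltW|].
    exact: (measurableT_comp ms mc).
  apply: aeW => x; have [i iJ si] := JP x.
  have := fs _ _ (coherent_code baseU0 x) iJ si.
  by rewrite base_codeK.
have stepI (mu : probability bits R) :
    \int[mu]_b s b = \sum_(i < J.+1) f (base_center U0 i) * fine (mu (first_small U0 k i)).
  rewrite /Rintegral /s.
  under eq_integral do rewrite -sumEFin.
  rewrite ge0_integral_sum//.
  - rewrite (_ : (\sum_(i < J.+1) _)%E = (\sum_(i < J.+1) f (base_center U0 i) *
      fine (mu (first_small U0 k i)))%:E)//.
    rewrite -sumEFin; apply: eq_bigr => i _.
    have mi := depends_measurable (@first_small_depends _ _ U0 k i).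
    under eq_integral do rewrite EFinM.
    rewrite ge0_integralZl//.
    + rewrite integral_indic// setIT EFinM fineK//; exact: fin_num_measure.
    + exact/measurable_EFinP/measurable_indic.
    + by rewrite lee_fin; case/andP: (f01 (base_center U0 i)).
  - move=> i; apply/measurable_EFinP; apply: measurable_funM; first exact: measurable_cst.
    by apply: measurable_indic; exact: depends_measurable (@first_small_depends _ _ U0 k i).
  - move=> i b _; rewrite lee_fin; apply: mulr_ge0 => //; by case/andP: (f01 (base_center U0 i)).
have slim : \int[n N]_b s b @[N --> U] --> \int[nu]_b s b.
  rewrite (_ : (fun N => _) = fun N => \sum_(i < J.+1) f (base_center U0 i) * fine (n N (first_small U0 k i))).
    rewrite stepI; apply: cvg_finite_sum => i; apply: cvgM; first exact: cvg_cst.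
    exact: nuP (@first_small_depends _ _ U0 k i).
  by apply/funext => N; exact: stepI.
have /cvgrPdist_le/(_ _ e3) := slim.
apply: filterS => N sN.
have := mE N; move: sN pE; move: (\int[p]_x f x) (\int[nu]_b s b) (\int[n N]_b s b) (\int[m N]_x f x).
move=> a1 a2 a3 a4; rewrite !ler_norml => /andP[? ?] /andP[? ?] /andP[? ?].
by apply/andP; split; lra.
Qed.

End compact_limit.

Lemma compact_limit (R : realType) (X : completePseudoMetricType R)
    (U : set_system nat) (m : nat -> probability (borel X) R) :
  polish X -> compact [set: X] -> UltraFilter U ->
  exists p : probability (borel X) R, forall f : X -> R, continuous f ->
    (forall x, 0 <= f x <= 1) ->
    \int[m N]_x f x @[N --> U] --> \int[p]_x f x.
Proof.
move=> [hX /countable_base[U0 [oU bU]]] cX UU.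
exact: (compact_limit_base cX oU bU hX UU).
Qed.

Lemma krylov_bogoliubov (R : realType) (X : completePseudoMetricType R)
    (T : R.-pker (borel X) ~> (borel X)) :
  polish X -> compact [set: X] -> weakly_continuous (fun x : X => T x) ->
  exists p : probability (borel X) R,
    forall S, measurable S -> (\int[p]_x T x S = p S)%E.
Proof.
move=> pX cX cT.
have [U [UU ooU]] := ultraFilterLemma (@eventually_filter).
pose q := fix q n : probability (borel X) R :=
  if n is k.+1 then mbind (q k) T else dirac (point : borel X).
have [p pP] := compact_limit (mavg q) pX cX UU.
exists p => S mS.
apply: (@borel_unique R X (mbind p T) p) mS => f cf f01.
have mf : measurable_fun setT (f : borel X -> R) by exact: continuous_measurable_borel.
have f0 x : 0 <= f x by case/andP: (f01 x).
pose g (x : X) : R := \int[T x]_y f y.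
have cg : continuous g.
  apply: cT => //; exists 1 => x.
  by have /andP[? ?] := f01 x; rewrite ger0_norm.
have g01 x : 0 <= g x <= 1 by exact: (Rintegral_01 (kprob T x)).
have mg : measurable_fun setT (g : borel X -> R) by exact: continuous_measurable_borel.
have bindE (r : probability (borel X) R) : \int[mbind r T]_x f x = \int[r]_x g x.
  rewrite /Rintegral ge0_integral_mbind//; last exact/measurable_EFinP.
  congr fine; apply: eq_integral => x _; rewrite /g /Rintegral fineK//.
  apply: integrable_fin_num => //.
  apply: (@bounded_integrable _ _ _ (kprob T x) _ 1) => // y.
  by have /andP[? ?] := f01 y; rewrite ger0_norm.
rewrite bindE; apply: (cvg_unique _ (pP g cg g01)) => //.
have qS j : \int[q j]_x g x = \int[q j.+1]_x f x by rewrite -bindE.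
(* Applying [T] shifts the sum of the Cesaro mean by one index; telescoping leaves an error of order
   [1 / N]. *)
have diff N : \int[mavg q N]_x g x = \int[mavg q N]_x f x +
    N.+1%:R^-1 * (\int[q N.+1]_x f x - \int[q 0%N]_x f x).
  rewrite !Rintegral_mavg// -mulrDr; congr (_ * _).
  under eq_bigr do rewrite qS.
  have telescope (u : nat -> R) n :
      \sum_(j < n) u j.+1 = \sum_(j < n) u j + (u n - u 0%N).
    elim: n => [|n IH]; first by rewrite !big_ord0 subrr addr0.
    by rewrite !big_ord_recr /= IH; ring.
  exact: (telescope (fun j => \int[q j]_x f x)).
rewrite (_ : (fun N => _) = fun N => \int[mavg q N]_x f x +
    N.+1%:R^-1 * (\int[q N.+1]_x f x - \int[q 0%N]_x f x)); last exact/funext.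
rewrite -(addr0 (\int[p]_x f x)); apply: cvgD; first exact: pP.
apply/cvgrPdist_le => e e0.
have [k ke] := invS_small e0.
apply: ooU; exists k => // N /= kN.
rewrite sub0r normrN normrM ger0_norm//.
apply: (@le_trans _ _ (N.+1%:R^-1 * 1)).
  apply: ler_wpM2l => //.
  have := Rintegral_01 (q N.+1) mf f01; have := Rintegral_01 (q 0%N) mf f01.
  move: (\int[q N.+1]_x f x) (\int[q 0%N]_x f x) => a b /andP[? ?] /andP[? ?].
  by rewrite ler_norml; apply/andP; split; lra.
rewrite mulr1; apply: le_trans (ltW ke).
by rewrite lef_pV2 ?posrE// ler_nat ltnS.
Qed.

(** * Conditional laws *)

Section kernel_constructions.
Context d1 d2 d3 (A : measurableType d1) (B : measurableType d2)
  (C : measurableType d3) (R : realType).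

Section kpush.
Variables (k : R.-pker A ~> B) (F : A * B -> C) (mF : measurable_fun setT F).

Definition kpush : A -> {measure set C -> \bar R} :=
  fun a => plaw (kprob k a) (measurableT_comp mF (pair1_measurable a)).

Let measurable_kpush S : measurable S -> measurable_fun setT (kpush ^~ S).
Proof.
move=> mS; have mFS : measurable (F @^-1` S) by exact: preimage_measurable.
have := @measurable_fun_xsection_finite_kernel _ _ _ _ R k _ (mem_set mFS).
by congr (measurable_fun _ _); apply/funext => a; rewrite xsectionE.
Qed.

HB.instance Definition _ := isKernel.Build _ _ _ _ _ kpush measurable_kpush.

Let kpush_prob a : kpush a setT = 1%E.
Proof. exact: (@probability_setT _ _ _ (kprob k a)). Qed.

HB.instance Definition _ := Kernel_isProbability.Build _ _ _ _ _ kpush kpush_prob.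

Lemma ge0_integral_kpush a (h : C -> \bar R) :
  measurable_fun setT h -> (forall c, 0 <= h c)%E ->
  (\int[kpush a]_c h c = \int[k a]_b h (F (a, b)))%E.
Proof. by move=> mh h0; rewrite /kpush ge0_integral_plaw. Qed.

End kpush.

Section kbind.
Variables (k : R.-pker A ~> B) (l : R.-pker (A * B) ~> C).

Definition kbind : A -> {measure set C -> \bar R} :=
  fun a => mbind (kprob k a) (kmap l (pair1_measurable a)).

Let measurable_kbind S : measurable S -> measurable_fun setT (kbind ^~ S).
Proof.
move=> mS.
exact: (@measurable_fun_integral_sfinite_kernel _ _ _ _ R (fun ab => l ab S) k _
  (measurable_kernel l S mS)).
Qed.

HB.instance Definition _ := isKernel.Build _ _ _ _ _ kbind measurable_kbind.

Let kbind_prob a : kbind a setT = 1%E.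
Proof. exact: (@probability_setT _ _ _ (mbind (kprob k a) (kmap l (pair1_measurable a)))). Qed.

HB.instance Definition _ := Kernel_isProbability.Build _ _ _ _ _ kbind kbind_prob.

Lemma ge0_integral_kbind a (h : C -> \bar R) :
  measurable_fun setT h -> (forall c, 0 <= h c)%E ->
  (\int[kbind a]_c h c = \int[k a]_b \int[l (a, b)]_c h c)%E.
Proof. by move=> mh h0; rewrite /kbind ge0_integral_mbind. Qed.

End kbind.

End kernel_constructions.

Section disint_facts.
Context d (Omega : measurableType d) (R : realType) (P : probability Omega R).

Lemma measurable_integral_kernel d1 d2 (A : measurableType d1)
    (B : measurableType d2) (k : R.-pker A ~> B) (h : A * B -> \bar R) :
  measurable_fun setT h -> (forall ab, 0 <= h ab)%E ->
  measurable_fun setT (fun a => \int[k a]_b h (a, b))%E.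
Proof. by move=> mh h0; exact: measurable_fun_integral_sfinite_kernel. Qed.

Lemma disint_map d1 d2 d3 (A : measurableType d1) (B : measurableType d2)
    (A' : measurableType d3) (z : Omega -> A) (x : Omega -> B) (f : A -> A')
    (k : A -> {measure set B -> \bar R}) (k' : A' -> {measure set B -> \bar R}) :
  measurable_fun setT f -> (forall a, k a = k' (f a)) ->
  disint P z x k -> disint P (fun w => f (z w)) x k'.
Proof.
move=> mf kk' dP h mh h0.
rewrite (dP (fun ab => h (f ab.1, ab.2)))//.
- by apply: eq_integral => w _; rewrite kk'.
- apply: (measurableT_comp mh); apply: measurable_fun_pair; last exact: measurable_snd.
  by apply: (measurableT_comp mf); exact: measurable_fst.
Qed.

Lemma disint_set d1 d2 (A : measurableType d1) (B : measurableType d2)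
    (z : Omega -> A) (x : Omega -> B) (k : A -> {measure set B -> \bar R}) S C :
  measurable_fun setT z -> measurable_fun setT x ->
  disint P z x k -> measurable S -> measurable C ->
  (P (z @^-1` S `&` x @^-1` C) = \int[P]_(w in z @^-1` S) k (z w) C)%E.
Proof.
move=> mz mx dP mS mC.
have mSC : measurable (S `*` C) by exact: measurableX.
have mi : measurable_fun setT (fun ab : A * B => (\1_(S `*` C) ab)%:E : \bar R).
  by apply/measurable_EFinP; exact: measurable_indic.
have i0 ab : (0 <= (\1_(S `*` C) ab)%:E :> \bar R)%E by rewrite lee_fin.
rewrite -(setIT (_ `&` _)) -integral_indic//; last first.
  by apply: measurableI; exact: preimage_measurable.
rewrite [LHS](dP _ mi i0).
rewrite [RHS]integral_mkcond; apply: eq_integral => w _; rewrite patchE.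
have -> : (w \in z @^-1` S) = (z w \in S) by [].
have [Sw|nSw] := boolP (z w \in S).
  rewrite (_ : (fun b => _) = fun b => (\1_C b)%:E) ?integral_indic ?setIT//.
  apply/funext => b; rewrite !indicE; congr ((nat_of_bool _)%:R%:E).
  by apply/idP/idP => /set_mem; [case=> _ Cb; exact: mem_set|move=> Cb; apply/mem_set; split => //=; exact: set_mem].
rewrite integral0_eq// => b _; rewrite indicE memNset//= => -[Sw _].
by move/negP: nSw; apply; exact: mem_set.
Qed.

Lemma disint_unique d1 d2 (A : measurableType d1) (B : measurableType d2)
    (z : Omega -> A) (x : Omega -> B) (k k' : R.-pker A ~> B) C :
  measurable_fun setT z -> measurable_fun setT x ->
  disint P z x k -> disint P z x k' -> measurable C ->
  {ae P, forall w, k (z w) C = k' (z w) C}.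
Proof.
move=> mz mx dk dk' mC.
have [N [mN N0 sN]] : {ae plaw P mz, forall a, k a C = k' a C}.
  have mk (l : R.-pker A ~> B) := measurable_kernel l C mC.
  have : ae_eq (plaw P mz) setT (fun a => k a C) (fun a => k' a C).
    apply: integral_ae_eq => //; [|exact: mk|].
      apply/integrableP; split; first exact: mk.
      rewrite (_ : (\int[_]_a _)%E = mbind (plaw P mz) k C).
        by apply: le_lt_trans (probability_le1 _ mC) _; rewrite ltry.
      by apply: eq_integral => a _; rewrite gee0_abs.
    move=> S _ mS.
    have E (l : R.-pker A ~> B) : disint P z x l ->
        (\int[plaw P mz]_(a in S) l a C = P (z @^-1` S `&` x @^-1` C))%E.
      move=> dl; rewrite (disint_set mz mx dl mS mC).
      rewrite integral_mkcond [RHS]integral_mkcond ge0_integral_plaw//.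
      - by move: (mk l) => ml; apply/(measurable_restrictT _ _).1 => //; exact: measurable_funTS.
      - by move=> a; rewrite patchE; case: ifP.
    by rewrite !E.
  by apply: filterS => a /(_ I).
exists (z @^-1` N); split => //; first exact: preimage_measurable.
by move=> w /= nw; apply: sN => /= e; apply: nw.
Qed.

Lemma disint_trans d1 d2 d3 (A : measurableType d1) (B : measurableType d2)
    (C : measurableType d3) (z : Omega -> A) (x : Omega -> B) (y : Omega -> C)
    (k : R.-pker A ~> B) (l : R.-pker (A * B) ~> C) :
  disint P z x k -> disint P (fun w => (z w, x w)) y l ->
  disint P z y (kbind k l).
Proof.
move=> dk dl h mh h0.
have mh' : measurable_fun setT (fun abc : (A * B) * C => h (abc.1.1, abc.2)).
  apply: (measurableT_comp mh); apply: measurable_fun_pair; last exact: measurable_snd.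
  by apply: measurableT_comp; [exact: measurable_fst|exact: measurable_fst].
rewrite (dl (fun abc => h (abc.1.1, abc.2)))//=.
rewrite (dk (fun ab => \int[l ab]_c h (ab.1, c))%E).
- apply: eq_integral => w _; rewrite ge0_integral_kbind//.
  exact: (measurableT_comp mh (@pair1_measurable _ _ A C (z w))).
- exact: (measurable_integral_kernel l mh').
- by move=> ab; exact: integral_ge0.
Qed.

End disint_facts.

(** Countably many cylinders determine a probability on a coded space, so the null sets attached to
    the single events can be united into one. *)
Lemma ae_countable_probability d d' (Omega : measurableType d) (B : measurableType d')
    (R : realType) (P : probability Omega R) (f g : Omega -> pprobability B R) :
  coded B ->
  (forall A, measurable A ->
    {ae P, forall w, (f w : probability B R) A = (g w : probability B R) A}) ->
  {ae P, forall w, indist (f w) (g w)}.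
Proof.
move=> [c [e [mc me ecK]]] fg.
have aes n : {ae P, forall w, (f w : probability B R) (c @^-1` cyl (odflt [::] (unpickle n)))
    = (g w : probability B R) (c @^-1` cyl (odflt [::] (unpickle n)))}.
  by apply: fg; apply: preimage_measurable mc _; exact: measurable_cyl.
have := ae_foralln aes; apply: filterS => w fgw.
apply: (@indist_gen _ (pprobability B R) (@pset _ B R)) => //.
move=> _ [r _ [A mA <-]]; rewrite /mset /=.
suff -> : (f w : probability B R) A = (g w : probability B R) A by [].
have E (p : probability B R) : p A = p (c @^-1` (e @^-1` A)).
  by congr (p _); apply/seteqP; split => x /=; rewrite ecK.
rewrite !E.
apply: (@bits_unique R (plaw (f w : probability B R) mc) (plaw (g w : probability B R) mc)).
- by rewrite [ltLHS]probability_setT ltry.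
- by move=> q; have := fgw (pickle q); rewrite pickleK.
- exact: preimage_measurable.
Qed.

Lemma indist_pprob d (B : measurableType d) (R : realType)
    (p q : pprobability B R) A : indist p q -> measurable A ->
  (p : probability B R) A = (q : probability B R) A.
Proof.
move=> pq mA.
exact: (indist_ereal (measurable_kernel
  (kprobability (@measurable_id _ (pprobability B R) setT)) A mA) pq).
Qed.

Section restricted_law.
Context d d' (A : measurableType d) (B : measurableType d') (R : realType).
Variables (P : probability A R) (f : A -> B) (D : set A)
  (mf : measurable_fun setT f) (mD : measurable D).

(** The measure to be differentiated with respect to the law of [f] when conditioning on it. *)
Definition restricted_law of measurable_fun setT f & measurable D :
  set B -> \bar R := fun S => P (f @^-1` S `&` D).

Let restricted_law0 : restricted_law mf mD set0 = 0%E.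
Proof. by rewrite /restricted_law preimage_set0 set0I measure0. Qed.

Let restricted_law_ge0 S : (0 <= restricted_law mf mD S)%E.
Proof. exact: measure_ge0. Qed.

Let restricted_law_sigma_additive : semi_sigma_additive (restricted_law mf mD).
Proof.
move=> F mF tF mUF; rewrite /restricted_law preimage_bigcup setI_bigcupl.
apply: measure_semi_sigma_additive.
- by move=> n; apply: measurableI => //; exact: preimage_measurable.
- apply/trivIsetP => /= i j _ _ ij; rewrite setIACA -preimage_setI.
  by move/trivIsetP : tF => /(_ _ _ _ _ ij) ->//; rewrite preimage_set0 set0I.
- rewrite -setI_bigcupl -preimage_bigcup.
  by apply: measurableI => //; exact: preimage_measurable.
Qed.

HB.instance Definition _ := isMeasure.Build _ _ _ (restricted_law mf mD)
  restricted_law0 restricted_law_ge0 restricted_law_sigma_additive.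

Let restricted_law_fin : fin_num_fun (restricted_law mf mD).
Proof.
move=> S mS; apply: fin_num_measure; apply: measurableI => //.
exact: preimage_measurable.
Qed.

HB.instance Definition _ := Measure_isFinite.Build _ _ _ (restricted_law mf mD)
  restricted_law_fin.

End restricted_law.

(* The conditional probabilities of the cylinders, given by the Radon-Nikodym
   theorem, form almost everywhere a system of weights. *)
Lemma exists_disint d d1 d2 (Omega : measurableType d) (A : measurableType d1)
    (B : measurableType d2) (R : realType) (P : probability Omega R)
    (z : Omega -> A) (x : Omega -> B) :
  measurable_fun setT z -> measurable_fun setT x -> coded B ->
  exists2 g : A -> pprobability B R, measurable_fun setT g &
    disint P z x (fun a => (g a : probability B R)).
Proof.
move=> mz mx [c [e [mc me ecK]]].
pose lam := plaw P mz.
have mcx : measurable_fun setT (c \o x) by exact: measurableT_comp.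
have mcxs s : measurable ((c \o x) @^-1` cyl s).
  by apply: preimage_measurable => //; exact: measurable_cyl.
have RN s : exists f : A -> \bar R, [/\ forall a, (0 <= f a)%E,
    forall a, f a \is a fin_num, lam.-integrable setT f &
    forall S, measurable S -> (P (z @^-1` S `&` (c \o x) @^-1` cyl s) = \int[lam]_(a in S) f a)%E].
  apply: (@radon_nikodym_sigma_finite _ _ _ lam (restricted_law P mz (mcxs s))).
  apply/null_content_dominatesP => S mS lS; apply/eqP; rewrite eq_le measure_ge0 andbT.
  rewrite -lS; apply: le_measure; rewrite ?inE.
  - by apply: measurableI => //; exact: preimage_measurable.
  - exact: preimage_measurable.
  - exact: subIsetl.
have [f fP] := choice RN.
have f0 s a : (0 <= f s a)%E by case: (fP s).
have ffin s a : f s a \is a fin_num by case: (fP s).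
have fint s : lam.-integrable setT (f s) by case: (fP s).
have mf s : measurable_fun setT (f s) by exact: measurable_int (fint s).
have fE s S : measurable S ->
    (P (z @^-1` S `&` (c \o x) @^-1` cyl s) = \int[lam]_(a in S) f s a)%E.
  by case: (fP s) => _ _ _; exact.
pose w (a : A) : paths (seq bool) (measurableTypeR R) := fun s => fine (f s a).
have mw : measurable_fun setT w.
  by apply: measurable_path => s; apply: measurableT_comp; [exact: fine_measurable|exact: mf].
have wE s a : (w a s)%:E = f s a by rewrite /w fineK.
have fint1 : lam.-integrable setT (cst 1%E).
  exact: (@bounded_integrable _ _ _ lam (fun=> 1) 1 (measurable_cst _) (fun=> ltac:(by rewrite normr1))).
have aew : {ae lam, forall a, weights (w a)}.
  have ae1 : {ae lam, forall a, f [::] a = 1%E}.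
    have : ae_eq lam setT (f [::]) (cst 1%E).
      apply: integral_ae_eq => //.
      move=> S _ mS; rewrite -fE// integral_cst// mul1e.
      by rewrite /lam /plaw /pushforward /= preimage_setT setIT.
    by apply: filterS => a /(_ I).
  have ae2 s : {ae lam, forall a, f s a = (f (true :: s) a + f (false :: s) a)%E}.
    have : ae_eq lam setT (f s) (fun a => f (true :: s) a + f (false :: s) a)%E.
      apply: integral_ae_eq => //; first exact: emeasurable_funD.
      move=> S _ mS; rewrite ge0_integralD//; [|exact: measurable_funTS|exact: measurable_funTS].
      rewrite -!fE//.
      have := cyl_split setT s; rewrite !setTI => ->.
      rewrite preimage_setU setIUr measureU//.
      + by apply: measurableI; [exact: preimage_measurable|exact: mcxs].
      + by apply: measurableI; [exact: preimage_measurable|exact: mcxs].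
      + by rewrite setIACA setIid -preimage_setI; have := cyl_disj setT s; rewrite !setTI => ->;
          rewrite preimage_set0 setI0.
    by apply: filterS => a /(_ I).
  have := ae_foralln (fun n => ae2 (odflt [::] (unpickle n))).
  apply: filterS2 ae1 => a a1 a2; split.
  - by rewrite /w a1.
  - by move=> s; apply: (@EFin_inj R); rewrite EFinD !wE; have := a2 (pickle s); rewrite pickleK.
  - by move=> s; apply: fine_ge0.
pose gb := kprobability (measurableT_comp (measurable_decode_law (@measurable_id _ bits setT)) mw).
exists (fun a => decode_law me (w a)).
  exact: (measurableT_comp (measurable_decode_law me) mw).
pose Q1 := plaw P (measurable_fun_pair mz mcx).
pose Q2 := mbind lam (kgraph gb).
(* With [S] fixed, both sides are finite measures in [D], so cylinders suffice; on these the
   equality is the Radon-Nikodym identity. *)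
have Q12 S D : measurable S -> measurable D -> Q1 (S `*` D) = Q2 (S `*` D).
  move=> mS mD.
  have mST : measurable (S `*` [set: bits]) by exact: measurableX.
  pose r1 := restricted_law Q1 (@measurable_snd _ _ A bits) mST.
  pose r2 := restricted_law Q2 (@measurable_snd _ _ A bits) mST.
  have rect (D' : set bits) : snd @^-1` D' `&` S `*` setT = S `*` D' :> set (A * bits).
    by apply/seteqP; split => -[a b] /=; tauto.
  suff : r1 D = r2 D by rewrite /r1 /r2 /restricted_law rect.
  apply: (@bits_unique R r1 r2) => //.
    apply: le_lt_trans (probability_le1 Q1 _) _; last by rewrite ltry.
    by apply: measurableI => //; exact: preimage_measurable.
  move=> s; change (Q1 (snd @^-1` cyl s `&` S `*` setT) = Q2 (snd @^-1` cyl s `&` S `*` setT)).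
  rewrite rect.
  have mSs : measurable (S `*` cyl s) by apply: measurableX => //; exact: measurable_cyl.
  transitivity (P (z @^-1` S `&` (c \o x) @^-1` cyl s)) => //.
  rewrite fE// /Q2 /mbind integral_mkcond.
  apply: ae_eq_integral => //.
  - by apply/(measurable_restrictT _ _).1 => //; exact: measurable_funTS.
  - exact: (measurable_kernel (kgraph gb)).
  apply: filterS aew => a wa _; rewrite patchE kgraphX; case: ifPn => // _.
  by rewrite -wE -(unif01_cyl s wa).
pose g := kprobability (measurableT_comp (measurable_decode_law me) mw).
apply: (@disintP _ _ _ _ _ _ R measurable P z x g) => //.
- by apply/esym; apply: sigma_algebra_id; exact: sigma_algebra_measurable.
- by move=> S S' mS mS'; exact: measurableI.
move=> S C mS mC.
have meC : measurable (e @^-1` C) by exact: preimage_measurable.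
transitivity (Q1 (S `*` (e @^-1` C))).
  congr (P _); apply/seteqP; split => a /= [Sa Ca]; split => //=.
    exact: (ecK (x a) C mC).2.
  exact: (ecK (x a) C mC).1.
rewrite Q12//.
rewrite integral_mkcond /Q2 /= /mbind ge0_integral_plaw//; last first.
  by apply: (measurable_kernel (kgraph gb)); exact: measurableX.
by apply: eq_integral => a _; rewrite patchE kgraphX.
Qed.

(** * Joint process of beliefs, states and noises *)

Section filter_model.
Context (R : realType) dX dY dV (X : measurableType dX) (Y : measurableType dY)
  (V : measurableType dV).
Variables (T : R.-pker X ~> X) (nu : probability V R) (G : X * V -> Y)
  (Q : R.-pker X ~> Y).
Hypothesis mG : measurable_fun setT G.
Hypothesis QE : forall x C, measurable C -> Q x C = nu [set v | C (G (x, v))].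

Let PX : measurableType _ := pprobability X R.
Let E : measurableType _ := (PX * X * V)%type.

Definition id_kernel : R.-pker PX ~> X := kprobability (@measurable_id _ PX setT).

(* Law of (X_{t+1}, Y_{t+1}) given X_t. *)
Definition state_obs_kernel : R.-pker X ~> (X * Y)%type :=
  kbind T (kmap (kgraph Q) (@measurable_snd _ _ X X)).

(** The joint law of the next state and the next observation when the current state is drawn from
    the belief. *)
Definition belief_obs_kernel : R.-pker PX ~> (X * Y)%type :=
  kbind id_kernel (kmap state_obs_kernel (@measurable_snd _ _ PX X)).

Lemma ge0_integral_noise x (h : Y -> \bar R) : measurable_fun setT h ->
  (forall y, 0 <= h y)%E -> (\int[nu]_v h (G (x, v)) = \int[Q x]_y h y)%E.
Proof.
move=> mh h0.
have mGx : measurable_fun setT (fun v => G (x, v)).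
  exact: (measurableT_comp mG (pair1_measurable x)).
rewrite -(ge0_integral_plaw nu mGx mh h0); apply: eq_measure_integral => C mC _.
exact/esym/QE.
Qed.

Lemma ge0_integral_state_obs x (h : X * Y -> \bar R) : measurable_fun setT h ->
  (forall xy, 0 <= h xy)%E ->
  (\int[state_obs_kernel x]_xy h xy = \int[T x]_x' \int[Q x']_y h (x', y))%E.
Proof.
move=> mh h0; rewrite ge0_integral_kbind//; apply: eq_integral => x' _.
by rewrite /= /kmap /kgraph ge0_integral_plaw.
Qed.

Lemma ge0_integral_belief_obs (p : PX) (h : X * Y -> \bar R) :
  measurable_fun setT h -> (forall xy, 0 <= h xy)%E ->
  (\int[belief_obs_kernel p]_xy h xy =
   \int[(p : probability X R)]_x \int[state_obs_kernel x]_xy h xy)%E.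
Proof. by move=> mh h0; rewrite ge0_integral_kbind. Qed.

Variable Phi : PX * Y -> PX.
Hypothesis mPhi : measurable_fun setT Phi.

Section step.

Let noise : R.-pker (PX * X * X)%type ~> V :=
  kprobability (@measurable_cst _ _ (PX * X * X)%type (pprobability V R) setT nu).

Let F (a : PX * X * X * V) : E := (Phi (a.1.1.1, G (a.1.2, a.2)), a.1.2, a.2).

Let mF : measurable_fun setT F.
Proof.
have m1 : measurable_fun setT (fun a : PX * X * X * V => a.1.2).
  by apply: measurableT_comp; [exact: measurable_snd|exact: measurable_fst].
apply: measurable_fun_pair; last exact: measurable_snd.
apply: measurable_fun_pair; last exact: m1.
apply: (measurableT_comp mPhi); apply: measurable_fun_pair.
  apply: (measurableT_comp (@measurable_fst _ _ PX X)).
  by apply: measurableT_comp; [exact: measurable_fst|exact: measurable_fst].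
by apply: (measurableT_comp mG); exact: measurable_fun_pair.
Qed.

(* The transition of (belief, state, noise) does not depend on the current
   noise. *)
Definition joint_step : R.-pker (PX * X)%type ~> E :=
  kbind (kmap T (@measurable_snd _ _ PX X)) (kpush noise mF).

Lemma ge0_integral_joint_step px (h : E -> \bar R) : measurable_fun setT h ->
  (forall z, 0 <= h z)%E ->
  (\int[joint_step px]_z h z =
   \int[T px.2]_x' \int[nu]_v h (Phi (px.1, G (x', v)), x', v))%E.
Proof.
move=> mh h0; rewrite ge0_integral_kbind//; apply: eq_integral => x' _.
by rewrite ge0_integral_kpush.
Qed.

End step.

Definition joint_kernel : R.-pker E ~> E :=
  kmap joint_step (@measurable_fst _ _ (PX * X)%type V).

(** Each step redraws the noise and forgets the old one, so invariance is needed only for the pair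
    (belief, state). The invariant law of the triple is obtained by making one step from [mu]. *)
Lemma exists_joint_process (mu : probability (PX * X)%type R) :
  coded X -> coded V ->
  (forall h : PX * X -> \bar R, measurable_fun setT h -> (forall px, 0 <= h px)%E ->
    \int[mu]_px \int[joint_step px]_z h z.1 = \int[mu]_px h px)%E ->
  exists2 L : probability (paths int E) R, stationary_markov joint_kernel L &
    forall t (h : PX * X -> \bar R), measurable_fun setT h ->
      (forall px, 0 <= h px)%E ->
      (\int[L]_w h (w t).1 = \int[mu]_px h px)%E.
Proof.
move=> cX cV inv.
have cE : coded E.
  by apply: coded_prod => //; apply: coded_prod => //; exact: coded_pprobability.
have [|L sL LE] := @exists_stationary_markov _ E R joint_kernel (mbind mu joint_step) _ cE.
  move=> S mS.
  rewrite [LHS](ge0_integral_mbind mu joint_step (measurable_kernel joint_kernel S mS))//.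
  exact: (inv (fun px => joint_step px S) (measurable_kernel joint_step S mS)).
exists L => // t h mh h0.
rewrite -inv// -ge0_integral_mbind//; last first.
  by apply: (measurableT_comp mh); exact: measurable_fst.
have mt : measurable_fun setT (fun w : paths int E => w t : E) by exact: measurable_coord.
have mhf : measurable_fun setT (fun z : E => h z.1).
  by apply: (measurableT_comp mh); exact: measurable_fst.
rewrite -[LHS](ge0_integral_plaw L mt mhf)//.
by apply: eq_measure_integral => S mS _; exact: LE.
Qed.

Section process.
Variable L : probability (paths int E) R.
Hypothesis sL : stationary_markov joint_kernel L.

Definition belief t (w : paths int E) : PX := (w t).1.1.
Definition state t (w : paths int E) : X := (w t).1.2.
Definition noise t (w : paths int E) : V := (w t).2.
Definition observation t (w : paths int E) : Y := G (state t w, noise t w).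

Lemma measurable_belief t : measurable_fun setT (belief t).
Proof.
apply: (measurableT_comp (@measurable_fst _ _ PX X)).
by apply: (measurableT_comp (@measurable_fst _ _ (PX * X)%type V)); exact: measurable_coord.
Qed.

Lemma measurable_state t : measurable_fun setT (state t).
Proof.
apply: (measurableT_comp (@measurable_snd _ _ PX X)).
by apply: (measurableT_comp (@measurable_fst _ _ (PX * X)%type V)); exact: measurable_coord.
Qed.

Lemma measurable_noise t : measurable_fun setT (noise t).
Proof.
by apply: (measurableT_comp (@measurable_snd _ _ (PX * X)%type V)); exact: measurable_coord.
Qed.

Lemma measurable_observation t : measurable_fun setT (observation t).
Proof.
apply: (measurableT_comp mG); apply: measurable_fun_pair.
  exact: measurable_state.
exact: measurable_noise.
Qed.

Lemma pastp0 t (w : paths int E) : pastp t w 0%N = w t.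
Proof. by rewrite /pastp subr0. Qed.

Lemma ge0_integral_next t (h : paths nat E * E -> \bar R) :
  measurable_fun setT h -> (forall hz, 0 <= h hz)%E ->
  (\int[L]_w h (pastp t w, w (t + 1)%R) =
   \int[L]_w \int[T (state t w)]_x' \int[nu]_v
      h (pastp t w, (Phi (belief t w, G (x', v)), x', v)))%E.
Proof.
move=> mh h0; rewrite (sL.1 t h mh h0). apply: eq_integral => w _.
rewrite ge0_integral_joint_step//.
  by rewrite pastp0.
exact: (measurableT_comp mh (@pair1_measurable _ _ (paths nat E) E (pastp t w))).
Qed.

(** By the Markov property any information [f] on the past may be kept along with the state. It will
    be a window of beliefs and observations for uniqueness, and the history of observations for
    existence. *)
Lemma disint_next t dD (D : measurableType dD) (f : paths nat E -> D) :
  measurable_fun setT f ->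
  disint L (fun w => (f (pastp t w), state t w))
    (fun w => (state (t + 1) w, observation (t + 1) w))
    (kmap state_obs_kernel (@measurable_snd _ _ D X)).
Proof.
move=> mf h mh h0.
pose st (g : paths nat E) : X := (g 0%N).1.2.
have mst : measurable_fun setT st.
  apply: (measurableT_comp (@measurable_snd _ _ PX X)).
  by apply: (measurableT_comp (@measurable_fst _ _ (PX * X)%type V)); exact: measurable_coord.
pose h' (gz : paths nat E * E) := h ((f gz.1, st gz.1), (gz.2.1.2, G (gz.2.1.2, gz.2.2))).
have mz2 : measurable_fun setT (fun gz : paths nat E * E => gz.2.1.2).
  apply: (measurableT_comp (@measurable_snd _ _ PX X)).
  by apply: (measurableT_comp (@measurable_fst _ _ (PX * X)%type V)); exact: measurable_snd.
have mh' : measurable_fun setT h'.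
  apply: (measurableT_comp mh); apply: measurable_fun_pair; apply: measurable_fun_pair => //.
  - by apply: (measurableT_comp mf); exact: measurable_fst.
  - by apply: (measurableT_comp mst); exact: measurable_fst.
  - apply: (measurableT_comp mG); apply: measurable_fun_pair => //.
    by apply: (measurableT_comp (@measurable_snd _ _ (PX * X)%type V)); exact: measurable_snd.
have stE w : st (pastp t w) = state t w by rewrite /st pastp0.
transitivity (\int[L]_w h' (pastp t w, w (t + 1)%R))%E.
  by apply: eq_integral => w _; rewrite /h' stE.
rewrite ge0_integral_next//; last by move=> gz; exact: h0.
apply: eq_integral => w _.
have mhw : measurable_fun setT (fun xy => h ((f (pastp t w), state t w), xy)).
  exact: (measurableT_comp mh (@pair1_measurable _ _ (D * X)%type (X * Y)%type (f (pastp t w), state t w))).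
rewrite ge0_integral_state_obs//; apply: eq_integral => x' _.
rewrite /h' /= stE.
rewrite (ge0_integral_noise x' (h := fun y => h ((f (pastp t w), state t w), (x', y))))//.
exact: (measurableT_comp mhw (@pair1_measurable _ _ X Y x')).
Qed.

End process.

Hypothesis update : forall (p : probability X R) A C, measurable A -> measurable C ->
  (\int[p]_x \int[T x]_x' \int[Q x']_(y in C) (Phi (p, y) : probability X R) A =
   \int[p]_x \int[T x]_(x' in A) Q x' C)%E.

Let kPhi : R.-pker (PX * Y)%type ~> X := kprobability mPhi.

(** The hypothesis [update] is this disintegration on rectangles, and [disintP] extends it to all
    functions. *)
Lemma disint_update (p : PX) :
  disint (kprob belief_obs_kernel p) (@snd X Y) (@fst X Y)
    (kmap kPhi (@pair1_measurable _ _ PX Y p)).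
Proof.
apply: (@disintP _ _ _ _ _ _ R measurable) => //.
- by apply/esym; apply: sigma_algebra_id; exact: sigma_algebra_measurable.
- by move=> S S' mS mS'; exact: measurableI.
move=> C A mC mA.
have mAC : measurable (A `*` C) by exact: measurableX.
transitivity (\int[belief_obs_kernel p]_xy (\1_(A `*` C) xy)%:E)%E.
  rewrite (integral_indicT _ mAC).
  by congr (kprob belief_obs_kernel p _); apply/seteqP; split => -[x y] /=; tauto.
rewrite ge0_integral_belief_obs//; last exact/measurable_EFinP/measurable_indic.
transitivity (\int[(p : probability X R)]_x \int[T x]_(x' in A) Q x' C)%E.
  apply: eq_integral => x _; rewrite ge0_integral_state_obs//;
    last exact/measurable_EFinP/measurable_indic.
  rewrite [RHS]integral_mkcond; apply: eq_integral => x' _; rewrite patchE.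
  case: ifPn => [/set_mem Ax'|/negP nAx'].
    rewrite (_ : (fun y => _) = fun y => (\1_C y)%:E) ?integral_indic ?setIT//.
    apply/funext => y; rewrite !indicE; congr ((nat_of_bool _)%:R%:E).
    by apply/idP/idP => /set_mem; [case=> _ Cb; exact: mem_set|move=> Cb; apply/mem_set].
  rewrite integral0_eq// => y _; rewrite indicE memNset//= => -[Ax' _].
  by apply: nAx'; exact: mem_set.
rewrite -update//.
have mPA : measurable_fun setT (fun y => (Phi (p, y) : probability X R) A).
  exact: (measurableT_comp (measurable_kernel kPhi A mA) (@pair1_measurable _ _ PX Y p)).
rewrite [RHS]integral_mkcond.
rewrite (_ : _ \_ _ = (fun xy : X * Y => ((fun y => (Phi (p, y) : probability X R) A) \_ C) xy.2)); last first.
  by apply/funext => xy; rewrite !patchE.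
have mPC : measurable_fun setT ((fun y => (Phi (p, y) : probability X R) A) \_ C).
  by apply/(measurable_restrictT _ _).1 => //; exact: measurable_funTS.
have PC0 y : (0 <= ((fun y => (Phi (p, y) : probability X R) A) \_ C) y)%E.
  by rewrite patchE; case: ifP.
have mPCs : measurable_fun setT
    (fun xy : X * Y => ((fun y => (Phi (p, y) : probability X R) A) \_ C) xy.2).
  by apply: (measurableT_comp mPC); exact: measurable_snd.
rewrite [RHS](ge0_integral_belief_obs p mPCs)//.
apply: eq_integral => x _.
rewrite [RHS](ge0_integral_state_obs x mPCs)//.
by apply: eq_integral => x' _; rewrite integral_mkcond.
Qed.

(* One step of Bayes' rule: a conditional law pi of X_t is turned into the
   conditional law Phi(pi, Y_{t+1}) of X_{t+1}. *)
Lemma disint_filter_step dO dD (Omega : measurableType dO) (D : measurableType dD)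
    (P : probability Omega R) (z : Omega -> D) (x x' : Omega -> X) (y' : Omega -> Y)
    (pi : D -> PX) (mpi : measurable_fun setT pi) :
  disint P z x (kprobability mpi) ->
  disint P (fun w => (z w, x w)) (fun w => (x' w, y' w))
    (kmap state_obs_kernel (@measurable_snd _ _ D X)) ->
  disint P z (fun w => (x' w, y' w)) (kmap belief_obs_kernel mpi) /\
  disint P (fun w => (z w, y' w)) x' (fun dy => (Phi (pi dy.1, dy.2) : probability X R)).
Proof.
move=> dzx dzxy.
have joint : disint P z (fun w => (x' w, y' w)) (kmap belief_obs_kernel mpi).
  move=> h mh h0; rewrite (disint_trans dzx dzxy mh h0).
  apply: eq_integral => w _.
  have mhw : measurable_fun setT (fun xy => h (z w, xy)).
    exact: (measurableT_comp mh (@pair1_measurable _ _ D (X * Y)%type (z w))).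
  by rewrite ge0_integral_kbind// /kmap ge0_integral_belief_obs.
split=> // h mh h0.
have mkP : measurable_fun setT (fun dy : D * Y => (pi dy.1, dy.2)).
  apply: measurable_fun_pair; last exact: measurable_snd.
  by apply: (measurableT_comp mpi); exact: measurable_fst.
pose h1 (dxy : D * (X * Y)) := h ((dxy.1, dxy.2.2), dxy.2.1).
pose h2 (dxy : D * (X * Y)) :=
  (\int[kmap kPhi mkP (dxy.1, dxy.2.2)]_a h ((dxy.1, dxy.2.2), a))%E.
have m22 : measurable_fun setT (fun dxy : D * (X * Y) => (dxy.1, dxy.2.2)).
  apply: measurable_fun_pair; first exact: measurable_fst.
  by apply: measurableT_comp; [exact: measurable_snd|exact: measurable_snd].
have mh1 : measurable_fun setT h1.
  apply: (measurableT_comp mh); apply: measurable_fun_pair => //.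
  by apply: measurableT_comp; [exact: measurable_fst|exact: measurable_snd].
have mh2 : measurable_fun setT h2.
  exact: (measurableT_comp (measurable_integral_kernel (kmap kPhi mkP) mh h0) m22).
have h20 dxy : (0 <= h2 dxy)%E by exact: integral_ge0.
rewrite [LHS](joint h1 mh1 (fun _ => h0 _)).
rewrite [RHS](joint h2 mh2 h20).
apply: eq_integral => w _.
pose h3 (ya : Y * X) := h ((z w, ya.1), ya.2).
have mh3 : measurable_fun setT h3.
  apply: (measurableT_comp mh); apply: measurable_fun_pair; last exact: measurable_snd.
  by apply: measurable_fun_pair; [exact: measurable_cst|exact: measurable_fst].
exact: (disint_update (pi (z w)) mh3 (fun _ => h0 _)).
Qed.

End filter_model.

(** * Stationary joint processes carrying an invariant law of the filter *)

Section belief_processes.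
Context (R : realType) dX dY dV (X : measurableType dX) (Y : measurableType dY)
  (V : measurableType dV).
Variables (T : R.-pker X ~> X) (nu : probability V R) (G : X * V -> Y)
  (Q : R.-pker X ~> Y).
Hypothesis mG : measurable_fun setT G.
Hypothesis QE : forall x C, measurable C -> Q x C = nu [set v | C (G (x, v))].

Let PX : measurableType _ := pprobability X R.
Let E : measurableType _ := (PX * X * V)%type.

Variable Phi : PX * Y -> PX.
Hypothesis mPhi : measurable_fun setT Phi.
Hypothesis update : forall (p : probability X R) A C, measurable A -> measurable C ->
  (\int[p]_x \int[T x]_x' \int[Q x']_(y in C) (Phi (p, y) : probability X R) A =
   \int[p]_x \int[T x]_(x' in A) Q x' C)%E.

(* In such a stationary joint process the belief is the conditional law of the
   state. *)
Definition belief_law (L : probability (paths int E) R) :=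
  stationary_markov (joint_kernel T nu mG mPhi) L /\
  forall t, disint L (belief t) (state t) (id_kernel R X).

(** All the defining identities are linear in the law, their kernels being the same for every
    summand. *)
Lemma belief_law_mavg P N : (forall n, belief_law (P n)) -> belief_law (mavg P N).
Proof.
move=> PL; split.
  split.
    move=> t h mh h0.
    have m1 : measurable_fun setT (fun w : paths int E => h (pastp t w, w (t + 1))).
      apply: (measurableT_comp mh); apply: measurable_fun_pair.
        exact: measurable_pastp.
      exact: measurable_coord.
    have m2 : measurable_fun setT (fun w : paths int E =>
        \int[joint_kernel T nu mG mPhi (pastp t w 0%N)]_b h (pastp t w, b))%E.
      apply: (measurableT_comp (measurable_integral_kernel
        (kmap (joint_kernel T nu mG mPhi) (@measurable_coord nat _ E 0%N)) mh h0)).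
      exact: measurable_pastp.
    rewrite !ge0_integral_mavg//; last by move=> w; exact: integral_ge0.
    by congr (_ * _)%E; apply: eq_bigr => j _; rewrite (PL j).1.1.
  move=> t S mS; rewrite [LHS]mavgE [RHS]mavgE; congr (_ * _)%E; apply: eq_bigr => j _.
  exact: (PL j).1.2.
move=> t h mh h0.
have m1 : measurable_fun setT (fun w : paths int E => h (belief t w, state t w)).
  apply: (measurableT_comp mh); apply: measurable_fun_pair.
    exact: measurable_belief.
  exact: measurable_state.
have m2 : measurable_fun setT (fun w : paths int E =>
    \int[id_kernel R X (belief t w)]_b h (belief t w, b))%E.
  apply: (measurableT_comp (measurable_integral_kernel (id_kernel R X) mh h0)).
  exact: measurable_belief.
rewrite !ge0_integral_mavg//; last by move=> w; exact: integral_ge0.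
by congr (_ * _)%E; apply: eq_bigr => j _; rewrite (PL j).2.
Qed.

Let Fupd (a : PX * (X * Y)) : PX := Phi (a.1, a.2.2).

Let mFupd : measurable_fun setT Fupd.
Proof.
apply: (measurableT_comp mPhi); apply: measurable_fun_pair; first exact: measurable_fst.
by apply: measurableT_comp; [exact: measurable_snd|exact: measurable_snd].
Qed.

Lemma integral_belief_obs_update (p : PX) S : measurable S ->
  (\int[belief_obs_kernel T Q p]_xy (\1_S (Phi (p, xy.2)))%:E =
   \int[(p : probability X R)]_x \int[T x]_x' Q x' [set y | S (Phi (p, y))])%E.
Proof.
move=> mS.
have mi : measurable_fun setT (fun xy : X * Y => (\1_S (Phi (p, xy.2)))%:E : \bar R).
  apply/measurable_EFinP; apply: (@measurableT_comp _ _ _ _ _ _ (\1_S : PX -> R)).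
    exact: measurable_indic.
  exact: (measurableT_comp mFupd (@pair1_measurable _ _ PX (X * Y)%type p)).
rewrite ge0_integral_belief_obs//; apply: eq_integral => x _.
rewrite ge0_integral_state_obs//; apply: eq_integral => x' _.
transitivity (\int[Q x']_y (\1_[set y | S (Phi (p, y))] y)%:E)%E; first by [].
apply: integral_indicT.
exact: (preimage_measurable (measurableT_comp mPhi (@pair1_measurable _ _ PX Y p)) mS).
Qed.

Section invariant_belief.
Variable mu : probability PX R.
Hypothesis inv : forall S, measurable S -> (mu S = \int[mu]_p
  \int[(p : probability X R)]_x \int[T x]_x' Q x' [set y | S (Phi (p, y))])%E.

Let ge0_integral_inv (h : PX -> \bar R) : measurable_fun setT h ->
  (forall p, 0 <= h p)%E ->
  (\int[mu]_p \int[belief_obs_kernel T Q p]_xy h (Phi (p, xy.2)) = \int[mu]_p h p)%E.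
Proof.
move=> mh h0.
transitivity (\int[mbind mu (kpush (belief_obs_kernel T Q) mFupd)]_p h p)%E.
  rewrite ge0_integral_mbind//; apply: eq_integral => p _.
  by rewrite ge0_integral_kpush.
apply: eq_measure_integral => S mS _; rewrite [RHS](inv mS); apply: eq_integral => p _.
rewrite -integral_belief_obs_update//.
have mS' : measurable [set xy : X * Y | S (Phi (p, xy.2))].
  exact: (preimage_measurable (measurableT_comp mFupd (@pair1_measurable _ _ PX (X * Y)%type p)) mS).
transitivity (\int[belief_obs_kernel T Q p]_xy (\1_[set xy : X * Y | S (Phi (p, xy.2))] xy)%:E)%E; last by [].
by rewrite (integral_indicT _ mS').
Qed.

Let mu2 := mbind mu (kgraph (id_kernel R X)).

Let ge0_integral_mu2 (h : PX * X -> \bar R) : measurable_fun setT h ->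
  (forall px, 0 <= h px)%E ->
  (\int[mu2]_px h px = \int[mu]_p \int[id_kernel R X p]_x h (p, x))%E.
Proof.
move=> mh h0; rewrite ge0_integral_mbind//; apply: eq_integral => p _.
by rewrite ge0_integral_plaw.
Qed.

(** The process starts from [mu2], a belief of law [mu] with a state drawn from it. After one step
    the state is still distributed according to the updated belief, by Bayes' rule, so invariance of
    [mu] gives that of [mu2]. *)
Lemma exists_belief_law : coded X -> coded V ->
  exists2 L, belief_law L &
    forall t S, measurable S -> L (belief t @^-1` S) = mu S.
Proof.
move=> cX cV.
have [|L sL LE] := @exists_joint_process R _ _ _ X Y V T nu G mG Phi mPhi mu2 cX cV.
  move=> h mh h0.
  have mK : measurable_fun setT (fun p : PX => \int[id_kernel R X p]_x h (p, x))%E.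
    exact: measurable_integral_kernel.
  have K0 (p : PX) : (0 <= \int[id_kernel R X p]_x h (p, x))%E by exact: integral_ge0.
  have mhf : measurable_fun setT (fun z : E => h z.1).
    by apply: (measurableT_comp mh); exact: measurable_fst.
  pose J := joint_step T nu mG mPhi.
  have mJ : measurable_fun setT (fun px => \int[J px]_z h z.1)%E.
    by apply: (measurable_fun_integral_kernel (measurable_kernel J) _ mhf) => z; exact: h0.
  have J0 px : (0 <= \int[J px]_z h z.1)%E by exact: integral_ge0.
  rewrite [LHS](ge0_integral_mu2 mJ J0) [RHS](ge0_integral_mu2 mh h0).
  rewrite -(ge0_integral_inv mK K0); apply: eq_integral => p _.
  have mp : measurable_fun setT (fun xy : X * Y => h (Phi (p, xy.2), xy.1)).
    apply: (measurableT_comp mh); apply: measurable_fun_pair; last exact: measurable_fst.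
    exact: (measurableT_comp mFupd (@pair1_measurable _ _ PX (X * Y)%type p)).
  transitivity (\int[belief_obs_kernel T Q p]_xy h (Phi (p, xy.2), xy.1))%E.
    rewrite ge0_integral_belief_obs//; apply: eq_integral => x _.
    rewrite ge0_integral_joint_step// ge0_integral_state_obs//.
    apply: eq_integral => x' _.
    rewrite (ge0_integral_noise mG QE x' (h := fun y => h (Phi (p, y), x')))//.
    exact: (measurableT_comp mp (@pair1_measurable _ _ X Y x')).
  have mp' : measurable_fun setT (fun yx : Y * X => h (Phi (p, yx.1), yx.2)).
    apply: (measurableT_comp mh); apply: measurable_fun_pair; last exact: measurable_snd.
    apply: (measurableT_comp mPhi); apply: measurable_fun_pair; first exact: measurable_cst.
    exact: measurable_fst.
  (* Given the observation, the new state may be redrawn from the updated belief. *)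
  exact: (disint_update mPhi update p mp' (fun _ => h0 _)).
exists L; first split => //.
  move=> t h mh h0.
  have mK : measurable_fun setT (fun p : PX => \int[id_kernel R X p]_x h (p, x))%E.
    exact: measurable_integral_kernel.
  have K0 (p : PX) : (0 <= \int[id_kernel R X p]_x h (p, x))%E by exact: integral_ge0.
  transitivity (\int[L]_w h (w t).1)%E.
    by apply: eq_integral => w _; rewrite /belief /state -surjective_pairing.
  rewrite LE// [LHS](ge0_integral_mu2 mh h0).
  have mK1 : measurable_fun setT (fun px : PX * X => \int[id_kernel R X px.1]_x h (px.1, x))%E.
    by apply: (measurableT_comp mK); exact: measurable_fst.
  rewrite [RHS](LE t (fun px => \int[id_kernel R X px.1]_x h (px.1, x))%E)//.
  rewrite [RHS](ge0_integral_mu2 mK1)//; apply: eq_integral => p _ /=.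
  by rewrite integral_cst// [X in (_ * X)%E]probability_setT mule1.
move=> t S mS.
have mi : measurable_fun setT (fun px : PX * X => (\1_S px.1)%:E : \bar R).
  apply/measurable_EFinP.
  apply: (@measurableT_comp _ _ _ _ _ _ (\1_S : PX -> R)); last exact: measurable_fst.
  exact: measurable_indic.
have mb : measurable (belief t @^-1` S : set (paths int E)).
  exact: preimage_measurable (@measurable_belief _ _ _ _ _ t) mS.
transitivity (\int[L]_w (\1_(belief t @^-1` S) w)%:E)%E.
  by rewrite (integral_indicT _ mb).
transitivity (\int[L]_w (\1_S (w t).1.1)%:E)%E; first by [].
rewrite (LE t (fun px : PX * X => (\1_S px.1)%:E))// ge0_integral_mu2//.
transitivity (\int[mu]_p (\1_S p)%:E)%E.
  by apply: eq_integral => p _ /=; rewrite integral_cst// [X in (_ * X)%E]probability_setT mule1.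
exact: integral_indicT.
Qed.

End invariant_belief.
End belief_processes.

Lemma disint_ae d d1 d2 (Omega : measurableType d) (A : measurableType d1)
    (B : measurableType d2) (R : realType) (P : probability Omega R)
    (z z' : Omega -> A) (x : Omega -> B) (k : R.-pker A ~> B) :
  measurable_fun setT z -> measurable_fun setT z' -> measurable_fun setT x ->
  {ae P, forall w, indist (z w) (z' w)} -> disint P z x k -> disint P z' x k.
Proof.
move=> mz mz' mx zz' dz h mh h0.
have mI := measurable_integral_kernel k mh h0.
have I0 a : (0 <= \int[k a]_b h (a, b))%E by exact: integral_ge0.
transitivity (\int[P]_w h (z w, x w))%E.
  apply: ge0_ae_eq_integral => //.
  - by apply: (measurableT_comp mh); exact: measurable_fun_pair.
  - by apply: (measurableT_comp mh); exact: measurable_fun_pair.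
  - apply: filterS zz' => w zw _; apply: (indist_ereal mh).
    by apply: indist_pair => //; exact: indist_sym.
rewrite [LHS]dz//; apply: ge0_ae_eq_integral => //.
- exact: (measurableT_comp mI mz).
- exact: (measurableT_comp mI mz').
- by apply: filterS zz' => w zw _; exact: (indist_ereal mI).
Qed.

Section belief_process_facts.
Context (R : realType) dX dY dV (X : measurableType dX) (Y : measurableType dY)
  (V : measurableType dV).
Variables (T : R.-pker X ~> X) (nu : probability V R) (G : X * V -> Y)
  (Q : R.-pker X ~> Y).
Hypothesis mG : measurable_fun setT G.
Hypothesis QE : forall x C, measurable C -> Q x C = nu [set v | C (G (x, v))].

Let PX : measurableType _ := pprobability X R.
Let E : measurableType _ := (PX * X * V)%type.

Variable Phi : PX * Y -> PX.
Hypothesis mPhi : measurable_fun setT Phi.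

Section joint_process.
Variable L : probability (paths int E) R.
Hypothesis sL : stationary_markov (joint_kernel T nu mG mPhi) L.

Let mhead : measurable_fun setT (fun h : paths nat E => (h 0%N).1.2 : X).
Proof.
apply: (measurableT_comp (@measurable_snd _ _ PX X)).
by apply: (measurableT_comp (@measurable_fst _ _ (PX * X)%type V)); exact: measurable_coord.
Qed.

Lemma disint_state t :
  disint L (pastp t) (state (t + 1)) (kmap T mhead).
Proof.
move=> h mh h0.
transitivity (\int[L]_w h (pastp t w, (w (t + 1)%R).1.2))%E; first by [].
have mh' : measurable_fun setT (fun gz : paths nat E * E => h (gz.1, gz.2.1.2)).
  apply: (measurableT_comp mh); apply: measurable_fun_pair; first exact: measurable_fst.
  apply: (measurableT_comp (@measurable_snd _ _ PX X)).
  by apply: (measurableT_comp (@measurable_fst _ _ (PX * X)%type V)); exact: measurable_snd.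
rewrite (ge0_integral_next sL t mh' (fun _ => h0 _)); apply: eq_integral => w _.
rewrite /kmap pastp0; apply: eq_integral => x' _.
by rewrite /= integral_cst// [X in (_ * X)%E]probability_setT mule1.
Qed.

Lemma disint_noise t :
  disint L (fun w => (pastp t w, state (t + 1) w)) (noise (t + 1)) (fun=> nu).
Proof.
move=> h mh h0.
transitivity (\int[L]_w h ((pastp t w, (w (t + 1)%R).1.2), (w (t + 1)%R).2))%E; first by [].
have m12 : measurable_fun setT (fun gz : paths nat E * E => gz.2.1.2).
  apply: (measurableT_comp (@measurable_snd _ _ PX X)).
  by apply: (measurableT_comp (@measurable_fst _ _ (PX * X)%type V)); exact: measurable_snd.
have mh' : measurable_fun setT (fun gz : paths nat E * E => h ((gz.1, gz.2.1.2), gz.2.2)).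
  apply: (measurableT_comp mh); apply: measurable_fun_pair; last first.
    by apply: (measurableT_comp (@measurable_snd _ _ (PX * X)%type V)); exact: measurable_snd.
  by apply: measurable_fun_pair => //; exact: measurable_fst.
rewrite (ge0_integral_next sL t mh' (fun _ => h0 _)) /=.
have mI : measurable_fun setT (fun gx : paths nat E * X => \int[nu]_v h (gx, v))%E.
  exact: (measurable_integral_kernel (kprobability
    (@measurable_cst _ _ (paths nat E * X)%type (pprobability V R) setT nu)) mh h0).
have I0 gx : (0 <= \int[nu]_v h (gx, v))%E by exact: integral_ge0.
by rewrite [RHS](disint_state t mI I0); apply: eq_integral => w _; rewrite /kmap pastp0.
Qed.

(** The transition kernel gives no mass to the places where the new belief and the update differ on
    [A]; one event [A] at a time, since equality of beliefs need not be a measurable event. *)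
Lemma ae_belief_next t : coded X ->
  {ae L, forall w, indist (belief (t + 1) w) (Phi (belief t w, observation G (t + 1) w))}.
Proof.
move=> cX; apply: ae_countable_probability cX _ => A mA.
have mev : measurable_fun setT (fun p : PX => (p : probability X R) A).
  exact: (measurable_kernel (id_kernel R X) A mA).
pose f (gz : paths nat E * E) := (gz.2.1.1 : probability X R) A.
pose g (gz : paths nat E * E) :=
  (Phi ((gz.1 0%N).1.1, G (gz.2.1.2, gz.2.2)) : probability X R) A.
have m21 : measurable_fun setT (fun gz : paths nat E * E => gz.2.1).
  by apply: (measurableT_comp (@measurable_fst _ _ (PX * X)%type V)); exact: measurable_snd.
have mf : measurable_fun setT f.
  apply: (measurableT_comp mev).
  exact: (measurableT_comp (@measurable_fst _ _ PX X) m21).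
have mg : measurable_fun setT g.
  apply: (measurableT_comp mev); apply: (measurableT_comp mPhi); apply: measurable_fun_pair.
    apply: (measurableT_comp (@measurable_fst _ _ PX X)).
    apply: (measurableT_comp (@measurable_fst _ _ (PX * X)%type V)).
    by apply: measurable_fun_coord; exact: measurable_fst.
  apply: (measurableT_comp mG); apply: measurable_fun_pair.
    exact: (measurableT_comp (@measurable_snd _ _ PX X) m21).
  by apply: (measurableT_comp (@measurable_snd _ _ (PX * X)%type V)); exact: measurable_snd.
pose D := [set gz | f gz != g gz].
have mD : measurable D by rewrite -[X in measurable X]setTI; exact: measurable_neqe.
have mi : measurable_fun setT (fun gz : paths nat E * E => (\1_D gz)%:E : \bar R).
  exact/measurable_EFinP/measurable_indic.
have i0 gz : (0 <= (\1_D gz)%:E :> \bar R)%E by rewrite lee_fin.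
have mp : measurable_fun setT (fun w : paths int E => (pastp t w, w (t + 1))).
  by apply: measurable_fun_pair; [exact: measurable_pastp|exact: measurable_coord].
exists ((fun w => (pastp t w, w (t + 1))) @^-1` D); split.
- exact: preimage_measurable mp mD.
- transitivity (\int[L]_w (\1_D (pastp t w, w (t + 1)%R))%:E)%E.
    transitivity (\int[L]_w (\1_((fun w => (pastp t w, w (t + 1)%R)) @^-1` D) w)%:E)%E; last by [].
    apply/esym/integral_indicT.
    exact: preimage_measurable mp mD.
  rewrite (ge0_integral_next sL t mi i0).
  rewrite integral0_eq// => w _; rewrite integral0_eq// => x' _; rewrite integral0_eq// => v _.
  by rewrite indicE memNset// /D /f /g /= pastp0 => /negP; apply; apply/eqP.
- move=> w /= nD; rewrite /D /f /g /=; apply/negP => e; apply: nD.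
  by move: e; rewrite pastp0 => /eqP.
Qed.

End joint_process.
End belief_process_facts.

(** * The belief as a posterior given past observations and beliefs *)

Section posterior_beliefs.
Context (R : realType) dX dY dV (X : measurableType dX) (Y : measurableType dY)
  (V : measurableType dV).
Variables (T : R.-pker X ~> X) (nu : probability V R) (G : X * V -> Y)
  (Q : R.-pker X ~> Y).
Hypothesis mG : measurable_fun setT G.
Hypothesis QE : forall x C, measurable C -> Q x C = nu [set v | C (G (x, v))].

Let PX : measurableType _ := pprobability X R.
Let E : measurableType _ := (PX * X * V)%type.
Let PY : measurableType _ := (PX * Y)%type.

Variable Phi : PX * Y -> PX.
Hypothesis mPhi : measurable_fun setT Phi.
Hypothesis update : forall (p : probability X R) A C, measurable A -> measurable C ->
  (\int[p]_x \int[T x]_x' \int[Q x']_(y in C) (Phi (p, y) : probability X R) A =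
   \int[p]_x \int[T x]_(x' in A) Q x' C)%E.
Hypothesis codedX : coded X.
Variable L : probability (paths int E) R.
Hypothesis bL : belief_law T nu mG mPhi L.

Let obs := observation (V := V) (R := R) G.

Definition belief_past (t : int) (w : paths int E) : paths nat PY :=
  fun j => (belief (t - j%:Z) w, obs (t - j%:Z) w).

Lemma measurable_belief_past t : measurable_fun setT (belief_past t).
Proof.
apply: measurable_path => j; apply: measurable_fun_pair.
  exact: measurable_belief.
exact: (measurable_observation mG).
Qed.

(** This keeps exactly [n] entries, whereas [truncp n] keeps [n.+1]; the induction on windows can
    thus start from the empty one. *)
Let tr n (h : paths nat PY) : paths nat PY :=
  if n is m.+1 then truncp m h else fun=> point.

Let measurable_tr n : measurable_fun setT (tr n).
Proof. by case: n => [|n]; [exact: measurable_cst|exact: measurable_truncp]. Qed.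

Let tr_consp n h z : tr n.+1 (consp (h, z)) = consp (tr n h, z).
Proof.
case: n => [|n]; last exact: truncp_consp.
by apply/funext => -[|j].
Qed.

Let belief_pastS t w :
  belief_past (t + 1) w = consp (belief_past t w, (belief (t + 1) w, obs (t + 1) w)).
Proof.
apply/funext => -[|j]; first by rewrite /belief_past /= subr0.
by rewrite /belief_past /=; have -> : t + 1 - j.+1%:Z = t - j%:Z by lia.
Qed.

Let kfst : R.-pker (PX * paths nat PY)%type ~> X :=
  kmap (id_kernel R X) (@measurable_fst _ _ PX (paths nat PY)).

Let mbt n t : measurable_fun setT (fun w => (belief t w, tr n (belief_past t w)) : PX * paths nat PY).
Proof.
apply: measurable_fun_pair; first exact: measurable_belief.
by apply: measurableT_comp; [exact: measurable_tr|exact: measurable_belief_past].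
Qed.

(** With an empty window this is [belief_law]. A longer window at time [t] adds the new belief and
    observation to a window at the preceding time: Bayes' rule gives the law of the state given the
    old data and the observation, and it depends only on the new belief. The induction must
    therefore cover all times. *)
Let window n t :
  disint L (fun w => (belief t w, tr n (belief_past t w))) (state t) kfst.
Proof.
elim: n t => [|n IH] t.
  exact: (disint_map (f := fun p : PX => (p, point : paths nat PY)) _ _ (bL.2 t)).
have := IH (t - 1); set s := t - 1; have -> : t = s + 1 by rewrite /s; lia.
move: s => s ds.
pose f (h : paths nat E) : PX * paths nat PY :=
  ((h 0%N).1.1, tr n (fun j => ((h j).1.1, G ((h j).1.2, (h j).2)))).
have fE w : f (pastp s w) = (belief s w, tr n (belief_past s w)).
  by rewrite /f pastp0; congr (_, tr n _).
have mf : measurable_fun setT f.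
  apply: measurable_fun_pair.
    apply: (measurableT_comp (@measurable_fst _ _ PX X)).
    by apply: (measurableT_comp (@measurable_fst _ _ (PX * X)%type V)); exact: measurable_coord.
  apply: (measurableT_comp (measurable_tr n)); apply: measurable_path => j.
  have m1 : measurable_fun setT (fun h : paths nat E => (h j).1).
    by apply: (measurableT_comp (@measurable_fst _ _ (PX * X)%type V)); exact: measurable_coord.
  apply: measurable_fun_pair.
    exact: (measurableT_comp (@measurable_fst _ _ PX X) m1).
  apply: (measurableT_comp mG); apply: measurable_fun_pair.
    exact: (measurableT_comp (@measurable_snd _ _ PX X) m1).
  by apply: (measurableT_comp (@measurable_snd _ _ (PX * X)%type V)); exact: measurable_coord.
have dn := disint_next QE bL.1 s mf.
have fsE : (fun w => (f (pastp s w), state s w)) =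
    (fun w => ((belief s w, tr n (belief_past s w)), state s w)).
  by apply/funext => w; rewrite fE.
rewrite fsE in dn.
have [_ d1] := disint_filter_step mPhi update
  (mpi := @measurable_fst _ _ PX (paths nat PY)) ds dn.
pose g (a : (PX * paths nat PY) * Y) : PX * paths nat PY :=
  (Phi (a.1.1, a.2), consp (a.1.2, (Phi (a.1.1, a.2), a.2))).
have mP : measurable_fun setT (fun a : (PX * paths nat PY) * Y => Phi (a.1.1, a.2)).
  apply: (measurableT_comp mPhi); apply: measurable_fun_pair; last exact: measurable_snd.
  by apply: measurableT_comp; [exact: measurable_fst|exact: measurable_fst].
have mg : measurable_fun setT g.
  apply: measurable_fun_pair => //.
  apply: (measurableT_comp (@measurable_consp _ PY)); apply: measurable_fun_pair.
    by apply: measurableT_comp; [exact: measurable_snd|exact: measurable_fst].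
  by apply: measurable_fun_pair => //; exact: measurable_snd.
(* [g] forms the new belief and appends it to the window with the observation; the posterior is its
   first component, so it remains the conditional law given these data. *)
have d2 := disint_map (k' := kfst) mg (fun=> erefl) d1.
apply: disint_ae d2.
- apply: (measurableT_comp mg); apply: measurable_fun_pair; first exact: mbt.
  exact: (measurable_observation mG).
- exact: mbt.
- exact: measurable_state.
- apply: filterS (ae_belief_next bL.1 s codedX) => w bw.
  rewrite belief_pastS tr_consp; apply: indist_pair; first exact: indist_sym.
  apply: indist_map; first exact: measurable_consp.
  apply: indist_pair; first exact: indist_refl.
  by apply: indist_pair; [exact: indist_sym|exact: indist_refl].
Qed.

Let mhead : measurable_fun setT (fun h : paths nat PY => (h 0%N).1 : PX).
Proof. by apply: (measurableT_comp (@measurable_fst _ _ PX Y)); exact: measurable_coord. Qed.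

(** Events determined by finitely many past entries generate the past, and each of them is covered
    by a window. *)
Lemma disint_belief_past t :
  disint L (belief_past t) (state t) (kmap (id_kernel R X) mhead).
Proof.
apply: (@disintP _ _ _ _ _ _ R (boxes setT (fun i (h : paths nat PY) => h i : PY))).
- exact: measurable_pathE.
- exact: boxes_setI_closed.
- exact: boxes_setT.
- exact: measurable_belief_past.
- exact: measurable_state.
move=> S C bS mC.
have mS : measurable S by rewrite measurable_pathE; exact: sub_sigma_algebra.
have [n Sn] := boxes_truncp bS.
have mS' : measurable (setT `*` S : set (PX * paths nat PY)) by exact: measurableX.
have E1 : belief_past t @^-1` S =
    (fun w => (belief t w, tr n.+1 (belief_past t w))) @^-1` (setT `*` S).
  apply/seteqP; split => w /=.
    move=> Sw; split; [exact: I|exact: ((Sn (belief_past t w)).1 Sw)].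
  by move=> [_ Sw]; exact: ((Sn (belief_past t w)).2 Sw).
rewrite {1}E1 (disint_set (mbt n.+1 t) _ (window n.+1 t) mS' mC)//; last exact: measurable_state.
rewrite -E1; apply: eq_integral => w _.
by rewrite /kfst /kmap /belief_past /= subr0.
Qed.

(** This is a function of the belief at time [m] and the later observations only, hence a version of
    the belief measurable for the distant beliefs and the observations. *)
Fixpoint iterated_update m n (w : paths int E) : PX :=
  if n is k.+1 then Phi (iterated_update m k w, obs (m + k.+1%:Z) w)
  else belief m w.

Lemma ae_iterated_update m n :
  {ae L, forall w, indist (belief (m + n%:Z) w) (iterated_update m n w)}.
Proof.
elim: n => [|n IH]; first by apply: aeW => w; rewrite addr0; exact: indist_refl.
apply: filterS2 IH (ae_belief_next bL.1 (m + n%:Z) codedX) => w bw.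
have -> : m + n%:Z + 1 = m + n.+1%:Z by lia.
move=> bw'; apply: indist_trans bw' _ => /=; apply: (indist_map mPhi).
by apply: indist_pair => //; exact: indist_refl.
Qed.

(** [iterated_update] supplies the measurable version. The integral identity is inherited from the
    conditional law given the full past of beliefs and observations, which contains the conditioning
    events. *)
Lemma belief_cond_prob t m : m <= t -> forall A, measurable A ->
  cond_prob L (past obs t `|` past (@belief R _ _ X V) m) (state t @^-1` A)
    (fun w => (belief t w : probability X R) A).
Proof.
move=> mt A mA; set Gs := _ `|` _.
have [n tE] : exists n : nat, t = m + n%:Z by exists `|t - m|%N; lia.
exists (fun w => (iterated_update m n w : probability X R) A).
have mev : measurable_fun setT (fun p : PX => (p : probability X R) A).
  exact: (measurable_kernel (id_kernel R X) A mA).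
have mGs k : (k <= n)%N ->
    measurable_fun setT (iterated_update m k : g_sigma_algebraType Gs -> PX).
  elim: k => [_|k IH kn].
    move=> _ C mC; rewrite setTI; apply: sub_sigma_algebra; right; exists m => //=.
    by exists C => //; rewrite setTI.
  apply: (measurableT_comp mPhi); apply: measurable_fun_pair; first by apply: IH; exact: ltnW.
  move=> _ C mC; rewrite setTI; apply: sub_sigma_algebra; left.
  exists (m + k.+1%:Z); first by rewrite /= tE lerD2l lez_nat.
  by exists C => //; rewrite setTI.
split.
- exact: (measurableT_comp mev (mGs n (leqnn n))).
- move=> S GS.
  have : preimage_set_system setT (belief_past t) measurable S.
    move: S GS; apply: smallest_sub.
      apply: sigma_algebra_preimage; exact: sigma_algebra_measurable.
    have coord s : s <= t -> exists j : nat, s = t - j%:Z by exists `|t - s|%N; lia.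
    move=> S [[s /= st [C mC <-]]|[s /= sm [C mC <-]]].
      have [j sE] := coord s st.
      exists ((fun h : paths nat PY => (h j).2) @^-1` C).
        apply: preimage_measurable mC.
        by apply: (measurableT_comp (@measurable_snd _ _ PX Y)); exact: measurable_coord.
      by rewrite !setTI; apply/seteqP; split => w; rewrite /belief_past /= -sE.
    have [j sE] := coord s (le_trans sm mt).
    exists ((fun h : paths nat PY => (h j).1) @^-1` C).
      apply: preimage_measurable mC.
      by apply: (measurableT_comp (@measurable_fst _ _ PX Y)); exact: measurable_coord.
    by rewrite !setTI; apply/seteqP; split => w; rewrite /belief_past /= -sE.
  move=> [S' mS' <-]; rewrite setTI setIC.
  rewrite (disint_set (measurable_belief_past t) (@measurable_state _ _ _ _ _ t)
    (disint_belief_past t) mS' mA).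
  have mS : measurable (belief_past t @^-1` S').
    exact: preimage_measurable (measurable_belief_past t) mS'.
  apply: ge0_ae_eq_integral => //.
  + apply: measurable_funTS; apply: (measurableT_comp mev).
    apply: (measurableT_comp mhead); exact: measurable_belief_past.
  + apply: measurable_funTS; apply: (measurableT_comp mev).
    have m_iter k : measurable_fun setT (iterated_update m k).
      elim: k => [|k IH]; first exact: measurable_belief.
      apply: (measurableT_comp mPhi); apply: measurable_fun_pair => //.
      exact: (measurable_observation mG).
    exact: m_iter.
  + apply: filterS (ae_iterated_update m n) => w; rewrite -tE => bw _.
    by rewrite /kmap /belief_past /= subr0; exact: indist_pprob.
- apply: filterS (ae_iterated_update m n) => w; rewrite -tE => bw.
  exact: indist_pprob.
Qed.

End posterior_beliefs.

(** * Uniqueness of the invariant law of the filter *)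

Section history_measurability.
Variables (R : realType) (Y : completePseudoMetricType R).
Hypothesis polishY : polish Y.

Let box (U : nat -> set Y) (u : seq nat) : set (nat -> Y) :=
  [set h | forall i, (i < size u)%N -> U (nth 0%N u i) (h i)].

(** An open set of the product is the union of the countably many basic boxes contained in it. If a
    point of it lay in none, boxes shrinking around more and more of its coordinates would yield
    points outside the open set converging to it coordinatewise. *)
Lemma measurable_history d (A : measurableType d) (f : A -> borel (history Y)) :
  (forall i, measurable_fun setT (fun a => f a i : borel Y)) -> measurable_fun setT f.
Proof.
move=> mf; have [U [oU bU]] := countable_base polishY.2.
apply: (@measurability _ _ _ _ setT f (@open (history Y))) => //.
move=> _ [W oW <-]; rewrite setTI.
have -> : f @^-1` W = \bigcup_(u in [set u | box U u `<=` W]) (f @^-1` box U u).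
  apply/seteqP; split => [a Wa|a [u uW ua]]; last exact: uW.
  apply: contrapT => nO.
  have H n : exists h : nat -> Y, (forall i, (i < n)%N -> ball (f a i) (n.+1%:R^-1 : R) (h i)) /\ ~ W h.
    have Ui i : exists k, U k (f a i) /\ U k `<=` ball (f a i) (n.+1%:R^-1 : R).
      by apply: bU; apply: nbhsx_ballx.
    have [k kU] := choice Ui.
    apply: contrapT => nH; apply: nO; exists (mkseq k n) => /=; last first.
      by move=> i; rewrite size_mkseq => ik; rewrite nth_mkseq//; exact: (kU i).1.
    move=> h hu; apply: contrapT => nOh; apply: nH; exists h; split => // i ik.
    by apply: (kU i).2; have := hu i; rewrite size_mkseq nth_mkseq//; exact.
  have [hs hsP] := choice H.
  have : {ptws, hs @ \oo --> f a}.
    apply/pointwise_cvgP => i.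
    change (hs n i @[n --> \oo] --> (f a i : Y)); apply/cvg_ballP => e e0.
    near=> n.
    apply: (@le_ball _ _ _ (n.+1%:R^-1)); last first.
      by apply: (hsP n).1; near: n; exact: nbhs_infty_gt.
    apply: ltW; near: n; exact: (near_infty_natSinv_lt (PosNum e0)).
  move=> /(_ W) cO.
  have : nbhs (hs @ \oo) W by apply: cO; exact: open_nbhs_nbhs.
  move=> [n _ /(_ n (leqnn n))] /=.
  exact: (hsP n).2.
rewrite bigcup_mkcond; apply: countable_bigcupT_measurable => // u.
case: ifP => _ //.
have -> : f @^-1` box U u = \bigcap_(i < size u) ((fun a => f a i : borel Y) @^-1` U (nth 0%N u i)).
  by apply/seteqP; split.
apply: bigcap_measurableType => i _; apply: preimage_measurable (mf i) _.
by apply: sub_sigma_algebra; exact: oU.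
Unshelve. all: by end_near. Qed.

End history_measurability.

Section joint_model.
Variables (R : realType) (X Y V : completePseudoMetricType R).
Variables (T : R.-pker (borel X) ~> (borel X)) (nu : probability (borel V) R)
  (G : borel X * borel V -> borel Y) (mG : measurable_fun setT G).

Let PX : measurableType _ := pprobability (borel X) R.
Let E : measurableType _ := (PX * borel X * borel V)%type.

Variables (Phi : PX * borel Y -> PX) (mPhi : measurable_fun setT Phi).
Variable L : probability (paths int E) R.
Hypothesis sL : stationary_markov (joint_kernel T nu mG mPhi) L.

Definition path_filtration (t : int) : set (set (paths int E)) :=
  preimage_set_system setT (pastp t) measurable.

Let beheadpE (t : int) (w : paths int E) : beheadp (pastp (t + 1) w) = pastp t w.
Proof. by apply/funext => j; rewrite /beheadp /pastp; congr w; lia. Qed.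

Let path_filtration_coord t d' (C : measurableType d') (f : E -> C) S :
  measurable_fun setT f -> measurable S ->
  path_filtration t ((fun w => f (w t)) @^-1` S).
Proof.
move=> mf mS; exists ((fun h : paths nat E => f (h 0%N)) @^-1` S).
  by apply: preimage_measurable mS; apply: (measurableT_comp mf); exact: measurable_coord.
by rewrite setTI; apply/seteqP; split => w; rewrite /preimage /= pastp0.
Qed.

Lemma joint_hidden_markov : hidden_markov T nu L path_filtration
  (@state R _ _ (borel X) (borel V)) (@noise R _ _ (borel X) (borel V)).
Proof.
split.
- move=> t; apply: sigma_algebra_preimage; exact: sigma_algebra_measurable.
- by move=> t _ [S mS <-]; apply: measurable_pastp.
- move=> t _ [S mS <-]; exists (@beheadp _ E @^-1` S).
    exact: preimage_measurable (@measurable_beheadp _ E) mS.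
  by rewrite !setTI; apply/seteqP; split => w; rewrite /preimage /= beheadpE.
- move=> t B mB; apply: (@path_filtration_coord t _ _ (fun z : E => z.1.2)) mB.
  apply: (measurableT_comp (@measurable_snd _ _ PX (borel X))).
  exact: (@measurable_fst _ _ (PX * borel X)%type (borel V)).
- move=> t B mB; apply: (@path_filtration_coord t _ _ (fun z : E => z.2)) mB.
  exact: (@measurable_snd _ _ (PX * borel X)%type (borel V)).
- move=> t B S mB [S' mS' <-]; rewrite setTI.
  rewrite (disint_set (@measurable_pastp _ E t) (measurable_state _) (disint_state sL t) mS' mB).
  by apply: eq_integral => w _; rewrite /kmap pastp0.
- move=> t D S mD FS.
  have mps : measurable_fun setT (fun w : paths int E => (pastp t w, state (t + 1) w)).
    by apply: measurable_fun_pair; [exact: measurable_pastp|exact: measurable_state].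
  have : preimage_set_system setT (fun w : paths int E => (pastp t w, state (t + 1) w)) measurable S.
    move: S FS; apply: smallest_sub.
      apply: sigma_algebra_preimage; exact: sigma_algebra_measurable.
    move=> _ [[S mS <-]|[S mS <-]]; rewrite setTI.
      exists (S `*` setT); first exact: measurableX.
      by rewrite setTI; apply/seteqP; split => w //= [].
    exists (setT `*` S); first exact: measurableX.
    by rewrite setTI; apply/seteqP; split => w //= [].
  move=> [S' mS' <-]; rewrite setTI.
  rewrite (disint_set mps (measurable_noise _) (disint_noise sL t) mS' mD).
  rewrite integral_cst; last exact: preimage_measurable mps mS'.
  by rewrite muleC.
Qed.

Lemma joint_stationary : stationary L (@state R _ _ (borel X) (borel V)).
Proof.
move=> n s B mB.
(* A common upper bound of the times [s i]: the event then concerns the past at [t], whose law is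
   shift invariant. *)
pose t : int := \sum_(i < n) `|s i|.
have st i : s i <= t.
  apply: le_trans (ler_norm _) _; rewrite /t (bigD1 i)//= lerDl.
  exact: sumr_ge0.
pose S := [set h : paths nat E | forall i, B i (h `|t - s i|%N).1.2].
have mS : measurable S.
  have -> : S = \bigcap_(i in [set: 'I_n]) ((fun h : paths nat E => (h `|t - s i|%N).1.2) @^-1` B i).
    by apply/seteqP; split => h /= hS i; [move=> _; exact: hS|exact: hS].
  apply: fin_bigcap_measurable => // i _; apply: preimage_measurable (mB i).
  apply: (measurableT_comp (@measurable_snd _ _ PX (borel X))).
  apply: (measurableT_comp (@measurable_fst _ _ (PX * borel X)%type (borel V))).
  exact: measurable_coord.
have E1 u : u = 0 \/ u = 1 -> \bigcap_(i in [set: 'I_n]) (state (s i + u) @^-1` B i) =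
    pastp (t + u) @^-1` S.
  move=> _; apply/seteqP; split => w /= wS i.
    have := wS i I; rewrite /state /pastp /=.
    by have -> : t + u - `|t - s i|%N%:Z = s i + u by have := st i; lia.
  move=> _; have := wS i; rewrite /state /pastp /=.
  by have -> : t + u - `|t - s i|%N%:Z = s i + u by have := st i; lia.
have E0 : \bigcap_(i in [set: 'I_n]) (state (s i) @^-1` B i) = pastp t @^-1` S.
  have := E1 0 (or_introl erefl); rewrite addr0 => <-.
  by apply: eq_bigcapr => i _; rewrite addr0.
by rewrite E1 ?E0; [rewrite sL.2// [RHS]sL.2|right].
Qed.

Hypothesis polishY : polish Y.

Let obs_history (h : paths nat E) : borel (history Y) :=
  fun j => G ((h j).1.2, (h j).2).

Let measurable_obs_history : measurable_fun setT obs_history.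
Proof.
apply: measurable_history => // i; apply: (measurableT_comp mG); apply: measurable_fun_pair.
  apply: (measurableT_comp (@measurable_snd _ _ PX (borel X))).
  by apply: (measurableT_comp (@measurable_fst _ _ (PX * borel X)%type (borel V))); exact: measurable_coord.
by apply: (measurableT_comp (@measurable_snd _ _ (PX * borel X)%type (borel V))); exact: measurable_coord.
Qed.

Let joint_obs_past := obs_past G (@state R _ _ (borel X) (borel V)) (@noise R _ _ (borel X) (borel V)).

Lemma measurable_joint_obs_past t : measurable_fun setT (joint_obs_past t).
Proof. by apply: (measurableT_comp measurable_obs_history); exact: measurable_pastp. Qed.

Lemma joint_history_invariant : history_invariant T nu G (plaw L (measurable_joint_obs_past 0)).
Proof.
exists _, _, L, path_filtration, (@state R _ _ (borel X) (borel V)), (@noise R _ _ (borel X) (borel V)).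
split; first exact: joint_hidden_markov.
move=> t S mS; apply: (sL.2 t (obs_history @^-1` S)).
exact: preimage_measurable measurable_obs_history mS.
Qed.

End joint_model.

Lemma measure_preimage_ae d d' (Omega : measurableType d) (A : measurableType d')
    (R : realType) (P : probability Omega R) (f g : Omega -> A) S :
  measurable_fun setT f -> measurable_fun setT g ->
  {ae P, forall w, indist (f w) (g w)} -> measurable S ->
  P (f @^-1` S) = P (g @^-1` S).
Proof.
move=> mf mg fg mS.
have mfS := preimage_measurable mf mS; have mgS := preimage_measurable mg mS.
rewrite -[f @^-1` S]setIT -[g @^-1` S]setIT -!integral_indic//.
apply: ge0_ae_eq_integral => //.
- exact/measurable_EFinP/measurable_indic.
- exact/measurable_EFinP/measurable_indic.
have [N [mN N0 sN]] := fg; exists N; split => // w nw; apply: sN => fgw; apply: nw => _.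
congr ((nat_of_bool _)%:R%:E).
by apply/idP/idP => /set_mem Sw; apply/mem_set; apply/(fgw S mS).
Qed.

(** Each summand is absolutely continuous with respect to the mean. *)
Lemma ae_mavg d (Omega : measurableType d) (R : realType)
    (P : nat -> probability Omega R) N (Q : Omega -> Prop) j : (j <= N)%N ->
  {ae mavg P N, forall w, Q w} -> {ae P j, forall w, Q w}.
Proof.
move=> jN [S [mS S0 QS]]; exists S; split => //.
move: S0; rewrite /mavg /mscale /= => /eqP; rewrite mule_eq0 => /orP[|].
  by rewrite eqe invr_eq0 pnatr_eq0.
rewrite /msum => /eqP sum0; apply/eqP; rewrite eq_le measure_ge0 andbT -sum0.
rewrite (bigD1 (Ordinal (jN : (j < N.+1)%N)))//=.
by rewrite leeDl// sume_ge0.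
Qed.

Section filter_uniqueness.
Variables (R : realType) (X Y V : completePseudoMetricType R).
Hypotheses (polishX : polish X) (polishY : polish Y) (polishV : polish V).
Variables (T : R.-pker (borel X) ~> (borel X)) (nu : probability (borel V) R)
  (G : borel X * borel V -> borel Y) (mG : measurable_fun setT G)
  (Q : R.-pker (borel X) ~> (borel Y)).
Hypothesis QE : forall x C, measurable C -> Q x C = nu [set v | C (G (x, v))].

Let PX : measurableType _ := pprobability (borel X) R.
Let E : measurableType _ := (PX * borel X * borel V)%type.

Variables (Phi : PX * borel Y -> PX) (mPhi : measurable_fun setT Phi).
Hypothesis update : forall (p : probability (borel X) R) A C, measurable A -> measurable C ->
  (\int[p]_x \int[T x]_x' \int[Q x']_(y in C) (Phi (p, y) : probability _ R) A =
   \int[p]_x \int[T x]_(x' in A) Q x' C)%E.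

Let Xp := @state R _ _ (borel X) (borel V).
Let Vp := @noise R _ _ (borel X) (borel V).
Let pit := @belief R _ _ (borel X) (borel V).

Lemma belief_filter_process (L : probability (paths int E) R) :
  belief_law T nu mG mPhi L ->
  filter_process T nu G L (@path_filtration R X V) Xp Vp pit.
Proof.
move=> bL; split.
- exact: joint_hidden_markov bL.1.
- move=> t S mS; exists ((fun h : paths nat E => (h 0%N).1.1) @^-1` S).
    apply: preimage_measurable mS; apply: (measurableT_comp (@measurable_fst _ _ PX (borel X))).
    apply: (measurableT_comp (@measurable_fst _ _ (PX * borel X)%type (borel V))).
    exact: measurable_coord.
  by rewrite setTI; apply/seteqP; split => w; rewrite /preimage /= pastp0.
- move=> t m mt A mA.
  exact: (belief_cond_prob QE update (coded_polish polishX) bL mt mA).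
Qed.

Hypothesis Y_uniquely_ergodic : obs_uniquely_ergodic T nu G.
Hypothesis filter_measurable :
  forall (d' : measure_display) (Omega' : measurableType d')
    (P' : probability Omega' R) (F' : int -> set (set Omega'))
    (Xp' : int -> Omega' -> borel X) (Vp' : int -> Omega' -> borel V)
    (pit' : int -> Omega' -> pprobability (borel X) R),
    filter_process T nu G P' F' Xp' Vp' pit' ->
    stationary_or_posterior G P' Xp' Vp' ->
    filter_obs_measurable G P' Xp' Vp' pit'.

Lemma filter_invariant_unique (mu mu' : probability PX R) :
  filter_invariant T Q Phi mu -> filter_invariant T Q Phi mu' ->
  forall S, measurable S -> mu S = mu' S.
Proof.
move=> inv inv'.
have cX := coded_polish polishX; have cV := coded_polish polishV.
have [L bL LE] := exists_belief_law mG QE mPhi update inv cX cV.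
have [L' bL' LE'] := exists_belief_law mG QE mPhi update inv' cX cV.
(* [mavg P 1] is the average of [L] and [L']. *)
pose P n := if n is 0%N then L else L'.
have bP : belief_law T nu mG mPhi (mavg P 1) by apply: belief_law_mavg => -[|n].
have sP : stationary (mavg P 1) Xp by exact: joint_stationary bP.1.
(* Measurability of the filter is applied to the averaged process, whose state is stationary; the
   same [g] then serves [L] and [L']. *)
have [g [mg gP]] :=
  filter_measurable (belief_filter_process bP) (or_introl sP) 0.
have ae_g := ae_countable_probability cX gP.
have mo := measurable_joint_obs_past mG polishY 0.
have mgo : measurable_fun setT (fun w => g (obs_past G Xp Vp 0 w)).
  exact: (measurableT_comp mg mo).
have [lambda [_ lambdaP]] := Y_uniquely_ergodic.
(* The belief at time 0 is the image under [g] of a history whose law is [lambda] for both values of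
   [j]. *)
have law j S : (j <= 1)%N -> stationary_markov (joint_kernel T nu mG mPhi) (P j) ->
    measurable S -> P j (pit 0 @^-1` S) = lambda (g @^-1` S).
  move=> j1 sPj mS.
  have mgS := preimage_measurable mg mS.
  rewrite -(lambdaP _ (joint_history_invariant sPj polishY) _ mgS).
  apply/esym; apply: (@measure_preimage_ae _ _ _ _ R (P j) _ _ S mgo) => //.
    exact: measurable_belief.
  exact: ae_mavg j1 ae_g.
move=> S mS.
rewrite -(LE 0)// -(LE' 0)//.
by rewrite (law 0%N S isT bL.1 mS) (law 1%N S isT bL'.1 mS).
Qed.

End filter_uniqueness.

(** * Existence of an invariant law of the filter *)

Section filter_existence.
Context (R : realType) dX dY dV (X : measurableType dX) (Y : measurableType dY)
  (V : measurableType dV).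
Variables (T : R.-pker X ~> X) (nu : probability V R) (G : X * V -> Y)
  (Q : R.-pker X ~> Y).
Hypothesis mG : measurable_fun setT G.
Hypothesis QE : forall x C, measurable C -> Q x C = nu [set v | C (G (x, v))].

Let PX : measurableType _ := pprobability X R.
Let E : measurableType _ := (PX * X * V)%type.

Variable Phi : PX * Y -> PX.
Hypothesis mPhi : measurable_fun setT Phi.
Hypothesis update : forall (p : probability X R) A C, measurable A -> measurable C ->
  (\int[p]_x \int[T x]_x' \int[Q x']_(y in C) (Phi (p, y) : probability X R) A =
   \int[p]_x \int[T x]_(x' in A) Q x' C)%E.
Hypotheses (codedX : coded X) (codedV : coded V).
Variable p0 : probability X R.
Hypothesis inv_p0 : forall S, measurable S -> (\int[p0]_x T x S = p0 S)%E.

(* The first projection is used as a dummy belief update, which keeps the belief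
   constant: only the states and the observations of the joint process matter. *)
Let K := joint_kernel T nu mG (@measurable_fst _ _ PX Y).

Let exists_state_process : exists L : probability (paths int E) R, stationary_markov K L.
Proof.
pose q0 : PX := p0.
have [|L sL _] := @exists_joint_process R _ _ _ X Y V T nu G mG fst
    (@measurable_fst _ _ PX Y) (plaw p0 (@pair1_measurable _ _ PX X q0)) codedX codedV;
  last by exists L.
move=> h mh h0.
have mh1 : measurable_fun setT (fun x : X => h (q0, x)).
  exact: (measurableT_comp mh (@pair1_measurable _ _ PX X q0)).
have mhf : measurable_fun setT (fun z : E => h z.1).
  by apply: (measurableT_comp mh); exact: measurable_fst.
pose J := joint_step T nu mG (@measurable_fst _ _ PX Y).
have mJ : measurable_fun setT (fun px => \int[J px]_z h z.1)%E.
  by apply: (measurable_fun_integral_kernel (measurable_kernel J) _ mhf) => z; exact: h0.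
have J0 px : (0 <= \int[J px]_z h z.1)%E by exact: integral_ge0.
rewrite [LHS](ge0_integral_plaw p0 _ mJ J0) [RHS](ge0_integral_plaw p0 _ mh h0).
transitivity (\int[mbind p0 T]_x h (q0, x))%E; last first.
  by apply: eq_measure_integral => S mS _; exact: inv_p0.
rewrite ge0_integral_mbind//; apply: eq_integral => x _.
rewrite ge0_integral_joint_step//; apply: eq_integral => x' _ /=.
by rewrite integral_cst// [X in (_ * X)%E]probability_setT mule1.
Qed.

Lemma exists_filter_invariant : exists mu : probability PX R,
  forall S, measurable S -> (mu S = \int[mu]_p
    \int[(p : probability X R)]_x \int[T x]_x' Q x' [set y | S (Phi (p, y))])%E.
Proof.
have [L sL] := exists_state_process.
pose obs := observation (V := V) (R := R) G.
pose H (h : paths nat E) : paths nat Y := fun j => G ((h j).1.2, (h j).2).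
have m1 j : measurable_fun setT (fun h : paths nat E => (h j).1.2).
  apply: (measurableT_comp (@measurable_snd _ _ PX X)).
  by apply: (measurableT_comp (@measurable_fst _ _ (PX * X)%type V)); exact: measurable_coord.
have mH : measurable_fun setT H.
  apply: measurable_path => j; apply: (measurableT_comp mG); apply: measurable_fun_pair => //.
  by apply: (measurableT_comp (@measurable_snd _ _ (PX * X)%type V)); exact: measurable_coord.
pose hist (t : int) (w : paths int E) : paths nat Y := H (pastp t w).
have mhist t : measurable_fun setT (hist t).
  by apply: (measurableT_comp mH); exact: measurable_pastp.
have hist1 w : hist (0 + 1) w = consp (hist 0 w, obs (0 + 1) w).
  apply/funext => -[|j]; rewrite /hist /H /pastp /= ?subr0//.
  by have -> : (0 + 1 - j.+1%:Z = 0 - j%:Z) by lia.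
have [g mg dg] := exists_disint L (mhist 0) (@measurable_state _ _ _ _ _ 0) codedX.
pose kg := kprobability mg.
have d0 : disint L (hist 0) (state 0) kg by exact: dg.
have dn := disint_next QE sL 0 mH.
have [d1 d2] := disint_filter_step mPhi update d0 dn.
(* By stationarity the posterior [g] found at time 0 is also a posterior at time 1. *)
have ds : disint L (hist (0 + 1)) (state (0 + 1)) kg.
  move=> h mh h0.
  have mF : measurable_fun setT (fun b : paths nat E => h (H b, (b 0%N).1.2)).
    by apply: (measurableT_comp mh); exact: measurable_fun_pair.
  have mK' : measurable_fun setT (fun b : paths nat E => \int[kg (H b)]_x h (H b, x))%E.
    exact: (measurableT_comp (measurable_integral_kernel kg mh h0) mH).
  have shift := integral_comp_plaw (@measurable_pastp _ E (0 + 1)) (@measurable_pastp _ E 0)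
    (P := L) (P' := L) (sL.2 _).
  transitivity (\int[L]_w h (H (pastp (0 + 1)%R w), (pastp (0 + 1)%R w 0%N).1.2))%E.
    by apply: eq_integral => w _; rewrite pastp0.
  rewrite (shift (fun b => h (H b, (b 0%N).1.2)))//.
  transitivity (\int[L]_w h (hist 0%R w, state 0%R w))%E.
    by apply: eq_integral => w _; rewrite pastp0.
  rewrite d0//.
  by rewrite [RHS](shift (fun b => \int[kg (H b)]_x h (H b, x))%E)// => b; exact: integral_ge0.
have mhead : measurable_fun setT (fun h : paths nat Y => h 0%N : Y) by exact: measurable_coord.
have mpost : measurable_fun setT (fun h : paths nat Y => Phi (g (beheadp h), h 0%N)).
  apply: (measurableT_comp mPhi); apply: measurable_fun_pair => //.
  by apply: (measurableT_comp mg); exact: measurable_beheadp.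
(* Bayes' rule gives a second posterior at time 1, a function of the same history; uniqueness of
   conditional laws identifies it with [g]. *)
have d3 : disint L (hist (0 + 1)) (state (0 + 1)) (kprobability mpost).
  have -> : hist (0 + 1) = fun w => consp (hist 0 w, obs (0 + 1) w) by apply/funext.
  exact: (disint_map (k' := kprobability mpost) (@measurable_consp _ Y) _ d2).
have ae_post : {ae L, forall w, indist (g (hist (0 + 1) w)) (Phi (g (hist 0 w), obs (0 + 1) w))}.
  apply: ae_countable_probability codedX _ => A mA.
  apply: filterS (disint_unique (mhist _) (@measurable_state _ _ _ _ _ _) ds d3 mA) => w.
  by rewrite {2}hist1.
exists (plaw L (measurableT_comp mg (mhist 0))) => S mS.
have mT : measurable_fun setT (fun p : PX =>
    \int[belief_obs_kernel T Q p]_xy (\1_S (Phi (p, xy.2)))%:E)%E.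
  apply: (measurable_integral_kernel (belief_obs_kernel T Q)
    (h := fun a : PX * (X * Y) => (\1_S (Phi (a.1, a.2.2)))%:E)) => //.
  apply/measurable_EFinP; apply: (@measurableT_comp _ _ _ _ _ _ (\1_S : PX -> R)).
    exact: measurable_indic.
  apply: (measurableT_comp mPhi); apply: measurable_fun_pair; first exact: measurable_fst.
  by apply: measurableT_comp; [exact: measurable_snd|exact: measurable_snd].
transitivity (\int[plaw L (measurableT_comp mg (mhist 0%R))]_p
    \int[belief_obs_kernel T Q p]_xy (\1_S (Phi (p, xy.2)))%:E)%E; last first.
  by apply: eq_integral => p _; exact: integral_belief_obs_update.
rewrite [RHS](ge0_integral_plaw L _ mT); last by move=> p; exact: integral_ge0.
have mgH : measurable_fun setT (g \o H) by exact: measurableT_comp.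
have mPg : measurable_fun setT (fun w => Phi (g (hist 0 w), obs (0 + 1) w)).
  apply: (measurableT_comp mPhi); apply: measurable_fun_pair; last exact: measurable_observation.
  exact: (measurableT_comp mg (mhist 0)).
transitivity (L ((fun w => g (hist (0 + 1) w)) @^-1` S)).
  apply/esym; exact: (sL.2 (0 + 1) _ (preimage_measurable mgH mS)).
rewrite (measure_preimage_ae (measurableT_comp mg (mhist (0 + 1))) mPg ae_post mS).
transitivity (\int[L]_w (\1_S (Phi (g (hist 0%R w), obs (0 + 1)%R w)))%:E)%E.
  transitivity (\int[L]_w (\1_((fun w => Phi (g (hist 0%R w), obs (0 + 1)%R w)) @^-1` S) w)%:E)%E;
    last by [].
  by rewrite integral_indicT//; exact: preimage_measurable mPg mS.
have mi : measurable_fun setT (fun a : paths nat Y * (X * Y) => (\1_S (Phi (g a.1, a.2.2)))%:E : \bar R).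
  apply/measurable_EFinP; apply: (@measurableT_comp _ _ _ _ _ _ (\1_S : PX -> R)).
    exact: measurable_indic.
  apply: (measurableT_comp mPhi); apply: measurable_fun_pair.
    by apply: (measurableT_comp mg); exact: measurable_fst.
  by apply: measurableT_comp; [exact: measurable_snd|exact: measurable_snd].
by rewrite (d1 _ mi (fun _ => _)) => // a; rewrite lee_fin.
Qed.

End filter_existence.

Theorem corollary2 (R : realType) (X Y U V : completePseudoMetricType R)
    (polishX : polish X) (polishY : polish Y) (polishU : polish U)
    (polishV : polish V)
    (compactX : compact [set: X]) (compactY : compact [set: Y])
    (compactU : compact [set: U])
    (* the model *)
    (T : R.-pker (borel X) ~> (borel X)) (nu : probability (borel V) R)
    (G : borel X * borel V -> borel Y) (mG : measurable_fun setT G)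
    (Q : R.-pker (borel X) ~> (borel Y))
    (QE : forall x C, measurable C -> Q x C = nu [set v | C (G (x, v))])
    (cT : weakly_continuous (fun x : X => T x))
    (cQ : weakly_continuous (fun x : X => Q x))
    (* the given realization of the state, noise and filter processes *)
    (d : measure_display) (Omega : measurableType d) (P : probability Omega R)
    (F : int -> set (set Omega)) (Xp : int -> Omega -> borel X)
    (Vp : int -> Omega -> borel V)
    (pit : int -> Omega -> pprobability (borel X) R)
    (filter_pit : filter_process T nu G P F Xp Vp pit)
    (SBD : stationary_or_posterior G P Xp Vp)
    (* unique ergodicity of the measurements *)
    (Y_uniquely_ergodic : obs_uniquely_ergodic T nu G)
    (* sigma(Y_(-oo,t])-measurability of the filter, whatever its distant
       prior beliefs *)
    (filter_measurable :
      forall (d' : measure_display) (Omega' : measurableType d')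
        (P' : probability Omega' R) (F' : int -> set (set Omega'))
        (Xp' : int -> Omega' -> borel X) (Vp' : int -> Omega' -> borel V)
        (pit' : int -> Omega' -> pprobability (borel X) R),
        filter_process T nu G P' F' Xp' Vp' pit' ->
        stationary_or_posterior G P' Xp' Vp' ->
        filter_obs_measurable G P' Xp' Vp' pit')
    (* the belief update, which determines the transition kernel *)
    (Phi : pprobability (borel X) R * borel Y -> pprobability (borel X) R)
    (updatePhi : filter_update T Q Phi) :
  exactly_one_probability (filter_invariant T Q Phi).
Proof.
have [mPhi update] := updatePhi.
have cX := coded_polish polishX; have cV := coded_polish polishV.
have [p0 inv_p0] := krylov_bogoliubov polishX compactX cT.
have [mu inv] := exists_filter_invariant mG QE mPhi update cX cV inv_p0.
exists mu; split => // mu' inv' S mS.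
exact: (filter_invariant_unique polishX polishY polishV mG QE mPhi update
  Y_uniquely_ergodic filter_measurable inv' inv mS).
Qed.
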